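(* Let $X\neq\{0\}$ be a complex Banach space with open unit ball $B$, let $0\le\alpha<1$, and let $f\in Q_B^{\alpha}(B)$, i.e. $f$ is a normalized quasi-convex mapping of type B and order $\alpha$ on $B$. Then for every $x\in B\setminus\{0\}$ and every $T_x\in T(x)$, $$\left|T_x\left(\frac{D^3f(0)(x^3)}{3!}\right)-\frac{2}{3}\,T_x\left(\frac{D^2f(0)}{2!}\left(x,\frac{D^2f(0)(x^2)}{2!}\right)\right)\right|\le\frac{1-\alpha}{3}\|x\|^3 .$$ This inequality is sharp: for each such $X$ and $\alpha$, the constant $\frac{1-\alpha}{3}$ cannot be replaced by a smaller one valid for all $f\in Q_B^\alpha(B)$, all $x\in B\setminus\{0\}$ and all $T_x\in T(x)$.
   Context: $X$ is a complex Banach space with norm $\|\cdot\|$ and $B=\{x\in X:\|x\|<1\}$. For $x\in X\setminus\{0\}$, $T(x)=\{T_x\in X^*:\|T_x\|=1,\ T_x(x)=\|x\|\}$. For holomorphic $f:B\to X$, $D^mf(x)$ denotes the $m$-th Fréchet derivative at $x$ (a bounded symmetric $m$-linear map $X^m\to X$), $D^mf(x)(y^m)=D^mf(x)(y,\dots,y)$, and $\frac{D^2f(0)}{2!}(x,y)=\frac12 D^2f(0)(x,y)$. A holomorphic $f$ is normalized if $f(0)=0$ and $Df(0)=I$, and locally biholomorphic if $Df(x)$ has a bounded inverse for each $x\in B$. For $\alpha\in[0,1)$, $Q_B^\alpha(B)$ (quasi-convex mappings of type B and order $\alpha$) is the family of normalized locally biholomorphic mappings $f:B\to X$ such that $$\mathrm{Re}\{T_x[(Df(x))^{-1}(D^2f(x)(x^2)+Df(x)x)]\}\ge\alpha\|x\|$$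 for all $x\in B\setminus\{0\}$ and all $T_x\in T(x)$. *)

(* Defs.v *)
From Stdlib Require Import Reals Factorial Lra ProofIrrelevance FunctionalExtensionality ClassicalEpsilon.
From Coquelicot Require Import Coquelicot.

Open Scope R_scope.

Section BoundedLinear.

Context {U V : NormedModule C_AbsRing}.

Definition blin : Type := {l : U -> V | is_linear l}.

Definition blin_fun (A : blin) : U -> V := proj1_sig A.

Lemma blin_ext (A B : blin) :
  (forall x, blin_fun A x = blin_fun B x) -> A = B.
Proof.
destruct A as [a Ha], B as [b Hb]; simpl; intros E.
assert (a = b) as <- by (apply functional_extensionality; exact E).
now rewrite (proof_irrelevance _ Ha Hb).
Qed.

(** [‖A‖ = sup {‖A x‖ : ‖x‖ <= 1}]; the supremum is finite for bounded [A]
    ([opnorm_is_lub]), so that [real] loses nothing. *)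
Definition opnorm (l : U -> V) : R :=
  real (Lub_Rbar (fun r => exists x : U, norm x <= 1 /\ r = norm (l x))).

Lemma opnorm_is_lub (l : U -> V) : is_linear l ->
  is_lub_Rbar (fun r => exists x : U, norm x <= 1 /\ r = norm (l x)) (opnorm l).
Proof.
intros [_ _ [M [HM Hl]]]; unfold opnorm.
set (E := fun r => exists x : U, norm x <= 1 /\ r = norm (l x)).
assert (H := Lub_Rbar_correct E).
assert (H0 := proj1 H (norm (l zero))).
assert (HM' := proj2 H (Finite M)).
destruct (Lub_Rbar E) as [r| |]; simpl in *; [exact H| |].
- exfalso; apply HM'; intros r [x [Hx ->]]; simpl.
  apply Rle_trans with (1 := Hl x).
  rewrite <- (Rmult_1_r M) at 2.
  apply Rmult_le_compat_l; lra.
- exfalso; apply H0; exists zero; split; [|reflexivity].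
  rewrite norm_zero; lra.
Qed.

Lemma opnorm_ub (l : U -> V) (x : U) : is_linear l ->
  norm x <= 1 -> norm (l x) <= opnorm l.
Proof.
intros Hl Hx; apply (proj1 (opnorm_is_lub l Hl) (norm (l x))).
now exists x.
Qed.

Lemma opnorm_least (l : U -> V) (M : R) : is_linear l ->
  (forall x, norm x <= 1 -> norm (l x) <= M) -> opnorm l <= M.
Proof.
intros Hl HM; apply (proj2 (opnorm_is_lub l Hl) (Finite M)).
intros r [x [Hx ->]]; exact (HM x Hx).
Qed.

Lemma opnorm_bound (l : U -> V) (x : U) : is_linear l ->
  norm (l x) <= opnorm l * norm x.
Proof.
intros Hl.
destruct (Req_dec (norm x) 0) as [H0|H0].
- rewrite (norm_eq_zero x H0), (linear_zero l Hl), !norm_zero; lra.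
- assert (Hp : 0 < norm x) by (generalize (norm_ge_0 x); lra).
  assert (Hs : forall W : NormedModule C_AbsRing, forall (t : R) (w : W),
             0 <= t -> norm (scal (RtoC t : C_AbsRing) w) <= t * norm w).
  { intros W t w Ht.
    apply Rle_trans with (1 := norm_scal _ _).
    change (abs (RtoC t : C_AbsRing)) with (Cmod (RtoC t)).
    rewrite Cmod_R, Rabs_pos_eq; lra. }
  assert (Ht : 0 < / norm x) by (apply Rinv_0_lt_compat; exact Hp).
  set (y := scal (RtoC (/ norm x) : C_AbsRing) x).
  assert (Hy : norm y <= 1).
  { apply Rle_trans with (1 := Hs _ (/ norm x) x (Rlt_le _ _ Ht)).
    right; field; lra. }
  assert (Hx : x = scal (RtoC (norm x) : C_AbsRing) y).
  { unfold y; rewrite scal_assoc.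
    change (mult (RtoC (norm x) : C_AbsRing) (RtoC (/ norm x)))
      with (Cmult (RtoC (norm x)) (RtoC (/ norm x))).
    rewrite <- RtoC_mult, Rinv_r by lra.
    symmetry; apply (scal_one x). }
  rewrite Hx at 1; rewrite (linear_scal l Hl).
  apply Rle_trans with (1 := Hs _ (norm x) (l y) (norm_ge_0 x)).
  rewrite Rmult_comm; apply Rmult_le_compat_r; [apply norm_ge_0|].
  now apply opnorm_ub.
Qed.

Lemma opnorm_ge_0 (l : U -> V) : is_linear l -> 0 <= opnorm l.
Proof.
intros Hl; apply Rle_trans with (norm (l zero)); [apply norm_ge_0|].
apply opnorm_ub; [exact Hl|rewrite norm_zero; lra].
Qed.

Lemma blin_plus_proof (l m : U -> V) : is_linear l -> is_linear m ->
  is_linear (fun x => plus (l x) (m x)).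
Proof.
intros Hl Hm.
apply (is_linear_comp (fun x => (l x, m x)) (fun p : V * V => plus (fst p) (snd p))).
- now apply is_linear_prod.
- exact is_linear_plus.
Qed.

Lemma blin_opp_proof (l : U -> V) : is_linear l -> is_linear (fun x => opp (l x)).
Proof.
intros Hl; apply (is_linear_comp l opp Hl); exact is_linear_opp.
Qed.

Lemma blin_scal_proof (k : C_AbsRing) (l : U -> V) : is_linear l ->
  is_linear (fun x => scal k (l x)).
Proof.
intros Hl; apply (is_linear_comp l (fun x => scal k x) Hl).
apply is_linear_scal_r; intros n m; exact (Cmult_comm n m).
Qed.

Definition blin_plus (A B : blin) : blin :=
  exist _ _ (blin_plus_proof _ _ (proj2_sig A) (proj2_sig B)).
Definition blin_opp (A : blin) : blin :=
  exist _ _ (blin_opp_proof _ (proj2_sig A)).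
Definition blin_zero : blin := exist _ (fun _ => zero) is_linear_zero.
Definition blin_scal (k : C_AbsRing) (A : blin) : blin :=
  exist _ _ (blin_scal_proof k _ (proj2_sig A)).

Lemma blin_plus_comm A B : blin_plus A B = blin_plus B A.
Proof. apply blin_ext; intros x; apply plus_comm. Qed.
Lemma blin_plus_assoc A B D :
  blin_plus A (blin_plus B D) = blin_plus (blin_plus A B) D.
Proof. apply blin_ext; intros x; apply plus_assoc. Qed.
Lemma blin_plus_zero_r A : blin_plus A blin_zero = A.
Proof. apply blin_ext; intros x; apply plus_zero_r. Qed.
Lemma blin_plus_opp_r A : blin_plus A (blin_opp A) = blin_zero.
Proof. apply blin_ext; intros x; apply (plus_opp_r (blin_fun A x)). Qed.

Definition blin_AbelianMonoid_mixin :=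
  AbelianMonoid.Mixin blin blin_plus blin_zero
    blin_plus_comm blin_plus_assoc blin_plus_zero_r.
Canonical blin_AbelianMonoid :=
  AbelianMonoid.Pack blin blin_AbelianMonoid_mixin blin.

Definition blin_AbelianGroup_mixin :=
  AbelianGroup.Mixin blin_AbelianMonoid blin_opp blin_plus_opp_r.
Canonical blin_AbelianGroup :=
  AbelianGroup.Pack blin
    (AbelianGroup.Class blin blin_AbelianMonoid_mixin blin_AbelianGroup_mixin) blin.

Lemma blin_scal_assoc (j k : C_AbsRing) A :
  blin_scal j (blin_scal k A) = blin_scal (mult j k) A.
Proof. apply blin_ext; intros x; apply scal_assoc. Qed.
Lemma blin_scal_one A : blin_scal one A = A.
Proof. apply blin_ext; intros x; apply (scal_one (blin_fun A x)). Qed.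
Lemma blin_scal_distr_l (k : C_AbsRing) A B :
  blin_scal k (blin_plus A B) = blin_plus (blin_scal k A) (blin_scal k B).
Proof. apply blin_ext; intros x; apply (scal_distr_l k (blin_fun A x)). Qed.
Lemma blin_scal_distr_r (j k : C_AbsRing) A :
  blin_scal (plus j k) A = blin_plus (blin_scal j A) (blin_scal k A).
Proof. apply blin_ext; intros x; apply (scal_distr_r j k (blin_fun A x)). Qed.

Definition blin_ModuleSpace_mixin :=
  ModuleSpace.Mixin C_AbsRing blin_AbelianGroup blin_scal
    blin_scal_assoc blin_scal_one blin_scal_distr_l blin_scal_distr_r.
Canonical blin_ModuleSpace :=
  ModuleSpace.Pack C_AbsRing blin
    (ModuleSpace.Class C_AbsRing blin (AbelianGroup.class blin_AbelianGroup)
       blin_ModuleSpace_mixin) blin.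

Definition blin_norm (A : blin) : R := opnorm (blin_fun A).

Lemma blin_norm_triangle (A B : blin) :
  blin_norm (plus A B) <= blin_norm A + blin_norm B.
Proof.
apply opnorm_least; [exact (proj2_sig (blin_plus A B))|].
intros x Hx; apply Rle_trans with (1 := norm_triangle _ _).
apply Rplus_le_compat; apply opnorm_ub; auto.
- exact (proj2_sig A).
- exact (proj2_sig B).
Qed.

Lemma blin_norm_scal (k : C_AbsRing) (A : blin) :
  blin_norm (scal k A) <= abs k * blin_norm A.
Proof.
apply opnorm_least; [exact (proj2_sig (blin_scal k A))|].
intros x Hx; apply Rle_trans with (1 := norm_scal _ _).
apply Rmult_le_compat_l; [apply abs_ge_0|].
apply opnorm_ub; [exact (proj2_sig A)|exact Hx].
Qed.

Lemma blin_norm_eq_zero (A : blin) : blin_norm A = 0 -> A = zero.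
Proof.
intros H; apply blin_ext; intros x; apply norm_eq_zero.
assert (Hx := opnorm_bound (blin_fun A) x (proj2_sig A)).
unfold blin_norm in H; rewrite H, Rmult_0_l in Hx.
apply Rle_antisym; [exact Hx|apply norm_ge_0].
Qed.

Definition blin_ball (A : blin) (eps : R) (B : blin) : Prop :=
  blin_norm (minus B A) < eps.

Lemma blin_ball_center (A : blin) (e : posreal) : blin_ball A e A.
Proof.
unfold blin_ball; rewrite minus_eq_zero.
apply Rle_lt_trans with 0; [|apply cond_pos].
apply opnorm_least; [exact (proj2_sig blin_zero)|].
intros x _; right; apply (norm_zero (V := V)).
Qed.

Lemma blin_ball_sym (A B : blin) (e : R) : blin_ball A e B -> blin_ball B e A.
Proof.
unfold blin_ball; apply Rle_lt_trans.
rewrite <- (opp_minus B A).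
apply opnorm_least; [exact (proj2_sig (opp (minus B A)))|].
intros x Hx; change (norm (opp (blin_fun (minus B A) x)) <= blin_norm (minus B A)).
rewrite norm_opp; apply opnorm_ub; [exact (proj2_sig (minus B A))|exact Hx].
Qed.

Lemma blin_ball_triangle (A B D : blin) (e1 e2 : R) :
  blin_ball A e1 B -> blin_ball B e2 D -> blin_ball A (e1 + e2) D.
Proof.
unfold blin_ball; intros H1 H2.
rewrite (minus_trans B D A), Rplus_comm.
apply Rle_lt_trans with (1 := blin_norm_triangle _ _); lra.
Qed.

Definition blin_UniformSpace_mixin :=
  UniformSpace.Mixin blin zero blin_ball
    blin_ball_center blin_ball_sym blin_ball_triangle.
Canonical blin_UniformSpace :=
  UniformSpace.Pack blin blin_UniformSpace_mixin blin.

Canonical blin_NormedModuleAux :=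
  NormedModuleAux.Pack C_AbsRing blin
    (NormedModuleAux.Class C_AbsRing blin
       (ModuleSpace.class C_AbsRing blin_ModuleSpace) blin_UniformSpace_mixin) blin.

Lemma blin_norm_ball1 (A B : blin) (eps : R) :
  blin_norm (minus B A) < eps -> ball A eps B.
Proof. exact (fun H => H). Qed.

Lemma blin_norm_ball2 (A B : blin) (eps : posreal) :
  ball A eps B -> blin_norm (minus B A) < 1 * eps.
Proof. rewrite Rmult_1_l; exact (fun H => H). Qed.

Definition blin_NormedModule_mixin :=
  NormedModule.Mixin C_AbsRing blin_NormedModuleAux blin_norm 1
    blin_norm_triangle blin_norm_scal blin_norm_ball1 blin_norm_ball2
    blin_norm_eq_zero.
Canonical blin_NormedModule :=
  NormedModule.Pack C_AbsRing blin
    (NormedModule.Class C_AbsRing blin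
       (NormedModuleAux.class C_AbsRing blin_NormedModuleAux)
       blin_NormedModule_mixin) blin.

End BoundedLinear.

Arguments blin : clear implicits.
Arguments blin_NormedModule : clear implicits.
Coercion blin_fun : blin >-> Funclass.

Section Frechet.

Context {U V : NormedModule C_AbsRing}.

(** Meaningful only where [f] is differentiable, the derivative then being
    unique; otherwise an unspecified bounded linear map. *)
Definition frechet (f : U -> V) (x : U) : blin U V :=
  epsilon (inhabits blin_zero) (fun A : blin U V => filterdiff f (locally x) A).

Lemma frechet_correct (f : U -> V) (x : U) :
  ex_filterdiff f (locally x) -> filterdiff f (locally x) (frechet f x).
Proof.
intros [l Hl]; unfold frechet; apply epsilon_spec.
exists (exist _ l (proj1 Hl)); exact Hl.
Qed.

End Frechet.

(** [multi X m] is [L(X, L(X, ... L(X, X)))], isometric to the space of bounded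
    [m]-linear maps [X^m -> X]. *)
Fixpoint multi (X : NormedModule C_AbsRing) (m : nat) : NormedModule C_AbsRing :=
  match m with
  | O => X
  | S m' => blin_NormedModule X (multi X m')
  end.

Fixpoint diag {X : NormedModule C_AbsRing} (m : nat) : multi X m -> X -> X :=
  match m return multi X m -> X -> X with
  | O => fun A _ => A
  | S m' => fun A y => diag m' (blin_fun A y) y
  end.

Fixpoint Dm {X : NormedModule C_AbsRing} (m : nat) (f : X -> X) : X -> multi X m :=
  match m return X -> multi X m with
  | O => f
  | S m' => frechet (Dm m' f)
  end.

(** Maps [B -> X] are represented by total functions [X -> X], of which only the
    values on the open unit ball matter: the ball is open, so derivatives at its
    points depend on nothing else. *)

Section QuasiConvex.

Context {X : NormedModule C_AbsRing}.

Definition unit_ball (x : X) : Prop := norm x < 1.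

Definition holomorphic (f : X -> X) : Prop :=
  forall x : X, unit_ball x -> ex_filterdiff f (locally x).

Definition support_functional (x : X) (T : blin X C_NormedModule) : Prop :=
  norm T = 1 /\ T x = RtoC (norm x).

Definition is_inverse (A G : blin X X) : Prop :=
  (forall y, G (A y) = y) /\ (forall y, A (G y) = y).

(** Unspecified when [A] has no bounded inverse. *)
Definition inverse (A : blin X X) : blin X X :=
  epsilon (inhabits blin_zero) (is_inverse A).

Lemma inverse_correct (A : blin X X) :
  (exists G, is_inverse A G) -> is_inverse A (inverse A).
Proof. apply epsilon_spec. Qed.

Definition normalized (f : X -> X) : Prop :=
  f zero = zero /\ forall y : X, frechet f zero y = y.

Definition locally_biholomorphic (f : X -> X) : Prop :=
  holomorphic f /\
  forall x : X, unit_ball x -> exists G : blin X X, is_inverse (frechet f x) G.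

Definition quasi_convex_B (alpha : R) (f : X -> X) : Prop :=
  normalized f /\ locally_biholomorphic f /\
  forall (x : X) (T : blin X C_NormedModule),
    unit_ball x -> x <> zero -> support_functional x T ->
    alpha * norm x <=
      Re (T (inverse (frechet f x) (plus (diag 2 (Dm 2 f x) x) (frechet f x x)))).

(** [T_x(D^3 f(0)(x^3)/3!) - (2/3) T_x((D^2 f(0)/2!)(x, D^2 f(0)(x^2)/2!))] *)
Definition third_functional (f : X -> X) (x : X) (T : blin X C_NormedModule) : C :=
  Cminus
    (T (scal (RtoC (/ INR (fact 3)) : C_AbsRing) (diag 3 (Dm 3 f zero) x)))
    (Cmult (RtoC (2 / 3))
       (T (scal (RtoC (/ INR (fact 2)) : C_AbsRing)
             (blin_fun (blin_fun (Dm 2 f zero) x)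
                (scal (RtoC (/ INR (fact 2)) : C_AbsRing) (diag 2 (Dm 2 f zero) x)))))).

End QuasiConvex.

(* Main.v *)
Require Import Defs.
From mathcomp Require classical_sets.
From Stdlib Require Import Reals Lra Lia List.
From Stdlib Require Import ClassicalEpsilon FunctionalExtensionality PropExtensionality.
From Coquelicot Require Import Coquelicot.
Import ListNotations.
Open Scope R_scope.

(** Put [u = x / |x|] and [q(z) = Df(zu)^-1 (D^2 f(zu)(u, u))]. Rotating [T] shows that
    [P(z) = 1 + z T(q(z))] satisfies [Re P >= alpha] on the unit disc, and differentiating
    [q] at [0] identifies the coefficient of [z^2] in [P] with six times the functional to
    be estimated (at [u]). So the bound is Carathéodory's inequality
    [|p_2| <= 2 (1 - alpha)] for that coefficient.

    That [Df] and [D^2 f] are again differentiable needs Cauchy's theory for maps between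
    Banach spaces that are merely differentiable. All of it comes from one inequality:
    [|F(0)| <= sup |F|] over a circle, for [F] continuous at [0] and differentiable in the
    punctured disc. Applied to [(F(z) - F(0)) / z] this bounds [F'(0)]; applied to
    differences [f(y + w) - f(y)] it bounds the variation of [Df] and hence the Taylor
    remainder; and [Df(.)v] is differentiable as a locally uniform limit of difference
    quotients.

    For sharpness take [f(x) = phi(tau x) x] with [tau] a norming functional. Then
    [1 + z h''/h'] with [h = z phi] plays the role of [P]. The extremal choice would be
    [h' = (1 - z^2)^(- (1 - alpha))]; Taylor polynomials of its dilations avoid
    transcendental functions and come arbitrarily close to the constant. Their zeros are
    controlled by the Eneström-Kakeya theorem. *)

(** * Linear equations in modules *)

(** The extremal [h'] comes from the equality case [P(z) = alpha + (1 - alpha) (1 + z^2) / (1 -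
    z^2)] of Carathéodory's inequality: solving [1 + z h''/h' = P] gives
    [h''/h' = 2 (1 - alpha) z / (1 - z^2)], hence the stated power. Truncating it could violate
    [Re P >= alpha]. Dilating first, that is replacing [z^2] by [q z^2] with [q < 1], raises the
    lower bound for [Re P] to [alpha + (1 - alpha) (1 - q) / (1 + q)]; this margin absorbs the
    truncation error, and the price is a factor [q] in the constant attained. For maps of the form
    [phi(tau x) x] the vector in the definition of quasi-convexity is a multiple of [x], so the
    condition is the same for every support functional. On the analytic side, the Taylor remainder
    is bounded by a constant that depends only on a radius and on a bound of the map. Such bounds
    survive limits and are uniform over directions [v] in the unit ball, which lifts the
    differentiability of each [Df(.)v] to that of [Df] in operator norm. Operators into a Banach
    space form a Banach space again, so the same theorem applied to [Df] gives the differentiability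
    of [D^2 f]. *)

Section ModuleTactic.

Context {V : ModuleSpace C_AbsRing}.

Inductive mexpr : Type :=
| MZero | MAtom (n : nat) | MPlus (a b : mexpr) | MOpp (a : mexpr)
| MScal (k : C) (a : mexpr).

Fixpoint meval (l : list V) (e : mexpr) : V :=
  match e with
  | MZero => zero
  | MAtom n => nth n l zero
  | MPlus a b => plus (meval l a) (meval l b)
  | MOpp a => opp (meval l a)
  | MScal k a => scal (k : C_AbsRing) (meval l a)
  end.

Fixpoint mcoef (e : mexpr) (n : nat) : C :=
  match e with
  | MZero => 0%C
  | MAtom m => if Nat.eqb m n then 1%C else 0%C
  | MPlus a b => Cplus (mcoef a n) (mcoef b n)
  | MOpp a => Copp (mcoef a n)
  | MScal k a => Cmult k (mcoef a n)
  end.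

Fixpoint mcomb (l : list V) (c : nat -> C) : V :=
  match l with
  | [] => zero
  | x :: l => plus (scal (c O : C_AbsRing) x) (mcomb l (fun n => c (S n)))
  end.

Lemma mcomb_ext l c d : (forall n, (n < length l)%nat -> c n = d n) -> mcomb l c = mcomb l d.
Proof.
revert c d; induction l as [|x l IH]; intros c d H; [reflexivity|]; simpl.
rewrite (H O) by (simpl; lia); f_equal; apply IH.
intros n Hn; apply H; simpl; lia.
Qed.

Lemma mcomb_zero l : mcomb l (fun _ => 0%C) = zero.
Proof.
induction l as [|x l IH]; [reflexivity|]; simpl; rewrite IH, plus_zero_r.
exact (scal_zero_l x).
Qed.

Lemma mcomb_plus l c d :
  mcomb l (fun n => Cplus (c n) (d n)) = plus (mcomb l c) (mcomb l d).
Proof.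
revert c d; induction l as [|x l IH]; intros c d; simpl.
- now rewrite plus_zero_r.
- rewrite (IH (fun n => c (S n)) (fun n => d (S n))).
  transitivity (plus (plus (scal (c O : C_AbsRing) x) (scal (d O : C_AbsRing) x))
    (plus (mcomb l (fun n => c (S n))) (mcomb l (fun n => d (S n))))).
  + f_equal; exact (scal_distr_r (c O : C_AbsRing) (d O) x).
  + rewrite <- !plus_assoc; f_equal.
    rewrite !plus_assoc; f_equal; apply plus_comm.
Qed.

Lemma mcomb_scal l k c :
  mcomb l (fun n => Cmult k (c n)) = scal (k : C_AbsRing) (mcomb l c).
Proof.
revert c; induction l as [|x l IH]; intros c; simpl.
- now rewrite scal_zero_r.
- rewrite (IH (fun n => c (S n))), scal_distr_l; f_equal.
  exact (eq_sym (scal_assoc (k : C_AbsRing) (c O) x)).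
Qed.

Lemma mcomb_atom l m :
  mcomb l (fun n => if Nat.eqb m n then 1%C else 0%C) = nth m l zero.
Proof.
revert m; induction l as [|x l IH]; intros [|m]; simpl; try reflexivity.
- rewrite mcomb_zero, plus_zero_r; exact (scal_one x).
- rewrite (IH m).
  transitivity (plus zero (nth m l zero)); [|apply plus_zero_l].
  f_equal; exact (scal_zero_l x).
Qed.

Lemma meval_mcomb l e : meval l e = mcomb l (mcoef e).
Proof.
induction e as [|m|a IHa b IHb|a IHa|k a IHa]; simpl.
- symmetry; apply mcomb_zero.
- symmetry; apply mcomb_atom.
- rewrite IHa, IHb; symmetry; apply (mcomb_plus l (mcoef a) (mcoef b)).
- rewrite IHa, <- (scal_opp_one (mcomb l (mcoef a))).
  transitivity (mcomb l (fun n => Cmult (Copp 1) (mcoef a n))).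
  + symmetry; apply (mcomb_scal l (Copp 1)).
  + apply mcomb_ext; intros n _; ring.
- rewrite IHa; symmetry; apply mcomb_scal.
Qed.

(** Written as an iterated conjunction so that, on a concrete list of atoms, [simpl; repeat split]
    leaves one equation in [C] per atom. *)
Fixpoint eq_upto (n : nat) (c d : nat -> C) : Prop :=
  match n with
  | O => True
  | S n => c O = d O /\ eq_upto n (fun k => c (S k)) (fun k => d (S k))
  end.

Lemma eq_upto_spec n c d : eq_upto n c d -> forall k, (k < n)%nat -> c k = d k.
Proof.
revert c d; induction n as [|n IH]; intros c d H k Hk; [lia|].
destruct H as [H0 H]; destruct k as [|k]; [exact H0|].
apply (IH (fun k => c (S k)) (fun k => d (S k)) H); lia.
Qed.

Lemma mexpr_eq l a b : eq_upto (length l) (mcoef a) (mcoef b) -> meval l a = meval l b.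
Proof.
intros H; rewrite !meval_mcomb; apply mcomb_ext; exact (eq_upto_spec _ _ _ H).
Qed.

End ModuleTactic.

(** Atoms are identified up to conversion, so that one vector reached through different structure
    projections does not count as two atoms. *)
Ltac mlookup x l :=
  lazymatch l with
  | ?y :: ?l' =>
      match y with
      | _ => let _ := constr:(eq_refl : x = y) in constr:(O)
      | _ => let n := mlookup x l' in constr:(S n)
      end
  end.

Ltac madd x l :=
  match l with
  | _ => let n := mlookup x l in l
  | _ => constr:(x :: l)
  end.

Ltac matoms e l :=
  lazymatch e with
  | plus ?a ?b => let l := matoms a l in matoms b l
  | minus ?a ?b => let l := matoms a l in matoms b l
  | opp ?a => matoms a l
  | scal ?k ?a => matoms a l
  | zero => l
  | ?x => madd x l
  end.

Ltac mreify e l :=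
  lazymatch e with
  | plus ?a ?b => let a := mreify a l in let b := mreify b l in constr:(MPlus a b)
  | minus ?a ?b =>
      let a := mreify a l in let b := mreify b l in constr:(MPlus a (MOpp b))
  | opp ?a => let a := mreify a l in constr:(MOpp a)
  | scal ?k ?a => let a := mreify a l in constr:(MScal k a)
  | zero => constr:(MZero)
  | ?x => let n := mlookup x l in constr:(MAtom n)
  end.

Ltac lmod_split V :=
  lazymatch goal with
  | |- ?a = ?b =>
      let l := matoms a (@nil V) in
      let l := matoms b l in
      let ea := mreify a l in
      let eb := mreify b l in
      apply (@mexpr_eq V l ea eb); simpl; repeat split
  end.

(** Proves equalities in the module [V] by comparing the coefficients of the atoms. *)
Tactic Notation "lmod" constr(V) :=
  lmod_split (NormedModule.ModuleSpace C_AbsRing V);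
  cbv [mult plus opp one zero]; simpl; try ring; try (field; auto).

Section Development.

(* Forces the operations of a [NormedModule] to be elaborated along one canonical
   path, so that convertible terms are also syntactically equal. *)
Local Notation plus := (@Hierarchy.plus (NormedModule.AbelianMonoid C_AbsRing _)).
Local Notation minus := (@Hierarchy.minus (NormedModule.AbelianGroup C_AbsRing _)).
Local Notation opp := (@Hierarchy.opp (NormedModule.AbelianGroup C_AbsRing _)).
Local Notation zero := (@Hierarchy.zero (NormedModule.AbelianMonoid C_AbsRing _)).
Local Notation scal := (@Hierarchy.scal (AbsRing.Ring C_AbsRing) (NormedModule.ModuleSpace C_AbsRing _)).

(** * Norm identities, bounded operators and epsilon-delta forms of differentiability *)

Section Norm.

Context {V : NormedModule C_AbsRing}.

(** The module axiom is only the inequality [<=]; applied to [/ k] and [scal k x] it yields the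
    converse. *)
Lemma norm_scal_eq (k : C) (x : V) : norm (scal k x) = Cmod k * norm x.
Proof.
apply Rle_antisym; [exact (norm_scal k x)|].
destruct (Req_dec (Cmod k) 0) as [H0|H0]; [rewrite H0, Rmult_0_l; apply norm_ge_0|].
assert (Hk : k <> 0%C) by (intros ->; apply H0, Cmod_0).
assert (Hp : 0 < Cmod k) by (generalize (Cmod_ge_0 k); lra).
replace (norm x) with (norm (scal (/ k : C_AbsRing)%C (scal k x)))
  by (f_equal; lmod V).
apply Rmult_le_reg_l with (/ Cmod k); [now apply Rinv_0_lt_compat|].
rewrite <- Rmult_assoc, Rinv_l, Rmult_1_l by exact H0.
rewrite <- Cmod_inv by exact Hk.
exact (norm_scal (/ k : C_AbsRing)%C _).
Qed.

Lemma norm_minus_sym (x y : V) : norm (minus x y) = norm (minus y x).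
Proof. rewrite <- norm_opp; f_equal; lmod V. Qed.

Lemma norm_minus_diag (x : V) : norm (minus x x) = 0.
Proof. rewrite minus_eq_zero; exact (norm_zero (V := V)). Qed.

Lemma norm_minus_trans (y x z : V) :
  norm (minus x z) <= norm (minus x y) + norm (minus y z).
Proof.
replace (minus x z) with (plus (minus x y) (minus y z)) by lmod V.
apply norm_triangle.
Qed.

Lemma norm_minus_le (x y : V) : norm (minus x y) <= norm x + norm y.
Proof. rewrite <- (norm_opp y); apply norm_triangle. Qed.

Lemma norm_le_minus (x y : V) : norm x <= norm y + norm (minus x y).
Proof.
replace x with (plus y (minus x y)) at 1 by lmod V; apply norm_triangle.
Qed.

Lemma norm_le_eps_zero (x : V) : (forall eps, 0 < eps -> norm x <= eps) -> x = zero.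
Proof.
intros H; apply norm_eq_zero; apply Rle_antisym; [|apply norm_ge_0].
apply le_epsilon; intros e He; rewrite Rplus_0_l; now apply H.
Qed.

Lemma locally_norm_iff (x : V) (P : V -> Prop) :
  locally x P <-> exists d, 0 < d /\ forall y, norm (minus y x) < d -> P y.
Proof.
split.
- intros H; destruct (locally_norm_le_locally x P H) as [d Hd].
  exists d; split; [apply cond_pos|]; exact Hd.
- intros [d [Hd H]]; apply locally_le_locally_norm.
  exists (mkposreal d Hd); exact H.
Qed.

End Norm.

Section BlinFun.

Context {U V : NormedModule C_AbsRing}.

Lemma blin_fun_plus (A : blin U V) (x y : U) : A (plus x y) = plus (A x) (A y).
Proof. exact (linear_plus _ (proj2_sig A) x y). Qed.

Lemma blin_fun_scal (A : blin U V) (k : C) (x : U) : A (scal k x) = scal k (A x).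
Proof. exact (linear_scal _ (proj2_sig A) k x). Qed.

Lemma blin_fun_minus (A : blin U V) (x y : U) : A (minus x y) = minus (A x) (A y).
Proof.
unfold Hierarchy.minus; rewrite blin_fun_plus; f_equal; exact (linear_opp _ y (proj2_sig A)).
Qed.

Lemma blin_fun_bound (A : blin U V) (x : U) : norm (A x) <= blin_norm A * norm x.
Proof. exact (opnorm_bound A x (proj2_sig A)). Qed.

Lemma blin_minus_bound (A B : blin U V) (x : U) :
  norm (minus (A x) (B x)) <= blin_norm (minus A B) * norm x.
Proof. exact (opnorm_bound (blin_fun (minus A B)) x (proj2_sig (minus A B : blin U V))). Qed.

Lemma blin_minus_norm_le (A B : blin U V) (M : R) :
  (forall x : U, norm x <= 1 -> norm (minus (A x) (B x)) <= M) -> blin_norm (minus A B) <= M.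
Proof. exact (opnorm_least _ M (proj2_sig (minus A B : blin U V))). Qed.

End BlinFun.

Tactic Notation "norm_replace" constr(V) constr(t) :=
  match goal with
  | |- context [@norm _ _ ?x] => replace x with t by lmod V
  end.

Lemma filterdiff_iff {U V : NormedModule C_AbsRing} (f : U -> V) (x : U) (l : U -> V) :
  filterdiff f (locally x) l <->
  is_linear l /\ forall eps, 0 < eps -> exists d, 0 < d /\
    forall h, norm h < d ->
      norm (minus (minus (f (plus x h)) (f x)) (l h)) <= eps * norm h.
Proof.
split.
- intros [Hl H]; split; [exact Hl|]; intros eps Heps.
  assert (H' := H x (fun P HP => HP) (mkposreal eps Heps)).
  apply locally_norm_iff in H' as [d [Hd H']]; exists d; split; [exact Hd|].
  intros h Hh.
  assert (E : minus (plus x h) x = h) by lmod U.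
  specialize (H' (plus x h)); simpl in H'; rewrite E in H'; exact (H' Hh).
- intros [Hl H]; split; [exact Hl|]; intros y Hy.
  apply is_filter_lim_locally_unique in Hy; subst y; intros eps.
  destruct (H eps (cond_pos eps)) as [d [Hd H']].
  apply locally_norm_iff; exists d; split; [exact Hd|]; intros y Hy.
  specialize (H' (minus y x) Hy).
  now replace (plus x (minus y x)) with y in H' by lmod U.
Qed.

Lemma filterdiff_continuous_norm {U V : NormedModule C_AbsRing} (f : U -> V) (x : U) :
  ex_filterdiff f (locally x) ->
  forall eps, 0 < eps -> exists d, 0 < d /\
    forall h, norm h < d -> norm (minus (f (plus x h)) (f x)) < eps.
Proof.
intros [l Hl] eps Heps; apply filterdiff_iff in Hl as [Hl H].
destruct (linear_norm l Hl) as [M [HM HlM]].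
destruct (H 1 Rlt_0_1) as [d [Hd H']].
exists (Rmin d (eps / (1 + M))); split.
{ apply Rmin_glb_lt; [exact Hd|]; apply Rdiv_lt_0_compat; lra. }
intros h Hh; assert (Hh1 := Rlt_le_trans _ _ _ Hh (Rmin_l _ _)).
assert (Hh2 := Rlt_le_trans _ _ _ Hh (Rmin_r _ _)).
apply Rle_lt_trans with (1 := norm_le_minus _ (l h)).
apply Rle_lt_trans with ((1 + M) * norm h).
{ specialize (H' h Hh1); specialize (HlM h); lra. }
apply Rmult_lt_compat_l with (r := 1 + M) in Hh2; [|lra].
replace ((1 + M) * (eps / (1 + M))) with eps in Hh2 by (field; lra); exact Hh2.
Qed.

Lemma filterdiff_unique {U V : NormedModule C_AbsRing} (f : U -> V) (x : U) (l m : U -> V) :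
  filterdiff f (locally x) l -> filterdiff f (locally x) m -> forall v, l v = m v.
Proof.
intros Hl Hm v; apply filterdiff_iff in Hl as [Ll Hl]; apply filterdiff_iff in Hm as [Lm Hm].
assert (E : minus (l v) (m v) = zero); [|replace (l v) with (plus (m v) (minus (l v) (m v))) by lmod V;
  rewrite E; apply plus_zero_r].
apply norm_le_eps_zero; intros eps Heps.
set (e := eps / (2 * (1 + norm v))).
assert (Hv := norm_ge_0 v).
assert (He : 0 < e) by (apply Rdiv_lt_0_compat; lra).
destruct (Hl e He) as [d1 [Hd1 H1]]; destruct (Hm e He) as [d2 [Hd2 H2]].
(* Both linear maps are compared along the ray through [v]; the factor [t] then cancels by
   homogeneity. The [1 +] covers [v = zero]. *)
set (t := Rmin d1 d2 / (2 * (1 + norm v))).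
assert (Hd : 0 < Rmin d1 d2) by (apply Rmin_glb_lt; lra).
assert (Ht : 0 < t) by (apply Rdiv_lt_0_compat; lra).
assert (Hth : t * norm v < Rmin d1 d2).
{ apply Rlt_le_trans with (t * (2 * (1 + norm v))); [apply Rmult_lt_compat_l; lra|].
  unfold t; right; field; lra. }
assert (Nt : norm (scal (RtoC t) v) = t * norm v).
{ rewrite norm_scal_eq, Cmod_R, Rabs_pos_eq; lra. }
specialize (H1 (scal (RtoC t) v)); specialize (H2 (scal (RtoC t) v)).
rewrite Nt in H1, H2.
assert (H1' := H1 (Rlt_le_trans _ _ _ Hth (Rmin_l _ _))).
assert (H2' := H2 (Rlt_le_trans _ _ _ Hth (Rmin_r _ _))).
rewrite (linear_scal l Ll) in H1'; rewrite (linear_scal m Lm) in H2'.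
set (A := minus (f (plus x (scal (RtoC t) v))) (f x)) in *.
assert (H3 : t * norm (minus (l v) (m v)) <= 2 * e * (t * norm v)).
{ replace (t * norm (minus (l v) (m v))) with (norm (scal (RtoC t) (minus (l v) (m v))))
    by (rewrite norm_scal_eq, Cmod_R, Rabs_pos_eq; lra).
  replace (scal (RtoC t) (minus (l v) (m v)))
    with (minus (minus A (scal (RtoC t) (m v))) (minus A (scal (RtoC t) (l v))))
    by lmod V.
  apply Rle_trans with (1 := norm_minus_le _ _); lra. }
apply Rmult_le_reg_l with t; [exact Ht|].
apply Rle_trans with (1 := H3).
apply Rle_trans with (t * (2 * e * (1 + norm v))).
- replace (2 * e * (t * norm v)) with (t * (2 * e * norm v)) by ring.
  apply Rmult_le_compat_l; [lra|]; apply Rmult_le_compat_l; lra.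
- unfold e; right; field; lra.
Qed.

Lemma frechet_eq {U V : NormedModule C_AbsRing} (f : U -> V) (x : U) (l : U -> V) :
  filterdiff f (locally x) l -> forall v, frechet f x v = l v.
Proof.
intros H; apply (filterdiff_unique f x); [|exact H].
apply frechet_correct; now exists l.
Qed.

(** [C] carries two uniform structures in Coquelicot (sup norm and modulus); maps
    from and to [C] are always taken over [C_NormedModule]. *)
Definition cderiv {V : NormedModule C_AbsRing} (F : C -> V) (z : C) (d : V) : Prop :=
  @filterdiff C_AbsRing C_NormedModule V F (locally (z : C_NormedModule))
    (fun h : C_NormedModule => scal h d).

Section Cderiv.

Context {V : NormedModule C_AbsRing}.

Lemma is_linear_scal_C (d : V) :
  @is_linear C_AbsRing C_NormedModule V (fun h : C => scal h d).
Proof.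
split.
- intros x y; exact (scal_distr_r (x : C_AbsRing) y d).
- intros k x; symmetry; exact (scal_assoc (k : C_AbsRing) x d).
- exists (1 + norm d); split; [generalize (norm_ge_0 d); lra|]; intros x.
  rewrite norm_scal_eq; change (norm x) with (Cmod x).
  generalize (Cmod_ge_0 x); intros Hx; rewrite (Rmult_comm _ (Cmod x)).
  apply Rmult_le_compat_l; lra.
Qed.

Lemma cderiv_iff (F : C -> V) (z : C) (d : V) :
  cderiv F z d <-> forall eps, 0 < eps -> exists dl, 0 < dl /\
    forall h : C, Cmod h < dl ->
      norm (minus (minus (F (z + h)%C) (F z)) (scal h d)) <= eps * Cmod h.
Proof.
unfold cderiv; rewrite filterdiff_iff; split; [intros [_ H]; exact H|].
intros H; split; [apply is_linear_scal_C|exact H].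
Qed.

Lemma cderiv_unique (F : C -> V) (z : C) (d e : V) : cderiv F z d -> cderiv F z e -> d = e.
Proof.
intros Hd He; assert (H := filterdiff_unique _ _ _ _ Hd He (RtoC 1)).
rewrite <- (scal_one d), <- (scal_one e); exact H.
Qed.

Lemma cderiv_ext_loc (F G : C -> V) (z : C) (d : V) (r : R) : 0 < r ->
  (forall y, Cmod (y - z) < r -> F y = G y) -> cderiv F z d -> cderiv G z d.
Proof.
intros Hr H; apply filterdiff_ext_locally; apply locally_norm_iff.
exists r; split; [exact Hr|exact H].
Qed.

Lemma cderiv_ext (F G : C -> V) (z : C) (d : V) :
  (forall y, F y = G y) -> cderiv F z d -> cderiv G z d.
Proof. intros H; apply cderiv_ext_loc with 1; [lra|]; intros y _; apply H. Qed.

Lemma cderiv_continuous (F : C -> V) (z : C) (d : V) : cderiv F z d ->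
  forall eps, 0 < eps -> exists dl, 0 < dl /\
    forall h : C, Cmod h < dl -> norm (minus (F (z + h)%C) (F z)) < eps.
Proof.
intros H; apply (@filterdiff_continuous_norm C_NormedModule V F z); now eexists; exact H.
Qed.

Lemma cderiv_const (a : V) (z : C) : cderiv (fun _ => a) z zero.
Proof.
apply (filterdiff_ext_lin (fun _ : C_NormedModule => a) (fun _ => zero));
  [apply filterdiff_const|].
intros y; lmod V.
Qed.

Lemma cderiv_plus (F G : C -> V) (z : C) (d e : V) : cderiv F z d -> cderiv G z e ->
  cderiv (fun y => plus (F y) (G y)) z (plus d e).
Proof.
intros HF HG; eapply filterdiff_ext_lin; [apply (filterdiff_plus_fct F G _ _ HF HG)|].
intros y; simpl; lmod V.
Qed.

Lemma cderiv_minus (F G : C -> V) (z : C) (d e : V) : cderiv F z d -> cderiv G z e ->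
  cderiv (fun y => minus (F y) (G y)) z (minus d e).
Proof.
intros HF HG; eapply filterdiff_ext_lin; [apply (filterdiff_minus_fct F G _ _ HF HG)|].
intros y; simpl; lmod V.
Qed.

Lemma cderiv_comp_linear {W : NormedModule C_AbsRing} (F : C -> V) (z : C) (d : V) (l : V -> W) :
  is_linear l -> cderiv F z d -> cderiv (fun y => l (F y)) z (l d).
Proof.
intros Hl HF; eapply filterdiff_ext_lin.
- apply (filterdiff_comp' F l z _ l HF); apply filterdiff_linear; exact Hl.
- intros y; exact (linear_scal l Hl y d).
Qed.

Lemma cderiv_comp_filterdiff {W : NormedModule C_AbsRing}
  (F : C -> V) (z : C) (d : V) (f l : V -> W) :
  filterdiff f (locally (F z)) l -> cderiv F z d -> cderiv (fun y => f (F y)) z (l d).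
Proof.
intros Hf HF; eapply filterdiff_ext_lin.
- apply (filterdiff_comp' F f z _ l HF Hf).
- intros y; exact (linear_scal l (proj1 Hf) y d).
Qed.

Lemma cderiv_affine (a v : V) (z : C) : cderiv (fun y => plus a (scal y v)) z v.
Proof.
apply cderiv_iff; intros eps He; exists 1; split; [lra|]; intros h _.
replace (minus _ _) with (@Hierarchy.zero V); [rewrite norm_zero; generalize (Cmod_ge_0 h); nra|].
lmod V.
Qed.

End Cderiv.

Lemma cderiv_comp {V : NormedModule C_AbsRing} (F : C -> V) (k : C -> C_NormedModule) (z d : C) (e : V) :
  cderiv F (k z) e -> cderiv k z d -> cderiv (fun y => F (k y)) z (scal d e).
Proof. intros HF Hk; exact (cderiv_comp_filterdiff k z d F _ HF Hk). Qed.

Lemma cderiv_scal {V : NormedModule C_AbsRing} (k : C -> C_NormedModule) (F : C -> V) (z d : C) (e : V) :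
  cderiv k z d -> cderiv F z e ->
  cderiv (fun y => scal (k y : C_AbsRing) (F y)) z
    (plus (scal d (F z)) (scal (k z : C_AbsRing) e)).
Proof.
intros Hk HF.
assert (Bk := cderiv_continuous k z d Hk).
generalize (proj1 (cderiv_iff k z d) Hk) (proj1 (cderiv_iff F z e) HF); clear Hk HF; intros Hk HF.
apply cderiv_iff; intros eps Heps.
assert (N1 := norm_ge_0 (F z)); assert (N2 := norm_ge_0 e); assert (N3 := Cmod_ge_0 (k z)).
(* The error splits into [k (z + h)] times the remainder of [F], the remainder of [k] times [F z],
   and the mixed term [(k (z + h) - k z) h e]. The first two share [eps / 2] through [e1], the last
   gets [eps / 2] through [e2]; [e2 <= 1] also bounds [k (z + h)]. *)
set (e1 := eps / (2 * (1 + Cmod (k z) + norm (F z)))).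
assert (He1 : 0 < e1) by (apply Rdiv_lt_0_compat; lra).
set (e2 := Rmin 1 (eps / (2 * (1 + norm e)))).
assert (He2 : 0 < e2) by (apply Rmin_glb_lt; [lra|apply Rdiv_lt_0_compat; lra]).
destruct (Hk e1 He1) as [d1 [Hd1 H1]]; destruct (HF e1 He1) as [d2 [Hd2 H2]].
destruct (Bk e2 He2) as [d3 [Hd3 H3]].
exists (Rmin d1 (Rmin d2 d3)); split; [repeat apply Rmin_glb_lt; assumption|].
intros h Hh.
assert (Hh1 := Rlt_le_trans _ _ _ Hh (Rmin_l _ _)).
assert (Hh23 := Rlt_le_trans _ _ _ Hh (Rmin_r _ _)).
assert (Hh2 := Rlt_le_trans _ _ _ Hh23 (Rmin_l _ _)).
assert (Hh3 := Rlt_le_trans _ _ _ Hh23 (Rmin_r _ _)).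
specialize (H1 h Hh1); specialize (H2 h Hh2); specialize (H3 h Hh3).
set (A := F (z + h)%C) in *; set (B := F z) in *.
set (p := k (z + h)%C : C) in *; set (q := k z : C) in *.
change (Cmod (p - q - h * d) <= e1 * Cmod h) in H1.
change (Cmod (p - q) < e2) in H3.
set (L := minus _ _).
replace L with (plus (scal p (minus (minus A B) (scal h e)))
         (plus (scal (p - q - h * d)%C B)
               (scal ((p - q)%C * h : C_AbsRing)%C e))) by (unfold L; lmod V).
apply Rle_trans with (1 := norm_triangle _ _).
apply Rle_trans with (1 := Rplus_le_compat_l _ _ _ (norm_triangle _ _)).
rewrite !norm_scal_eq, Cmod_mult.
assert (Hp : Cmod p <= Cmod q + 1).
{ replace p with (q + (p - q))%C by ring.
  apply Rle_trans with (1 := Cmod_triangle _ _).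
  assert (e2 <= 1) by apply Rmin_l; lra. }
assert (N4 := Cmod_ge_0 h); assert (N5 := Cmod_ge_0 p).
assert (Ha : Cmod p * norm (minus (minus A B) (scal h e)) <= (Cmod q + 1) * (e1 * Cmod h)).
{ apply Rmult_le_compat; auto; apply norm_ge_0. }
assert (Hb : Cmod (p - q - h * d) * norm B <= e1 * Cmod h * norm B) by (apply Rmult_le_compat_r; auto).
assert (Hc : Cmod (p - q) * Cmod h * norm e <= eps / 2 * Cmod h).
{ apply Rle_trans with (eps / (2 * (1 + norm e)) * Cmod h * (1 + norm e)).
  - apply Rmult_le_compat; try lra; [apply Rmult_le_pos; auto; apply Cmod_ge_0|].
    apply Rmult_le_compat_r; auto; apply Rlt_le, Rlt_le_trans with (1 := H3), Rmin_r.
  - right; field; lra. }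
assert (Hd : (Cmod q + 1) * (e1 * Cmod h) + e1 * Cmod h * norm B = eps / 2 * Cmod h).
{ unfold e1; field; lra. }
lra.
Qed.

Lemma cderiv_id (z : C) : cderiv (V := C_NormedModule) (fun y => y) z (RtoC 1).
Proof.
apply cderiv_iff; intros eps He; exists 1; split; [lra|]; intros h _.
change (Cmod (z + h - z - h * 1) <= eps * Cmod h).
replace (z + h - z - h * 1)%C with (RtoC 0) by ring.
rewrite Cmod_0; generalize (Cmod_ge_0 h); nra.
Qed.

Lemma cderiv_mult (k F : C -> C_NormedModule) (z d e : C) :
  cderiv k z d -> cderiv F z e ->
  cderiv (V := C_NormedModule) (fun y => (k y * F y)%C) z (d * F z + k z * e)%C.
Proof. exact (cderiv_scal k F z d e). Qed.

Lemma cderiv_inv (z : C) : z <> 0%C ->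
  cderiv (V := C_NormedModule) (fun y => (/ y)%C) z (- / (z * z))%C.
Proof.
intros Hz; apply cderiv_iff; intros eps He.
assert (Hm : 0 < Cmod z) by now apply Cmod_gt_0.
(* The remainder is exactly [h^2 / ((z + h) z^2)]. The first radius keeps
   [Cmod (z + h) >= Cmod z / 2], so its modulus is at most [2 |h|^2 / |z|^3]. *)
exists (Rmin (Cmod z / 2) (eps * (Cmod z ^ 3 / 2))); split.
{ apply Rmin_glb_lt; [lra|]; apply Rmult_lt_0_compat; [exact He|].
  apply Rdiv_lt_0_compat; [apply pow_lt; exact Hm|lra]. }
intros h Hh; assert (Hh1 := Rlt_le_trans _ _ _ Hh (Rmin_l _ _)).
assert (Hh2 := Rlt_le_trans _ _ _ Hh (Rmin_r _ _)).
assert (Hzh : Cmod z / 2 <= Cmod (z + h)).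
{ assert (H := Cmod_triangle (z + h) (- h)).
  replace (z + h + - h)%C with z in H by ring; rewrite Cmod_opp in H; lra. }
assert (Hn : (z + h)%C <> 0%C) by (intros E; rewrite E, Cmod_0 in Hzh; lra).
change (Cmod (/ (z + h) - / z - h * - / (z * z)) <= eps * Cmod h).
replace (/ (z + h) - / z - h * - / (z * z))%C with (h * (h * / ((z + h) * (z * z))))%C
  by (field; auto).
rewrite Cmod_mult, Rmult_comm; apply Rmult_le_compat_r; [apply Cmod_ge_0|].
rewrite Cmod_mult, Cmod_inv, !Cmod_mult
  by (apply Cmult_neq_0; [exact Hn|now apply Cmult_neq_0]).
apply Rle_trans with (eps * (Cmod z ^ 3 / 2) * / (Cmod z / 2 * (Cmod z * Cmod z))).
- apply Rmult_le_compat; [apply Cmod_ge_0| |lra|].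
  + apply Rlt_le, Rinv_0_lt_compat; apply Rmult_lt_0_compat; [lra|nra].
  + apply Rinv_le_contravar; [apply Rmult_lt_0_compat; [lra|nra]|].
    apply Rmult_le_compat_r; [nra|exact Hzh].
- right; field; lra.
Qed.

Lemma cderiv_eq_C (F : C -> C) (z d e : C) : d = e ->
  cderiv (V := C_NormedModule) F z d -> cderiv (V := C_NormedModule) F z e.
Proof. now intros ->. Qed.

Lemma cderiv_const_C (a z : C) : cderiv (V := C_NormedModule) (fun _ => a) z (RtoC 0).
Proof. exact (cderiv_const (V := C_NormedModule) a z). Qed.

Lemma Cmod_le_Rabs_plus (x y : R) : Cmod (x, y) <= Rabs x + Rabs y.
Proof.
replace ((x, y) : C) with (RtoC x + Ci * RtoC y)%C
  by (unfold RtoC, Ci, Cplus, Cmult; simpl; f_equal; ring).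
apply Rle_trans with (1 := Cmod_triangle _ _).
rewrite Cmod_mult, !Cmod_R, Cmod_Ci; lra.
Qed.

(** * Goursat's theorem for Banach-space-valued maps *)

Section Realification.

Variable V : CompleteNormedModule C_AbsRing.

Let scalR (r : R) (x : V) : V := scal (RtoC r) x.

Lemma real_scal_assoc (r s : R) (x : V) : scalR r (scalR s x) = scalR (r * s) x.
Proof. unfold scalR; lmod V; rewrite ?RtoC_mult; ring. Qed.

Lemma real_scal_one (x : V) : scalR 1 x = x.
Proof. exact (scal_one x). Qed.

Lemma real_scal_distr_l (r : R) (x y : V) : scalR r (plus x y) = plus (scalR r x) (scalR r y).
Proof. unfold scalR; lmod V. Qed.

Lemma real_scal_distr_r (r s : R) (x : V) : scalR (r + s) x = plus (scalR r x) (scalR s x).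
Proof. unfold scalR; lmod V; rewrite ?RtoC_plus; ring. Qed.

Definition real_ModuleSpace : ModuleSpace R_AbsRing :=
  ModuleSpace.Pack R_AbsRing V
    (ModuleSpace.Class R_AbsRing V (AbelianGroup.class V)
       (ModuleSpace.Mixin R_AbsRing V scalR
          real_scal_assoc real_scal_one real_scal_distr_l real_scal_distr_r)) V.

Definition real_NormedModuleAux : NormedModuleAux R_AbsRing :=
  NormedModuleAux.Pack R_AbsRing V
    (NormedModuleAux.Class R_AbsRing V
       (ModuleSpace.class R_AbsRing real_ModuleSpace) (UniformSpace.class V)) V.

Lemma real_norm_scal (r : R) (x : V) : norm (scalR r x) <= Rabs r * norm x.
Proof.
right; transitivity (Cmod (RtoC r) * norm x); [exact (norm_scal_eq _ _)|now rewrite Cmod_R].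
Qed.

Definition real_NormedModule_mixin : NormedModule.mixin_of R_AbsRing real_NormedModuleAux :=
  NormedModule.Mixin R_AbsRing real_NormedModuleAux norm (@norm_factor C_AbsRing V)
    norm_triangle real_norm_scal (@norm_compat1 C_AbsRing V) (@norm_compat2 C_AbsRing V)
    (@norm_eq_zero C_AbsRing V).

(** [V] with scalars restricted to [R], as needed for Riemann integrals in [V]. *)
Definition realified : CompleteNormedModule R_AbsRing :=
  CompleteNormedModule.Pack R_AbsRing V
    (CompleteNormedModule.Class R_AbsRing V
       (NormedModule.Class R_AbsRing V
          (NormedModuleAux.class R_AbsRing real_NormedModuleAux) real_NormedModule_mixin)
       (CompleteSpace.class V)) V.

End Realification.

(** Nested squares localize at a point any property that always passes to one of the four quarters.
    It serves Goursat's argument and, with a property of [a] and [l] alone, the bisection of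
    intervals in the mean value inequality. *)
Lemma bisection_square (P : R -> R -> R -> Prop) (a b l : R) :
  0 < l -> P a b l ->
  (forall a b l, 0 < l -> P a b l ->
     P a b (l / 2) \/ P (a + l / 2) b (l / 2) \/
     P a (b + l / 2) (l / 2) \/ P (a + l / 2) (b + l / 2) (l / 2)) ->
  exists s t, a <= s <= a + l /\ b <= t <= b + l /\
    forall eta, 0 < eta -> exists a' b' l', 0 < l' < eta /\
      a' <= s <= a' + l' /\ b' <= t <= b' + l' /\ a <= a' /\ a' + l' <= a + l /\
      b <= b' /\ b' + l' <= b + l /\ P a' b' l'.
Proof.
intros Hl HP Hstep.
(* The conditional form makes every triple have a successor, a dummy one where [P] fails, so that
   choice provides a total function [next]. *)
set (good := fun p q : R * R * R =>
  let '(a, b, l) := p in let '(a', b', l') := q in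
  P a b l -> 0 < l -> l' = l / 2 /\ (a' = a \/ a' = a + l / 2) /\ (b' = b \/ b' = b + l / 2) /\ P a' b' l').
assert (Hg : forall p, exists q, good p q).
{ intros [[x y] m]; unfold good.
  destruct (excluded_middle_informative (P x y m /\ 0 < m)) as [[H H0]|H].
  - destruct (Hstep x y m H0 H) as [K|[K|[K|K]]];
      [exists (x, y, m / 2)|exists (x + m / 2, y, m / 2)|exists (x, y + m / 2, m / 2)
      |exists (x + m / 2, y + m / 2, m / 2)]; tauto.
  - exists (0, 0, 0); tauto. }
set (next := fun p => proj1_sig (constructive_indefinite_description _ (Hg p))).
assert (Hnext : forall p, good p (next p)).
{ intros p; unfold next; exact (proj2_sig (constructive_indefinite_description _ (Hg p))). }
set (u := fun n => Nat.iter n next (a, b, l)).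
set (A := fun n => fst (fst (u n))); set (B := fun n => snd (fst (u n))); set (L := fun n => snd (u n)).
assert (Hn : forall n, L n = l / 2 ^ n /\ P (A n) (B n) (L n)).
{ induction n as [|n [IHl IHP]]; [unfold L, A, B, u; simpl; split; [field|exact HP]|].
  assert (H := Hnext (u n)); unfold good in H; change (next (u n)) with (u (S n)) in H.
  unfold L, A, B in *; destruct (u n) as [[x y] m], (u (S n)) as [[x' y'] m']; simpl in *.
  assert (Hm : 0 < m) by (rewrite IHl; apply Rdiv_lt_0_compat; [exact Hl|apply pow_lt; lra]).
  destruct (H IHP Hm) as [E [_ [_ HP']]]; split; [|exact HP'].
  rewrite E, IHl; field; apply pow_nonzero; lra. }
assert (HL : forall n, 0 < L n).
{ intros n; rewrite (proj1 (Hn n)); apply Rdiv_lt_0_compat; [exact Hl|apply pow_lt; lra]. }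
assert (Hinc : forall n, A n <= A (S n) /\ A (S n) + L (S n) <= A n + L n /\
                         B n <= B (S n) /\ B (S n) + L (S n) <= B n + L n).
{ intros n; assert (H := Hnext (u n)); unfold good in H; change (next (u n)) with (u (S n)) in H.
  assert (H1 := proj2 (Hn n)); assert (H2 := HL n).
  unfold L, A, B in *; destruct (u n) as [[x y] m], (u (S n)) as [[x' y'] m']; simpl in *.
  destruct (H H1 H2) as [E [Ha [Hb _]]]; lra. }
assert (Hinc2 : forall n k, A n <= A (n + k)%nat /\ A (n + k)%nat + L (n + k)%nat <= A n + L n /\
                         B n <= B (n + k)%nat /\ B (n + k)%nat + L (n + k)%nat <= B n + L n).
{ intros n; induction k as [|k IH]; [rewrite Nat.add_0_r; lra|].
  rewrite Nat.add_succ_r; assert (H := Hinc (n + k)%nat); lra. }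
assert (Hlim : forall Z : nat -> R,
  (forall n k, Z n <= Z (n + k)%nat /\ Z (n + k)%nat + L (n + k)%nat <= Z n + L n) ->
  exists z, forall n, Z n <= z <= Z n + L n).
{ intros Z HZ.
  assert (Hub : forall n k, Z k <= Z n + L n).
  { intros n k; destruct (Nat.le_ge_cases n k) as [H|H].
    - replace k with (n + (k - n))%nat by lia; assert (H1 := HZ n (k - n)%nat).
      assert (H2 := HL (n + (k - n))%nat); lra.
    - assert (H1 := HZ k (n - k)%nat); replace (k + (n - k))%nat with n in H1 by lia.
      assert (H2 := HL n); lra. }
  destruct (completeness (fun x => exists n, x = Z n)) as [z [Hz1 Hz2]].
  - exists (Z O + L O); intros x [k ->]; apply Hub.
  - exists (Z O); now exists O.
  - exists z; intros n; split; [apply Hz1; now exists n|].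
    apply Hz2; intros x [k ->]; apply Hub. }
destruct (Hlim A) as [s Hs]; [intros n k; generalize (Hinc2 n k); tauto|].
destruct (Hlim B) as [t Ht]; [intros n k; generalize (Hinc2 n k); tauto|].
exists s, t; split; [exact (Hs O)|]; split; [exact (Ht O)|].
intros eta Heta.
destruct (pow_lt_1_zero (/ 2)) with (y := eta / l) as [N HN].
{ rewrite Rabs_pos_eq; lra. }
{ apply Rdiv_lt_0_compat; lra. }
exists (A N), (B N), (L N); split; [split; [apply HL|]|].
{ specialize (HN N (Nat.le_refl N)).
  rewrite Rabs_pos_eq, pow_inv in HN by (apply pow_le; lra).
  rewrite (proj1 (Hn N)); apply Rmult_lt_compat_l with (r := l) in HN; [|lra].
  unfold Rdiv at 1; apply Rlt_le_trans with (1 := HN); right; field; lra. }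
assert (H := Hinc2 O N); simpl in H.
change (A O) with a in H; change (B O) with b in H; change (L O) with l in H.
split; [apply Hs|]; split; [apply Ht|]; split; [lra|]; split; [lra|]; split; [lra|]; split; [lra|].
exact (proj2 (Hn N)).
Qed.

Lemma continuous_norm_iff {V : CompleteNormedModule C_AbsRing} (f : R -> V) (t : R) :
  (forall eps, 0 < eps -> exists d, 0 < d /\ forall s, Rabs (s - t) < d -> norm (minus (f s) (f t)) < eps) ->
  @continuous R_UniformSpace V f t.
Proof.
intros H; apply filterlim_locally; intros eps.
destruct (H eps (cond_pos eps)) as [d [Hd H']].
exists (mkposreal d Hd); intros s Hs; apply (@norm_compat1 C_AbsRing V); apply H'; exact Hs.
Qed.

Section Goursat.

Variable V0 : CompleteNormedModule C_AbsRing.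
(* Keeps all operations on [V0] syntactically those of a [NormedModule]. *)
Local Notation V := (CompleteNormedModule.NormedModule C_AbsRing V0).
Variable G : R -> R -> V.

Definition RIntV (f : R -> V) (a b : R) : V := @RInt (realified V0) f a b.
Definition hor (y x0 x1 : R) : V := RIntV (fun s => G s y) x0 x1.
Definition ver (x y0 y1 : R) : V := RIntV (fun t => G x t) y0 y1.

(** The contour integral of [G ds + i G dt] along the boundary of [[x0,x1] x [y0,y1]]. *)
Definition circulation (x0 x1 y0 y1 : R) : V :=
  minus (scal Ci (minus (ver x1 y0 y1) (ver x0 y0 y1)))
        (minus (hor y1 x0 x1) (hor y0 x0 x1)).

(** Complex differentiability at [s + i t]: the pair [(h, k)] is the complex increment, measured by
    [Rabs h + Rabs k] because the sides of squares are parametrized by real coordinates. *)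
Definition holo_at (s t : R) : Prop :=
  exists d : V, forall eps, 0 < eps -> exists dl, 0 < dl /\
    forall h k : R, Rabs h < dl -> Rabs k < dl ->
      norm (minus (minus (G (s + h) (t + k)) (G s t)) (scal (h, k) d))
        <= eps * (Rabs h + Rabs k).

Variables x0 y0 w : R.
Hypothesis HG : forall s t, x0 <= s <= x0 + w -> y0 <= t <= y0 + w -> holo_at s t.

Lemma holo_at_continuous s t : holo_at s t ->
  forall eps, 0 < eps -> exists dl, 0 < dl /\
    forall h k : R, Rabs h < dl -> Rabs k < dl -> norm (minus (G (s + h) (t + k)) (G s t)) < eps.
Proof.
intros [d Hd] eps Heps; destruct (Hd 1 Rlt_0_1) as [dl [Hdl H]].
assert (Nd := norm_ge_0 d).
exists (Rmin dl (eps / (2 * (2 + norm d)))); split.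
{ apply Rmin_glb_lt; [exact Hdl|]; apply Rdiv_lt_0_compat; lra. }
intros h k Hh Hk; apply Rle_lt_trans with (1 := norm_le_minus _ (scal (h, k) d)).
specialize (H h k (Rlt_le_trans _ _ _ Hh (Rmin_l _ _)) (Rlt_le_trans _ _ _ Hk (Rmin_l _ _))).
assert (Hh' := Rlt_le_trans _ _ _ Hh (Rmin_r _ _)).
assert (Hk' := Rlt_le_trans _ _ _ Hk (Rmin_r _ _)).
rewrite !norm_scal_eq.
assert (Hm : Cmod (h, k) <= Rabs h + Rabs k) by apply Cmod_le_Rabs_plus.
apply Rmult_le_compat_r with (r := norm d) in Hm; [|exact Nd].
set (m := eps / (2 * (2 + norm d))) in *.
assert (E : eps = 2 * m * (2 + norm d)) by (unfold m; field; lra).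
assert (Hm0 := Rabs_pos h); assert (Hm1 := Rabs_pos k).
assert ((Rabs h + Rabs k) * norm d <= 2 * m * norm d) by (apply Rmult_le_compat_r; lra).
lra.
Qed.

Lemma ex_RInt_ver x a b : x0 <= x <= x0 + w -> y0 <= a <= b -> b <= y0 + w ->
  @ex_RInt (realified V0) (fun t => G x t) a b.
Proof.
intros Hx Ha Hb; apply (@ex_RInt_continuous (realified V0)).
rewrite Rmin_left, Rmax_right by lra; intros t Ht.
apply (@continuous_norm_iff V0); intros eps Heps.
destruct (holo_at_continuous x t (HG x t Hx ltac:(lra)) eps Heps) as [dl [Hdl H]].
exists dl; split; [exact Hdl|]; intros u Hu.
specialize (H 0 (u - t)); rewrite Rabs_R0, Rplus_0_r in H.
replace (t + (u - t)) with u in H by ring; now apply H.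
Qed.

Lemma ex_RInt_hor y a b : y0 <= y <= y0 + w -> x0 <= a <= b -> b <= x0 + w ->
  @ex_RInt (realified V0) (fun s => G s y) a b.
Proof.
intros Hx Ha Hb; apply (@ex_RInt_continuous (realified V0)).
rewrite Rmin_left, Rmax_right by lra; intros t Ht.
apply (@continuous_norm_iff V0); intros eps Heps.
destruct (holo_at_continuous t y (HG t y ltac:(lra) Hx) eps Heps) as [dl [Hdl H]].
exists dl; split; [exact Hdl|]; intros u Hu.
specialize (H (u - t) 0); rewrite Rabs_R0, Rplus_0_r in H.
replace (t + (u - t)) with u in H by ring; now apply H.
Qed.

(** Each inner edge is traversed twice in opposite directions and cancels; each outer edge is split
    by Chasles' relation. *)
Lemma circulation_quarters a b m : 0 < m -> x0 <= a -> a + m + m <= x0 + w ->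
  y0 <= b -> b + m + m <= y0 + w ->
  circulation a (a + m + m) b (b + m + m) =
  plus (plus (circulation a (a + m) b (b + m)) (circulation (a + m) (a + m + m) b (b + m)))
       (plus (circulation a (a + m) (b + m) (b + m + m))
             (circulation (a + m) (a + m + m) (b + m) (b + m + m))).
Proof.
intros Hm Ha1 Ha2 Hb1 Hb2; unfold circulation.
assert (EV : forall x, x0 <= x <= x0 + w ->
  ver x b (b + m + m) = plus (ver x b (b + m)) (ver x (b + m) (b + m + m))).
{ intros x Hx; symmetry; apply (@RInt_Chasles (realified V0)); apply ex_RInt_ver; lra. }
assert (EH : forall y, y0 <= y <= y0 + w ->
  hor y a (a + m + m) = plus (hor y a (a + m)) (hor y (a + m) (a + m + m))).
{ intros y Hy; symmetry; apply (@RInt_Chasles (realified V0)); apply ex_RInt_hor; lra. }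
rewrite !EV, !EH by lra; lmod V.
Qed.

(** Meant for opposite sides of a square: the affine part of [G] makes [f - g] a constant [c], and
    only the deviation from it has to be estimated. *)
Lemma norm_RInt_diff_le (f g : R -> V) (a l : R) (c : V) (M : R) : 0 <= l ->
  @ex_RInt (realified V0) f a (a + l) -> @ex_RInt (realified V0) g a (a + l) ->
  (forall t, a <= t <= a + l -> norm (minus (minus (f t) (g t)) c) <= M) ->
  norm (minus (minus (RIntV f a (a + l)) (RIntV g a (a + l))) (scal (RtoC l) c)) <= l * M.
Proof.
intros Hl Hf Hg HM.
assert (H := @norm_RInt_le_const (realified V0)
  (fun t => @Hierarchy.minus (realified V0) (@Hierarchy.minus (realified V0) (f t) (g t)) c) a (a + l)
  (@Hierarchy.minus (realified V0) (@Hierarchy.minus (realified V0) (RIntV f a (a + l)) (RIntV g a (a + l)))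
     (@Hierarchy.scal R_AbsRing (realified V0) (a + l - a) c)) M ltac:(lra) HM).
replace (a + l - a) with l in H by ring; apply H.
apply (@is_RInt_minus (realified V0)).
- apply (@is_RInt_minus (realified V0)); apply (@RInt_correct (realified V0)); assumption.
- assert (Hc := @is_RInt_const (realified V0) a (a + l) c).
  now replace (a + l - a) with l in Hc by ring.
Qed.

Theorem goursat_square : 0 < w -> circulation x0 (x0 + w) y0 (y0 + w) = zero.
Proof.
intros Hw; apply norm_le_eps_zero; intros eps0 Heps0.
destruct (Rle_or_lt (norm (circulation x0 (x0 + w) y0 (y0 + w))) eps0) as [H|Hbad]; [exact H|exfalso].
set (eps := eps0 / w ^ 2).
assert (Hw2 : 0 < w ^ 2) by (apply pow_lt; exact Hw).
assert (Heps : 0 < eps) by (apply Rdiv_lt_0_compat; assumption).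
(* The invariant: the norm of the circulation exceeds [eps] times the area. If it failed on all four
   quarters, it would fail on their union. *)
set (P := fun a b l => (x0 <= a /\ a + l <= x0 + w /\ y0 <= b /\ b + l <= y0 + w) /\
   eps * l ^ 2 < norm (circulation a (a + l) b (b + l))).
destruct (bisection_square P x0 y0 w Hw) as [s [t [Hs [Ht Hst]]]].
- split; [lra|]; unfold eps; replace (eps0 / w ^ 2 * w ^ 2) with eps0 by (field; lra); exact Hbad.
- intros a b l Hl [Hin Hn]; set (m := l / 2).
  replace (a + l) with (a + m + m) in * by (unfold m; field).
  replace (b + l) with (b + m + m) in * by (unfold m; field).
  assert (Hm : 0 < m) by (unfold m; lra).
  rewrite circulation_quarters in Hn by lra.
  assert (El : eps * l ^ 2 = 4 * (eps * m ^ 2)) by (unfold m; field).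
  unfold P.
  destruct (Rle_or_lt (norm (circulation a (a + m) b (b + m))) (eps * m ^ 2)) as [H1|H1]; [|left; lra].
  right.
  destruct (Rle_or_lt (norm (circulation (a + m) (a + m + m) b (b + m))) (eps * m ^ 2)) as [H2|H2]; [|left; lra].
  right.
  destruct (Rle_or_lt (norm (circulation a (a + m) (b + m) (b + m + m))) (eps * m ^ 2)) as [H3|H3]; [|left; lra].
  right; split; [lra|].
  set (J1 := circulation a (a + m) b (b + m)) in *.
  set (J2 := circulation (a + m) (a + m + m) b (b + m)) in *.
  set (J3 := circulation a (a + m) (b + m) (b + m + m)) in *.
  set (J4 := circulation (a + m) (a + m + m) (b + m) (b + m + m)) in *.
  assert (N1 := norm_triangle (plus J1 J2) (plus J3 J4)).
  assert (N2 := norm_triangle J1 J2); assert (N3 := norm_triangle J3 J4); lra.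
- destruct (HG s t Hs Ht) as [d Hd].
  destruct (Hd (eps / 16) ltac:(lra)) as [dl [Hdl H]].
  destruct (Hst dl Hdl) as [a [b [l [Hl [Has [Hbt [_ [_ [_ [_ [Hin Hn]]]]]]]]]]].
  assert (Hpt : forall x y, a <= x <= a + l -> b <= y <= b + l ->
    norm (minus (minus (G x y) (G s t)) (scal (x - s, y - t) d)) <= eps / 16 * (2 * l)).
  { intros x y Hx Hy.
    assert (Rabs (x - s) <= l) by (apply Rabs_le; lra).
    assert (Rabs (y - t) <= l) by (apply Rabs_le; lra).
    specialize (H (x - s) (y - t) ltac:(lra) ltac:(lra)).
    replace (s + (x - s)) with x in H by ring; replace (t + (y - t)) with y in H by ring.
    apply Rle_trans with (1 := H), Rmult_le_compat_l; lra. }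
  assert (HV : norm (minus (minus (ver (a + l) b (b + l)) (ver a b (b + l)))
                 (scal (RtoC l) (scal (RtoC l) d))) <= l * (eps / 16 * (4 * l))).
  { apply norm_RInt_diff_le; [lra|apply ex_RInt_ver; lra|apply ex_RInt_ver; lra|].
    intros y Hy.
    set (c1 := (a + l - s, y - t) : C); set (c2 := (a - s, y - t) : C).
    replace (minus (minus (G (a + l) y) (G a y)) (scal (RtoC l) d)) with
      (minus (minus (minus (G (a + l) y) (G s t)) (scal c1 d))
             (minus (minus (G a y) (G s t)) (scal c2 d))).
    - apply Rle_trans with (1 := norm_minus_le _ _).
      assert (K1 := Hpt (a + l) y ltac:(lra) Hy); assert (K2 := Hpt a y ltac:(lra) Hy).
      unfold c1, c2; lra.
    - replace (RtoC l) with (c1 - c2)%C; [lmod V|].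
      unfold c1, c2, RtoC, Cminus, Cplus, Copp; simpl; f_equal; ring. }
  assert (HH : norm (minus (minus (hor (b + l) a (a + l)) (hor b a (a + l)))
                 (scal (RtoC l) (scal (RtoC l * Ci)%C d))) <= l * (eps / 16 * (4 * l))).
  { apply norm_RInt_diff_le; [lra|apply ex_RInt_hor; lra|apply ex_RInt_hor; lra|].
    intros x Hx.
    set (c1 := (x - s, b + l - t) : C); set (c2 := (x - s, b - t) : C).
    replace (minus (minus (G x (b + l)) (G x b)) (scal (RtoC l * Ci)%C d)) with
      (minus (minus (minus (G x (b + l)) (G s t)) (scal c1 d))
             (minus (minus (G x b) (G s t)) (scal c2 d))).
    - apply Rle_trans with (1 := norm_minus_le _ _).
      assert (K1 := Hpt x (b + l) Hx ltac:(lra)); assert (K2 := Hpt x b Hx ltac:(lra)).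
      unfold c1, c2; lra.
    - replace (RtoC l * Ci)%C with (c1 - c2)%C; [lmod V|].
      unfold c1, c2, RtoC, Ci, Cminus, Cplus, Copp, Cmult; simpl; f_equal; ring. }
  (* The affine part of [G] contributes [i l^2 d] to both pairs of sides, so subtracting it changes
     nothing. Each pair then leaves at most [eps / 4 * l^2], half of the bound in total. *)
  assert (E : circulation a (a + l) b (b + l) =
    minus (scal Ci (minus (minus (ver (a + l) b (b + l)) (ver a b (b + l)))
                 (scal (RtoC l) (scal (RtoC l) d))))
      (minus (minus (hor (b + l) a (a + l)) (hor b a (a + l)))
                 (scal (RtoC l) (scal (RtoC l * Ci)%C d)))).
  { unfold circulation; lmod V. }
  rewrite E in Hn; apply (Rlt_not_le _ _ Hn).
  apply Rle_trans with (1 := norm_minus_le _ _).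
  rewrite norm_scal_eq, Cmod_Ci.
  assert (eps * l ^ 2 = 2 * (l * (eps / 16 * (4 * l))) + eps * l ^ 2 / 2) by field.
  assert (0 < eps * l ^ 2) by (apply Rmult_lt_0_compat; [lra|apply pow_lt; lra]); lra.
Qed.

End Goursat.

(** * Mean values over circles *)

Definition Cexp (z : C) : C := (exp (Re z) * cos (Im z), exp (Re z) * sin (Im z)).

Lemma Cexp_plus z w : Cexp (z + w) = (Cexp z * Cexp w)%C.
Proof.
destruct z as [a b], w as [c d]; unfold Cexp, Cplus, Cmult, Re, Im; simpl.
rewrite exp_plus, cos_plus, sin_plus; f_equal; ring.
Qed.

Lemma Cmod_Cexp z : Cmod (Cexp z) = exp (Re z).
Proof.
unfold Cexp, Cmod; simpl.
replace (_ + _) with (Rsqr (exp (Re z)) * (Rsqr (sin (Im z)) + Rsqr (cos (Im z))))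
  by (unfold Rsqr; ring).
rewrite sin2_cos2, Rmult_1_r; apply sqrt_Rsqr, Rlt_le, exp_pos.
Qed.

Lemma derivable_pt_lim_0_bound (f : R -> R) (l : R) : derivable_pt_lim f 0 l ->
  forall eps, 0 < eps -> exists d, 0 < d /\
    forall h, Rabs h < d -> Rabs (f h - f 0 - l * h) <= eps * Rabs h.
Proof.
intros H eps Heps; destruct (H eps Heps) as [d Hd]; exists d; split; [apply cond_pos|].
intros h Hh; destruct (Req_dec h 0) as [->|Hn].
- replace (f 0 - f 0 - l * 0) with 0 by ring; rewrite Rabs_R0; lra.
- specialize (Hd h Hn Hh); rewrite Rplus_0_l in Hd.
  replace (f h - f 0 - l * h) with (((f h - f 0) / h - l) * h) by (field; exact Hn).
  rewrite Rabs_mult; apply Rmult_le_compat_r; [apply Rabs_pos|lra].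
Qed.

(** The addition formula moves the question to [0], where the real derivatives of [exp], [cos] and
    [sin] control the two components of [Cexp h - 1 - h]. *)
Lemma cderiv_Cexp (z : C) : cderiv (V := C_NormedModule) Cexp z (Cexp z).
Proof.
apply cderiv_iff; intros eps Heps.
assert (Hz : 0 < Cmod (Cexp z)) by (rewrite Cmod_Cexp; apply exp_pos).
(* The two components are at most [4 e |h|] and [5 e |h|]; [16] leaves room. The products below use
   [e <= 1] and [|h| < e]. *)
set (e := Rmin 1 (eps / (16 * Cmod (Cexp z)))).
assert (He0 : 0 < eps / (16 * Cmod (Cexp z))) by (apply Rdiv_lt_0_compat; lra).
assert (He : 0 < e) by (apply Rmin_glb_lt; [lra|exact He0]).
destruct (derivable_pt_lim_0_bound exp 1 derivable_pt_lim_exp_0 e He) as [d1 [Hd1 H1]].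
assert (Dc : derivable_pt_lim cos 0 0).
{ replace 0 with (- sin 0) at 2 by (rewrite sin_0; ring); apply derivable_pt_lim_cos. }
destruct (derivable_pt_lim_0_bound cos 0 Dc e He) as [d2 [Hd2 H2]].
assert (Ds : derivable_pt_lim sin 0 1).
{ rewrite <- cos_0; apply derivable_pt_lim_sin. }
destruct (derivable_pt_lim_0_bound sin 1 Ds e He) as [d3 [Hd3 H3]].
exists (Rmin (Rmin d1 (Rmin d2 d3)) e); split; [apply Rmin_glb_lt; [repeat apply Rmin_glb_lt; assumption|exact He]|].
intros h Hh; change (Cmod (Cexp (z + h) - Cexp z - h * Cexp z) <= eps * Cmod h).
replace (Cexp (z + h) - Cexp z - h * Cexp z)%C with (Cexp z * (Cexp h - 1 - h))%C
  by (rewrite Cexp_plus; ring).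
rewrite Cmod_mult.
assert (Hd : Rmin d1 (Rmin d2 d3) <= d1 /\ Rmin d1 (Rmin d2 d3) <= d2 /\ Rmin d1 (Rmin d2 d3) <= d3).
{ assert (K1 := Rmin_l d1 (Rmin d2 d3)); assert (K2 := Rmin_r d1 (Rmin d2 d3)).
  assert (K3 := Rmin_l d2 d3); assert (K4 := Rmin_r d2 d3); lra. }
assert (Hh1 := Rlt_le_trans _ _ _ Hh (Rmin_l _ _)).
assert (Hh2 := Rlt_le_trans _ _ _ Hh (Rmin_r _ _)).
destruct h as [a b].

assert (Ha : Rabs a <= Cmod (a, b)).
{ exact (Rle_trans _ _ _ (Rmax_l _ _) (Rmax_Cmod (a, b))). }
assert (Hb : Rabs b <= Cmod (a, b)).
{ exact (Rle_trans _ _ _ (Rmax_r _ _) (Rmax_Cmod (a, b))). }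
specialize (H1 a ltac:(lra)); specialize (H2 b ltac:(lra)); specialize (H3 b ltac:(lra)).
rewrite exp_0, Rmult_1_l in H1; rewrite cos_0, Rmult_0_l, Rminus_0_r in H2.
rewrite sin_0, Rminus_0_r, Rmult_1_l in H3.
assert (He1 : e <= 1) by apply Rmin_l.
assert (E1 : Rabs (exp a - 1) <= 2 * Rabs a).
{ replace (exp a - 1) with ((exp a - 1 - a) + a) by ring.
  apply Rle_trans with (1 := Rabs_triang _ _).
  assert (e * Rabs a <= 1 * Rabs a) by (apply Rmult_le_compat_r; [apply Rabs_pos|exact He1]); lra. }
assert (E2 : Rabs (exp a) <= 3).
{ replace (exp a) with ((exp a - 1) + 1) by ring.
  apply Rle_trans with (1 := Rabs_triang _ _); rewrite Rabs_R1; lra. }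
set (m := Cmod (a, b)) in *.
assert (Hm : 0 <= m) by apply Cmod_ge_0.
assert (E3 : Rabs (exp a * cos b - 1 - a) <= 4 * (e * m)).
{ replace (exp a * cos b - 1 - a) with ((exp a - 1 - a) + exp a * (cos b - 1)) by ring.
  apply Rle_trans with (1 := Rabs_triang _ _); rewrite Rabs_mult.
  assert (Rabs (exp a) * Rabs (cos b - 1) <= 3 * (e * Rabs b))
    by (apply Rmult_le_compat; auto using Rabs_pos).
  assert (e * Rabs a <= e * m) by (apply Rmult_le_compat_l; lra).
  assert (e * Rabs b <= e * m) by (apply Rmult_le_compat_l; lra); lra. }
assert (E4 : Rabs (exp a * sin b - b) <= 5 * (e * m)).
{ replace (exp a * sin b - b) with (exp a * (sin b - b) + (exp a - 1) * b) by ring.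
  apply Rle_trans with (1 := Rabs_triang _ _); rewrite !Rabs_mult.
  assert (Rabs (exp a) * Rabs (sin b - b) <= 3 * (e * Rabs b))
    by (apply Rmult_le_compat; auto using Rabs_pos).
  assert (Rabs (exp a - 1) * Rabs b <= (2 * e) * Rabs b)
    by (apply Rmult_le_compat_r; [apply Rabs_pos|lra]).
  assert (e * Rabs b <= e * m) by (apply Rmult_le_compat_l; lra); lra. }
apply Rle_trans with (Cmod (Cexp z) * (16 * (e * m))).
- apply Rmult_le_compat_l; [lra|].
  replace (Cexp (a, b) - 1 - (a, b))%C with ((exp a * cos b - 1 - a, exp a * sin b - b) : C)
    by (unfold Cexp, Cminus, Cplus, Copp, RtoC, Re, Im; simpl; f_equal; ring).
  apply Rle_trans with (1 := Cmod_le_Rabs_plus _ _).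
  assert (0 <= e * m) by (apply Rmult_le_pos; lra); lra.
- assert (He2 : e <= eps / (16 * Cmod (Cexp z))) by apply Rmin_r.
  apply Rmult_le_compat_r with (r := 16 * Cmod (Cexp z) * m) in He2; [|apply Rmult_le_pos; lra].
  replace (eps / (16 * Cmod (Cexp z)) * (16 * Cmod (Cexp z) * m)) with (eps * m) in He2
    by (field; lra).
  lra.
Qed.

Lemma cderiv_holo_at {V0 : CompleteNormedModule C_AbsRing}
  (F : C -> CompleteNormedModule.NormedModule C_AbsRing V0) (s t : R) (d : V0) :
  cderiv F (s, t) d -> holo_at V0 (fun s t => F (s, t)) s t.
Proof.
intros H; exists d; intros eps Heps.
destruct (proj1 (cderiv_iff _ _ _) H eps Heps) as [dl [Hdl Hd]].
exists (dl / 2); split; [lra|]; intros h k Hh Hk.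
assert (K := Cmod_le_Rabs_plus h k).
apply Rle_trans with (1 := Hd (h, k) ltac:(lra)); apply Rmult_le_compat_l; lra.
Qed.

Section MaximumPrinciple.

Variable V0 : CompleteNormedModule C_AbsRing.
Local Notation V := (CompleteNormedModule.NormedModule C_AbsRing V0).

Lemma scal_Ci_eq_zero (x : V) : scal Ci x = zero -> x = zero.
Proof.
intros H; replace x with (scal (- Ci)%C (scal Ci x)).
- rewrite H; lmod V.
- rewrite scal_assoc; change (mult (- Ci : C_AbsRing)%C Ci) with (- Ci * Ci)%C.
  replace (- Ci * Ci)%C with (RtoC 1); [exact (scal_one x)|].
  unfold Ci, RtoC, Copp, Cmult; simpl; f_equal; ring.
Qed.

(** Cauchy's theorem on unit squares in logarithmic coordinates shows that the circle
    mean [I s] of radius [r e^(2 pi s)] satisfies [I s = I (s - 1)], and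
    [I (- n)] tends to [F 0]; nothing is assumed on the derivative at [0]. *)
Theorem center_norm_le (F : C -> V) (r R0 M : R) : 0 < r -> r < R0 ->
  (forall eps, 0 < eps -> exists d, 0 < d /\ forall z, Cmod z < d -> norm (minus (F z) (F 0%C)) <= eps) ->
  (forall z, 0 < Cmod z -> Cmod z < R0 -> exists d, cderiv F z d) ->
  (forall z, Cmod z = r -> norm (F z) <= M) ->
  norm (F 0%C) <= M.
Proof.
intros Hr HR Hcont Hder HM.
set (tau := RtoC (2 * PI)).
set (g := fun z : C => (r * Cexp (tau * z))%C : C_NormedModule).
assert (Hgm : forall s t, Cmod (g (s, t)) = r * exp (2 * PI * s)).
{ intros s t; unfold g; rewrite Cmod_mult, Cmod_R, Cmod_Cexp, Rabs_pos_eq by lra.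
  f_equal; f_equal; unfold tau; simpl; ring. }
assert (Hgd : forall z, exists d, cderiv g z d).
{ intros z; eexists; unfold g.
  apply (cderiv_mult (fun _ => RtoC r) (fun z => Cexp (tau * z))%C); [apply cderiv_const|].
  apply (cderiv_comp (V := C_NormedModule) Cexp (fun z => (tau * z)%C)); [apply cderiv_Cexp|].
  apply (cderiv_mult (fun _ => tau) (fun z => z)); [apply cderiv_const|apply cderiv_id]. }
set (G := fun s t : R => F (g (s, t))).
(* The half-plane [s <= 0] is mapped to moduli in [(0, r]]; since [r < R0], differentiability also
   holds on the circle itself. *)
assert (HG : forall s t, s <= 0 -> holo_at V0 G s t).
{ intros s t Hs; destruct (Hgd (s, t)) as [d Hd].
  assert (He : 0 < exp (2 * PI * s) <= 1).
  { split; [apply exp_pos|]; rewrite <- exp_0.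
    assert (Hpi := PI_RGT_0); destruct (Req_dec s 0) as [->|Hs0]; [rewrite Rmult_0_r; lra|].
    apply Rlt_le, exp_increasing; nra. }
  destruct (Hder (g (s, t))) as [e HF]; rewrite ?Hgm; [nra|nra|].
  apply (cderiv_holo_at (fun z => F (g z)) s t (scal d e)).
  now apply cderiv_comp. }
set (I := fun s => ver V0 G s 0 1).
assert (Hper : forall s, G s 1 = G s 0).
{ intros s; unfold G, g; f_equal; f_equal; unfold Cexp, tau, Cmult, RtoC; simpl.
  replace (2 * PI * 1 + 0 * s) with (0 + 2 * PI) by ring.
  replace (2 * PI * 0 + 0 * s) with 0 by ring.
  replace (2 * PI * s - 0 * 1) with (2 * PI * s - 0 * 0) by ring.
  rewrite cos_plus, sin_plus, cos_2PI, sin_2PI, cos_0, sin_0; f_equal; ring. }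
assert (Hstep : forall s, s <= 0 -> I s = I (s - 1)).
{ intros s Hs.
  assert (H := goursat_square V0 G (s - 1) 0 1).
  replace (s - 1 + 1) with s in H by ring; rewrite Rplus_0_l in H.
  specialize (H ltac:(intros; apply HG; lra) ltac:(lra)); unfold circulation in H.
  (* Height [1] is one full turn because of the factor [2 PI] in [tau], so the horizontal edges
     cancel. *)
  assert (E : hor V0 G 1 (s - 1) s = hor V0 G 0 (s - 1) s).
  { apply (@RInt_ext (realified V0)); intros x _; apply Hper. }
  rewrite E in H.
  replace (minus (scal Ci (minus (ver V0 G s 0 1) (ver V0 G (s - 1) 0 1)))
    (minus (hor V0 G 0 (s - 1) s) (hor V0 G 0 (s - 1) s)))
    with (scal Ci (minus (I s) (I (s - 1)))) in H by (unfold I; lmod V).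
  apply scal_Ci_eq_zero in H.
  replace (I s) with (plus (I (s - 1)) (minus (I s) (I (s - 1)))) by lmod V.
  rewrite H; apply plus_zero_r. }
assert (HI : forall n, I 0 = I (- INR n)).
{ induction n as [|n IH]; [f_equal; simpl; ring|].
  rewrite IH, Hstep by (generalize (pos_INR n); lra); f_equal; rewrite S_INR; ring. }
assert (Hex : forall s, s <= 0 -> @ex_RInt (realified V0) (fun t => G s t) 0 1).
{ intros s Hs; apply (ex_RInt_ver V0 G (s - 1) 0 1); try lra.
  intros s' t Hs' _; apply HG; lra. }
assert (HM0 : norm (I 0) <= M).
{ replace M with ((1 - 0) * M) by ring.
  apply (@norm_RInt_le_const (realified V0) (fun t => G 0 t) 0 1); [lra| |].
  - intros t _; apply HM; rewrite Hgm, Rmult_0_r, exp_0; ring.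
  - apply (@RInt_correct (realified V0)), Hex; lra. }
apply le_epsilon; intros eps Heps.
destruct (Hcont eps Heps) as [d [Hd Hc]].
(* Since [exp (2 PI n) > n], any [n > r / d] puts the circle of radius [r exp (- 2 PI n)] inside the
   disc of radius [d]. *)
destruct (INR_unbounded (r / d)) as [n Hn].
assert (Hnd : r * exp (2 * PI * - INR n) < d).
{ assert (Hpi := PI2_1); assert (Hp := pos_INR n).
  replace (2 * PI * - INR n) with (- (2 * PI * INR n)) by ring; rewrite exp_Ropp.
  assert (K := exp_ineq1_le (2 * PI * INR n)).
  assert (K1 : INR n < exp (2 * PI * INR n)) by nra.
  apply Rmult_lt_reg_r with (exp (2 * PI * INR n)); [apply exp_pos|].
  rewrite Rmult_assoc, Rinv_l, Rmult_1_r by (apply Rgt_not_eq, exp_pos).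
  apply Rmult_lt_compat_l with (r := d) in Hn; [|exact Hd].
  replace (d * (r / d)) with r in Hn by (field; lra); nra. }
assert (Hlim : norm (minus (I 0) (F 0%C)) <= eps).
{ rewrite (HI n).
  replace eps with ((1 - 0) * eps) by ring.
  apply (@norm_RInt_le_const (realified V0) (fun t => @Hierarchy.minus (realified V0) (G (- INR n) t) (F 0%C)) 0 1); [lra| |].
  - intros t _; apply Hc; rewrite Hgm; exact Hnd.
  - apply (@is_RInt_minus (realified V0)).
    + apply (@RInt_correct (realified V0)), Hex; generalize (pos_INR n); lra.
    + assert (K := @is_RInt_const (realified V0) 0 1 (F 0%C)).
      refine (eq_rect _ (fun v => @is_RInt (realified V0) _ 0 1 v) K _ _).
      rewrite Rminus_0_r; apply (@scal_one R_AbsRing (realified V0)). }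
rewrite norm_minus_sym in Hlim; assert (K := norm_le_minus (F 0%C) (I 0)); lra.
Qed.

End MaximumPrinciple.

(** * Cauchy estimates *)

Section CauchyEstimate.

Context {V0 : CompleteNormedModule C_AbsRing}.
Local Notation V := (CompleteNormedModule.NormedModule C_AbsRing V0).

(** The difference quotient, completed by [d] at [0], is continuous there, which is all that
    [center_norm_le] asks at the centre. The factor [2] comes from bounding [F z - F 0] by [2 * M].
    The circle must lie inside the disc, so the estimate is proved for each [s < r] and then [s]
    tends to [r]. *)
Lemma cauchy_estimate (F : C -> V) (r M : R) (d : V) : 0 < r ->
  (forall z, Cmod z < r -> exists e, cderiv F z e) ->
  (forall z, Cmod z < r -> norm (F z) <= M) ->
  cderiv F 0%C d -> norm d * r <= 2 * M.
Proof.
intros Hr HF HM Hd;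
set (H := fun z : C => if excluded_middle_informative (z = 0%C) then d
                       else scal (/ z)%C (minus (F z) (F 0%C))).
assert (H0 : H 0%C = d) by (unfold H; destruct excluded_middle_informative; congruence).
assert (HM0 : 0 <= M).
{ apply Rle_trans with (norm (F 0%C)); [apply norm_ge_0|apply HM; rewrite Cmod_0; exact Hr]. }
assert (Hs : forall s, 0 < s < r -> norm d * s <= 2 * M).
{ intros s Hs.
  assert (Hc : norm (H 0%C) <= 2 * M / s).
  { apply (center_norm_le V0 H s r); try tauto.
    - intros eps Heps; rewrite H0.
      destruct (proj1 (cderiv_iff F 0%C d) Hd eps Heps) as [dl [Hdl K]].
      exists dl; split; [exact Hdl|]; intros z Hz.
      unfold H; destruct excluded_middle_informative as [_|Hz0].
      { rewrite norm_minus_diag; lra. }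
      specialize (K z Hz); rewrite Cplus_0_l in K.
      assert (Hp : 0 < Cmod z) by now apply Cmod_gt_0.
      set (L := minus _ d).
      replace L with (scal (/ z)%C (minus (minus (F z) (F 0%C)) (scal z d)))
        by (unfold L; lmod V).
      rewrite !norm_scal_eq, Cmod_inv by exact Hz0.
      apply Rmult_le_reg_l with (Cmod z); [exact Hp|].
      rewrite <- Rmult_assoc, Rinv_r, Rmult_1_l by lra; lra.
    - intros z Hz1 Hz2.
      assert (Hz0 : z <> 0%C) by (intros ->; rewrite Cmod_0 in Hz1; lra).
      destruct (HF z Hz2) as [e He]; eexists.
      apply cderiv_ext_loc with (F := fun y : C => scal (/ y)%C (minus (F y) (F 0%C)))
        (r := Cmod z); [exact Hz1| |].
      + intros y Hy; unfold H; destruct excluded_middle_informative as [->|_]; [|reflexivity].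
        replace (0 - z)%C with (- z)%C in Hy by ring; rewrite Cmod_opp in Hy; lra.
      + apply cderiv_scal; [apply cderiv_inv; exact Hz0|].
        apply cderiv_minus; [exact He|apply cderiv_const].
    - intros z Hz; assert (Hz0 : z <> 0%C) by (intros ->; rewrite Cmod_0 in Hz; lra).
      unfold H; destruct excluded_middle_informative as [|_]; [contradiction|].
      rewrite !norm_scal_eq, Cmod_inv, Hz by exact Hz0.
      unfold Rdiv; rewrite Rmult_comm; apply Rmult_le_compat_r; [apply Rlt_le, Rinv_0_lt_compat; lra|].
      apply Rle_trans with (1 := norm_minus_le _ _).
      assert (K1 := HM z ltac:(lra)); assert (K2 := HM 0%C ltac:(rewrite Cmod_0; lra)); lra. }
  rewrite H0 in Hc; apply Rmult_le_compat_r with (r := s) in Hc; [|lra].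
  replace (2 * M / s * s) with (2 * M) in Hc by (field; lra); exact Hc. }
(* Passage to the limit [s -> r]: otherwise a radius halfway between [2 * M / norm d] and [r]
   violates [Hs]. *)
destruct (Rle_or_lt (norm d * r) (2 * M)) as [K|K]; [exact K|exfalso].
assert (Nd : 0 < norm d) by (destruct (norm_ge_0 d) as [|E]; [assumption|rewrite <- E in K; lra]).
set (q := 2 * M / norm d).
assert (Hq : q < r).
{ apply Rmult_lt_reg_l with (norm d); [exact Nd|]; unfold q.
  replace (norm d * (2 * M / norm d)) with (2 * M) by (field; lra); exact K. }
assert (Hq0 : 0 <= q) by (apply Rmult_le_pos; [lra|apply Rlt_le, Rinv_0_lt_compat; exact Nd]).
specialize (Hs ((q + r) / 2) ltac:(lra)).
assert (norm d * q = 2 * M) by (unfold q; field; lra); nra.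
Qed.

End CauchyEstimate.

(** An interval on which the increment exceeds [K + eps] times the length has a half with the same
    defect; at the limit point this contradicts differentiability. *)
Lemma mean_value_real {V : NormedModule C_AbsRing} (g : R -> V) (K : R) :
  (forall t, 0 <= t <= 1 -> exists d : V, norm d <= K /\
     forall eps, 0 < eps -> exists dl, 0 < dl /\ forall h, Rabs h < dl ->
       norm (minus (minus (g (t + h)) (g t)) (scal (RtoC h) d)) <= eps * Rabs h) ->
  norm (minus (g 1) (g 0)) <= K.
Proof.
intros Hg; apply le_epsilon; intros eps Heps.
destruct (Rle_or_lt (norm (minus (g 1) (g 0))) (K + eps)) as [H|Hbad]; [exact H|exfalso].
set (P := fun a (_ l : R) => (K + eps) * l < norm (minus (g (a + l)) (g a))).
destruct (bisection_square P 0 0 1 Rlt_0_1) as [t [u [Ht [_ Htu]]]].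
- unfold P; rewrite Rplus_0_l, Rmult_1_r; exact Hbad.
- intros a b l Hl HP; unfold P in *.
  destruct (Rle_or_lt (norm (minus (g (a + l / 2)) (g a))) ((K + eps) * (l / 2))) as [H1|H1]; [|left; exact H1].
  right; left.
  replace (a + l / 2 + l / 2) with (a + l) by field.
  assert (T := norm_minus_trans (g (a + l / 2)) (g (a + l)) (g a)); lra.
- rewrite Rplus_0_l in Ht; destruct (Hg t Ht) as [d [Hd H]].
  destruct (H (eps / 2) ltac:(lra)) as [dl [Hdl H']].
  destruct (Htu dl Hdl) as [a [b [l [Hl [Ha [_ [_ [_ [_ [_ HP]]]]]]]]]].
  unfold P in HP; apply (Rlt_not_le _ _ HP).
  (* Since [t] lies between the endpoints, its distances to them add up to [l], and the two errors
     to [eps / 2 * l]. *)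
  assert (K1 := H' (a + l - t) ltac:(apply Rabs_lt_between; lra)).
  assert (K2 := H' (a - t) ltac:(apply Rabs_lt_between; lra)).
  replace (t + (a + l - t)) with (a + l) in K1 by ring; replace (t + (a - t)) with a in K2 by ring.
  rewrite Rabs_pos_eq in K1 by lra; rewrite Rabs_left1 in K2 by lra.
  replace (minus (g (a + l)) (g a)) with
    (plus (scal (RtoC l) d)
       (minus (minus (minus (g (a + l)) (g t)) (scal (RtoC (a + l - t)) d))
          (minus (minus (g a) (g t)) (scal (RtoC (a - t)) d)))).
  + apply Rle_trans with (1 := norm_triangle _ _).
    apply Rle_trans with (1 := Rplus_le_compat_l _ _ _ (norm_minus_le _ _)).
    rewrite !norm_scal_eq, Cmod_R, Rabs_pos_eq by lra.
    assert (l * norm d <= l * K) by (apply Rmult_le_compat_l; lra); nra.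
  + replace (RtoC (a + l - t)) with (RtoC l + RtoC (a - t))%C by (rewrite <- RtoC_plus; f_equal; ring).
    lmod V.
Qed.

(** * Cauchy estimates for Fréchet derivatives on balls *)

Section DifferentiableOnBall.

Context {U : NormedModule C_AbsRing} {V0 : CompleteNormedModule C_AbsRing}.
Local Notation V := (CompleteNormedModule.NormedModule C_AbsRing V0).

Definition diff_on {W : NormedModule C_AbsRing} (f : U -> W) (x : U) (r : R) : Prop :=
  forall y : U, norm (minus y x) < r -> ex_filterdiff f (locally y).

Lemma diff_on_sub {W : NormedModule C_AbsRing} (f : U -> W) (x y : U) (r s : R) :
  norm (minus y x) + s <= r -> diff_on f x r -> diff_on f y s.
Proof.
intros H Hf z Hz; apply Hf; assert (T := norm_minus_trans y z x); lra.
Qed.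

Lemma cderiv_line {W : NormedModule C_AbsRing} (f : U -> W) (x v : U) (z : C) :
  ex_filterdiff f (locally (plus x (scal z v))) ->
  cderiv (fun z : C => f (plus x (scal z v))) z
    (frechet f (plus x (scal z v)) v).
Proof.
intros H; apply (cderiv_comp_filterdiff (fun z : C => plus x (scal z v)) z v).
- now apply frechet_correct.
- apply cderiv_affine.
Qed.

Lemma mean_value {W : NormedModule C_AbsRing} (f : U -> W) (x h : U) (K : R) :
  (forall t, 0 <= t <= 1 -> exists l : U -> W,
     filterdiff f (locally (plus x (scal (RtoC t) h))) l /\ norm (l h) <= K) ->
  norm (minus (f (plus x h)) (f x)) <= K.
Proof.
intros Hf.
assert (H := mean_value_real (fun t : R => f (plus x (scal (RtoC t) h))) K).
cbv beta in H.
replace (plus x (scal (RtoC 1) h)) with (plus x h) in H by lmod U.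
replace (plus x (scal (RtoC 0) h)) with x in H by lmod U.
apply H; intros t Ht; destruct (Hf t Ht) as [l [Hl Hn]].
exists (l h); split; [exact Hn|]; intros eps Heps.
assert (D := cderiv_comp_filterdiff (fun z : C => plus x (scal z h)) (RtoC t) h f l Hl
  (cderiv_affine x h (RtoC t))).
destruct (proj1 (cderiv_iff _ _ _) D eps Heps) as [dl [Hdl K']].
exists dl; split; [exact Hdl|]; intros s Hs.
specialize (K' (RtoC s)); rewrite <- RtoC_plus, Cmod_R in K'; exact (K' Hs).
Qed.

(** This is Cauchy's estimate on the disc of radius [r / norm v] in the complex line through [x]
    with direction [v]. *)
Lemma frechet_bound (f : U -> V) (x : U) (r M : R) : 0 < r -> diff_on f x r ->
  (forall y : U, norm (minus y x) < r -> norm (f y) <= M) ->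
  forall v, norm (frechet f x v) <= 2 * M / r * norm v.
Proof.
intros Hr Hf HM v; set (A := frechet f x).
destruct (Req_dec (norm v) 0) as [H0|H0].
{ rewrite (norm_eq_zero v H0), (linear_zero A (proj2_sig A)), !norm_zero; lra. }
assert (Hv : 0 < norm v) by (generalize (norm_ge_0 v); lra).
assert (Hin : forall z : C, Cmod z < r / norm v -> norm (minus (plus x (scal z v)) x) < r).
{ intros z Hz; replace (minus _ x) with (scal z v) by lmod U.
  rewrite !norm_scal_eq; apply Rmult_lt_compat_r with (r := norm v) in Hz; [|exact Hv].
  replace (r / norm v * norm v) with r in Hz by (field; lra); exact Hz. }
assert (E : plus x (scal (RtoC 0) v) = x) by lmod U.
assert (H := cauchy_estimate (fun z : C => f (plus x (scal z v))) (r / norm v) M (A v)).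
assert (H' : norm (A v) * (r / norm v) <= 2 * M).
{ apply H.
  - apply Rdiv_lt_0_compat; assumption.
  - intros z Hz; eexists; apply cderiv_line, Hf, Hin, Hz.
  - intros z Hz; apply HM, Hin, Hz.
  - assert (L := cderiv_line f x v (RtoC 0)); rewrite E in L; apply L, Hf.
    rewrite norm_minus_diag; exact Hr. }
apply Rmult_le_reg_r with (r / norm v); [apply Rdiv_lt_0_compat; assumption|].
apply Rle_trans with (1 := H'); right; field; lra.
Qed.

Lemma ball_segment (x y z : U) (r t : R) : norm (minus y x) < r -> norm (minus z x) < r ->
  0 <= t <= 1 -> norm (minus (plus z (scal (RtoC t) (minus y z))) x) < r.
Proof.
intros Hy Hz Ht.
replace (minus _ x) with (plus (scal (RtoC t) (minus y x))
   (scal (RtoC (1 - t)) (minus z x))) by (rewrite RtoC_minus; lmod U).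
apply Rle_lt_trans with (1 := norm_triangle _ _).
rewrite !norm_scal_eq, !Cmod_R, !Rabs_pos_eq by lra.
destruct (Req_dec t 0) as [->|Ht0]; [lra|].
assert (t * norm (minus y x) < t * r) by (apply Rmult_lt_compat_l; lra).
assert ((1 - t) * norm (minus z x) <= (1 - t) * r) by (apply Rmult_le_compat_l; lra); lra.
Qed.

Lemma lipschitz_of_bounded (f : U -> V) (x : U) (r M : R) : 0 < r -> diff_on f x (2 * r) ->
  (forall y : U, norm (minus y x) < 2 * r -> norm (f y) <= M) ->
  forall y z : U, norm (minus y x) < r -> norm (minus z x) < r ->
    norm (minus (f y) (f z)) <= 2 * M / r * norm (minus y z).
Proof.
intros Hr Hf HM y z Hy Hz.
replace y with (plus z (minus y z)) at 1 by lmod U; apply mean_value.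
intros t Ht; set (p := plus z (scal (RtoC t) (minus y z))).
assert (Hp : norm (minus p x) < r) by now apply ball_segment.
exists (frechet f p); split; [apply frechet_correct, Hf; lra|].
apply frechet_bound; [exact Hr|apply (diff_on_sub f x) with (2 * r); [lra|exact Hf]|].
intros q Hq; apply HM; assert (T := norm_minus_trans p q x); lra.
Qed.

Lemma ex_filterdiff_translate {W : NormedModule C_AbsRing} (f : U -> W) (y w : U) (l : U -> W) :
  filterdiff f (locally (plus y w)) l -> filterdiff (fun y => f (plus y w)) (locally y) l.
Proof.
intros H; apply filterdiff_iff in H as [Hl H]; apply filterdiff_iff; split; [exact Hl|].
intros eps Heps; destruct (H eps Heps) as [d [Hd K]]; exists d; split; [exact Hd|].
intros h Hh; replace (plus (plus y h) w) with (plus (plus y w) h) by lmod U; now apply K.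
Qed.

(** Two Cauchy estimates are chained: a Lipschitz bound makes the difference [G] of size [norm w] on
    the ball of radius [r], and [frechet_bound] turns this into a bound for its derivative. Points
    [y + w] stay within [2 * r], and the Lipschitz bound there needs [f] on the doubled ball, hence
    [4 * r]. *)
Lemma frechet_lipschitz (f : U -> V) (x : U) (r M : R) : 0 < r -> diff_on f x (4 * r) ->
  (forall y : U, norm (minus y x) < 4 * r -> norm (f y) <= M) ->
  forall w v, norm w < r ->
    norm (minus (frechet f (plus x w) v) (frechet f x v)) <= 2 * M / r ^ 2 * norm w * norm v.
Proof.
intros Hr Hf HM w v Hw.
set (G := fun y : U => minus (f (plus y w)) (f y)).
assert (Hin : forall y : U, norm (minus y x) < r -> norm (minus (plus y w) x) < 2 * r).
{ intros y Hy; norm_replace U (plus (minus y x) w).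
  assert (T := norm_triangle (minus y x) w). lra. }
assert (HG : forall y : U, norm (minus y x) < r ->
  filterdiff G (locally y) (fun h => minus (frechet f (plus y w) h) (frechet f y h))).
{ intros y Hy; apply (filterdiff_minus_fct (fun y => f (plus y w)) f).
  - apply ex_filterdiff_translate, frechet_correct, Hf; specialize (Hin y Hy); lra.
  - apply frechet_correct, Hf; lra. }
assert (Hx : norm (minus x x) < r) by (rewrite norm_minus_diag; exact Hr).
rewrite <- (frechet_eq _ _ _ (HG x Hx) v).
replace (2 * M / r ^ 2 * norm w * norm v) with (2 * (2 * M / (2 * r) * norm w) / r * norm v)
  by (field; lra).
apply frechet_bound; [exact Hr| |].
- intros y Hy; eexists; exact (HG y Hy).
- intros y Hy; unfold G.
  replace (norm w) with (norm (minus (plus y w) y)) by (f_equal; lmod U).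
  apply lipschitz_of_bounded with (x := x); try lra; [| |now apply Hin].
  + now replace (2 * (2 * r)) with (4 * r) by ring.
  + intros z Hz; apply HM; lra.
Qed.

(** The mean value inequality is applied to [f - A], whose derivative on the segment is
    [Df(p) - Df(x)], of size [norm w] by [frechet_lipschitz]. *)
Lemma taylor_quadratic (f : U -> V) (x : U) (r M : R) : 0 < r -> diff_on f x (4 * r) ->
  (forall y : U, norm (minus y x) < 4 * r -> norm (f y) <= M) ->
  forall w, norm w < r ->
    norm (minus (minus (f (plus x w)) (f x)) (frechet f x w)) <= 2 * M / r ^ 2 * norm w ^ 2.
Proof.
intros Hr Hf HM w Hw; set (A := frechet f x).
assert (HM0 : 0 <= M).
{ apply Rle_trans with (norm (f x)); [apply norm_ge_0|apply HM].
  rewrite norm_minus_diag; lra. }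
replace (minus (minus (f (plus x w)) (f x)) (A w)) with
  (minus (minus (f (plus x w)) (A (plus x w))) (minus (f x) (A x))).
2:{ rewrite blin_fun_plus; lmod V. }
apply (mean_value (fun y => minus (f y) (A y))); intros t Ht.
set (p := plus x (scal (RtoC t) w)).
assert (Nt : norm (scal (RtoC t) w) <= norm w).
{ rewrite !norm_scal_eq, Cmod_R, Rabs_pos_eq by lra; assert (K := norm_ge_0 w); nra. }
exists (fun h => minus (frechet f p h) (A h)); split.
- apply filterdiff_minus_fct.
  + apply frechet_correct, Hf; unfold p.
    norm_replace U (scal (RtoC t) w); lra.
  + apply filterdiff_linear; exact (proj2_sig A).
- apply Rle_trans with (1 := frechet_lipschitz f x r M Hr Hf HM (scal (RtoC t) w) w ltac:(lra)).
  replace (2 * M / r ^ 2 * norm w ^ 2) with (2 * M / r ^ 2 * norm w * norm w) by (simpl; ring).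
  apply Rmult_le_compat_r; [apply norm_ge_0|]; apply Rmult_le_compat_l; [|exact Nt].
  apply Rmult_le_pos; [lra|]; apply Rlt_le, Rinv_0_lt_compat; simpl; nra.
Qed.

End DifferentiableOnBall.

(** * Uniform limits and completeness of spaces of operators *)

Section SeqLimit.

Context {V : NormedModule C_AbsRing}.

Definition seq_lim (u : nat -> V) (l : V) : Prop :=
  forall eps, 0 < eps -> exists N, forall n, (N <= n)%nat -> norm (minus (u n) l) <= eps.

Lemma seq_lim_plus u v l m : seq_lim u l -> seq_lim v m ->
  seq_lim (fun n => plus (u n) (v n)) (plus l m).
Proof.
intros Hu Hv eps Heps.
destruct (Hu (eps / 2) ltac:(lra)) as [N1 H1]; destruct (Hv (eps / 2) ltac:(lra)) as [N2 H2].
exists (max N1 N2); intros n Hn; specialize (H1 n ltac:(lia)); specialize (H2 n ltac:(lia)).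
norm_replace V (plus (minus (u n) l) (minus (v n) m)).
apply Rle_trans with (1 := norm_triangle _ _); lra.
Qed.

Lemma seq_lim_scal u l (k : C) : seq_lim u l ->
  seq_lim (fun n => scal k (u n)) (scal k l).
Proof.
intros Hu eps Heps; assert (Hk := Cmod_ge_0 k).
destruct (Hu (eps / (1 + Cmod k))) as [N H]; [apply Rdiv_lt_0_compat; lra|].
exists N; intros n Hn; specialize (H n Hn).
norm_replace V (scal k (minus (u n) l)); rewrite norm_scal_eq.
apply Rle_trans with ((1 + Cmod k) * (eps / (1 + Cmod k))); [|right; field; lra].
apply Rmult_le_compat; try lra; apply norm_ge_0.
Qed.

Lemma seq_lim_minus u v l m : seq_lim u l -> seq_lim v m ->
  seq_lim (fun n => minus (u n) (v n)) (minus l m).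
Proof.
intros Hu Hv eps Heps.
destruct (Hu (eps / 2) ltac:(lra)) as [N1 H1]; destruct (Hv (eps / 2) ltac:(lra)) as [N2 H2].
exists (max N1 N2); intros n Hn; specialize (H1 n ltac:(lia)); specialize (H2 n ltac:(lia)).
norm_replace V (minus (minus (u n) l) (minus (v n) m)).
apply Rle_trans with (1 := norm_minus_le _ _); lra.
Qed.

Lemma seq_lim_norm_le u l (N : nat) (M : R) : seq_lim u l ->
  (forall n, (N <= n)%nat -> norm (u n) <= M) -> norm l <= M.
Proof.
intros Hu HM; apply le_epsilon; intros eps Heps.
destruct (Hu eps Heps) as [N' H]; specialize (H (max N N') ltac:(lia)).
specialize (HM (max N N') ltac:(lia)).
rewrite norm_minus_sym in H; assert (K := norm_le_minus l (u (max N N'))); lra.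
Qed.

Lemma seq_lim_unique u l m : seq_lim u l -> seq_lim u m -> l = m.
Proof.
intros Hl Hm; assert (H := seq_lim_minus _ _ _ _ Hl Hm).
assert (E : minus l m = zero).
{ apply norm_eq_zero, Rle_antisym; [|apply norm_ge_0].
  apply (seq_lim_norm_le _ _ O 0 H); intros n _; rewrite norm_minus_diag; lra. }
replace l with (plus m (minus l m)) by lmod V; rewrite E; lmod V.
Qed.

End SeqLimit.

Lemma cauchy_seq_lim {V0 : CompleteNormedModule C_AbsRing}
  (u : nat -> CompleteNormedModule.NormedModule C_AbsRing V0) :
  (forall eps, 0 < eps -> exists N, forall n m, (N <= n)%nat -> (N <= m)%nat ->
     norm (minus (u n) (u m)) <= eps) ->
  exists l, seq_lim u l.
Proof.
intros H.
destruct (proj1 (@filterlim_locally_cauchy nat V0 eventually _ u)) as [l Hl].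
- intros eps; destruct (H (eps / 2)) as [N HN]; [generalize (cond_pos eps); lra|].
  exists (fun n => (N <= n)%nat); split; [exists N; tauto|].
  intros n m Hn Hm; apply (@norm_compat1 C_AbsRing V0).
  apply Rle_lt_trans with (1 := HN m n Hm Hn); generalize (cond_pos eps); lra.
- exists l; intros eps Heps.
  destruct (Hl (fun y => norm (minus y l) < eps)) as [N HN].
  { apply (locally_norm_iff (V := CompleteNormedModule.NormedModule C_AbsRing V0)).
    exists eps; split; [exact Heps|tauto]. }
  exists N; intros n Hn; apply Rlt_le, HN, Hn.
Qed.

Lemma filterdiff_of_quadratic {U V : NormedModule C_AbsRing} (f l : U -> V) (x : U) (K d : R) :
  0 < d -> is_linear l ->
  (forall h, norm h < d ->
     norm (minus (minus (f (plus x h)) (f x)) (l h)) <= K * norm h ^ 2) ->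
  filterdiff f (locally x) l.
Proof.
intros Hd Hl H; apply filterdiff_iff; split; [exact Hl|]; intros eps Heps.
assert (HK := Rabs_pos K).
exists (Rmin d (eps / (1 + Rabs K))); split.
{ apply Rmin_glb_lt; [exact Hd|apply Rdiv_lt_0_compat; lra]. }
intros h Hh; assert (Hh1 := Rlt_le_trans _ _ _ Hh (Rmin_l _ _)).
assert (Hh2 := Rlt_le_trans _ _ _ Hh (Rmin_r _ _)).
apply Rle_trans with (1 := H h Hh1).
assert (Hn := norm_ge_0 h); assert (HK' := Rle_abs K).
apply Rle_trans with ((1 + Rabs K) * norm h * norm h); [simpl; nra|].
apply Rmult_le_compat_r; [exact Hn|].
apply Rle_trans with ((1 + Rabs K) * (eps / (1 + Rabs K))); [apply Rmult_le_compat_l; lra|].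
right; field; lra.
Qed.

Section Weierstrass.

Context {U : NormedModule C_AbsRing} {V0 : CompleteNormedModule C_AbsRing}.
Local Notation V := (CompleteNormedModule.NormedModule C_AbsRing V0).

Lemma locally_bounded (f : U -> V) (x : U) : ex_filterdiff f (locally x) ->
  exists r, 0 < r /\ forall y : U, norm (minus y x) < r -> norm (f y) <= norm (f x) + 1.
Proof.
intros Hf; destruct (filterdiff_continuous_norm f x Hf 1 Rlt_0_1) as [r [Hr H]].
exists r; split; [exact Hr|]; intros y Hy; specialize (H (minus y x) Hy).
replace (plus x (minus y x)) with y in H by lmod U.
assert (K := norm_le_minus (f y) (f x)); lra.
Qed.

(** Cauchy estimates for [fn n - fn m] make the derivatives at [x] converge in each direction. The
    quadratic remainder has a constant independent of [n], so it passes to the limit and exhibits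
    the limit operator as the derivative of [f]. *)
Theorem ex_filterdiff_uniform_limit (fn : nat -> U -> V) (f : U -> V) (x : U) (r : R) : 0 < r ->
  (forall n, diff_on (fn n) x r) ->
  (forall eps, 0 < eps -> exists N, forall n, (N <= n)%nat ->
     forall y : U, norm (minus y x) < r -> norm (minus (fn n y) (f y)) <= eps) ->
  ex_filterdiff f (locally x).
Proof.
intros Hr Hfn Hlim.
assert (Hx : norm (minus x x) < r) by (rewrite norm_minus_diag; exact Hr).
destruct (Hlim 1 Rlt_0_1) as [N1 HN1].
destruct (locally_bounded (fn N1) x (Hfn N1 x Hx)) as [r1 [Hr1 Hb]].
set (rho := Rmin r r1 / 4).
assert (Hrho : 0 < rho) by (unfold rho; assert (0 < Rmin r r1) by (apply Rmin_glb_lt; lra); lra).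
assert (Hrr : 4 * rho <= r /\ 4 * rho <= r1).
{ assert (K1 := Rmin_l r r1); assert (K2 := Rmin_r r r1); unfold rho; lra. }
(* One unit bounds the variation of [fn N1] near [x]; the other two bound the distance from [fn n]
   to [fn N1] through [f]. *)
set (M := norm (fn N1 x) + 3).
assert (HM : forall n, (N1 <= n)%nat -> forall y : U, norm (minus y x) < 4 * rho -> norm (fn n y) <= M).
{ intros n Hn y Hy; specialize (Hb y ltac:(lra)).
  assert (H1 := HN1 n Hn y ltac:(lra)); assert (H2 := HN1 N1 (Nat.le_refl _) y ltac:(lra)).
  assert (K1 := norm_le_minus (fn n y) (fn N1 y)).
  assert (K2 := norm_minus_trans (f y) (fn n y) (fn N1 y)).
  rewrite (norm_minus_sym (f y)) in K2; unfold M; lra. }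
assert (Hdiff : forall n, diff_on (fn n) x (4 * rho)).
{ intros n; apply (diff_on_sub (fn n) x x r); [rewrite norm_minus_diag; lra|apply Hfn]. }
set (D := fun n v => frechet (fn n) x v).
assert (HD : forall v, exists l, seq_lim (fun n => D n v) l).
{ intros v; apply cauchy_seq_lim; intros eps Heps.
  assert (Hv := norm_ge_0 v).
  set (e := eps * r / (4 * (1 + norm v))).
  assert (He : 0 < e) by (apply Rdiv_lt_0_compat; [apply Rmult_lt_0_compat|]; lra).
  destruct (Hlim e He) as [N HN]; exists N; intros n m Hn Hm.
  assert (Hd : forall y : U, norm (minus y x) < r ->
    filterdiff (fun y => minus (fn n y) (fn m y)) (locally y)
      (fun h => minus (frechet (fn n) y h) (frechet (fn m) y h))).
  { intros y Hy; apply (filterdiff_minus_fct (fn n) (fn m)); apply frechet_correct; now apply Hfn. }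
  unfold D; rewrite <- (frechet_eq _ _ _ (Hd x Hx) v).
  apply Rle_trans with (2 * (2 * e) / r * norm v).
  - apply frechet_bound; [exact Hr|intros y Hy; eexists; exact (Hd y Hy)|].
    intros y Hy; apply Rle_trans with (1 := norm_minus_trans (f y) _ _).
    rewrite (norm_minus_sym (f y)).
    assert (K1 := HN n Hn y Hy); assert (K2 := HN m Hm y Hy); lra.
  - apply Rle_trans with (2 * (2 * e) / r * (1 + norm v)); [|right; unfold e; field; lra].
    apply Rmult_le_compat_l; [|lra]; apply Rmult_le_pos; [lra|].
    apply Rlt_le, Rinv_0_lt_compat, Hr. }
set (l := fun v => proj1_sig (constructive_indefinite_description _ (HD v))).
assert (Hl : forall v, seq_lim (fun n => D n v) (l v)).
{ intros v; exact (proj2_sig (constructive_indefinite_description _ (HD v))). }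
assert (HM0 : 0 <= M) by (unfold M; generalize (norm_ge_0 (fn N1 x)); lra).
assert (Hlin : is_linear l).
{ split.
  - intros v w; apply (seq_lim_unique (fun n => D n (plus v w))); [apply Hl|].
    intros eps Heps; destruct (seq_lim_plus _ _ _ _ (Hl v) (Hl w) eps Heps) as [N HN].
    exists N; intros n Hn; specialize (HN n Hn); unfold D in *.
    now rewrite blin_fun_plus.
  - intros k v; apply (seq_lim_unique (fun n => D n (scal k v))); [apply Hl|].
    intros eps Heps; destruct (seq_lim_scal _ _ k (Hl v) eps Heps) as [N HN].
    exists N; intros n Hn; specialize (HN n Hn); unfold D in *.
    now rewrite blin_fun_scal.
  - exists (2 * M / (4 * rho) + 1); split.
    + assert (0 <= 2 * M / (4 * rho)); [|lra].
      apply Rmult_le_pos; [lra|apply Rlt_le, Rinv_0_lt_compat; lra].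
    + intros v; apply Rle_trans with (2 * M / (4 * rho) * norm v).
      * apply (seq_lim_norm_le _ _ N1 _ (Hl v)); intros n Hn.
        apply frechet_bound; [lra|apply Hdiff|apply HM, Hn].
      * apply Rmult_le_compat_r; [apply norm_ge_0|lra]. }
exists l; apply (filterdiff_of_quadratic f l x (2 * M / rho ^ 2) rho Hrho Hlin).
intros h Hh.
assert (Hf : forall y : U, norm (minus y x) < r -> seq_lim (fun n => fn n y) (f y)).
{ intros y Hy eps Heps; destruct (Hlim eps Heps) as [N HN]; exists N; intros n Hn; now apply HN. }
assert (Hxh : norm (minus (plus x h) x) < r) by (norm_replace U h; lra).
apply (seq_lim_norm_le _ _ N1 _
  (seq_lim_minus _ _ _ _ (seq_lim_minus _ _ _ _ (Hf (plus x h) Hxh) (Hf x Hx)) (Hl h))).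
intros n Hn; apply taylor_quadratic; [exact Hrho|apply Hdiff|apply HM, Hn|exact Hh].
Qed.

End Weierstrass.

Section BlinComplete.

Context {U : NormedModule C_AbsRing} {V0 : CompleteNormedModule C_AbsRing}.
Local Notation V := (CompleteNormedModule.NormedModule C_AbsRing V0).

(** The limit is built pointwise from the completeness of [V0]. Its algebraic laws and its bound are
    tested on a single operator close to it at the finitely many vectors concerned. *)
Lemma blin_cauchy_converges (F : (blin U V -> Prop) -> Prop) :
  ProperFilter F -> cauchy F -> exists A : blin U V, forall eps : posreal, F (ball A eps).
Proof.
intros HF HC0.
assert (Hand : forall P Q, F P -> F Q -> F (fun A => P A /\ Q A)) by (intros P Q; apply filter_and).
assert (Hex : forall P, F P -> exists A, P A) by (intros P; apply filter_ex).
assert (HC : forall eps, 0 < eps ->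
  exists A : blin U V, F (fun B : blin U V => blin_norm (minus B A) < eps)).
{ intros eps Heps; destruct (HC0 (mkposreal _ Heps)) as [A HA]; exists A; exact HA. }
assert (Hx : forall x : U, cauchy (filtermap (fun A : blin U V => (blin_fun A x : V0)) F)).
{ intros x eps.
  assert (Hp : 0 < eps / (1 + norm x)).
  { apply Rdiv_lt_0_compat; [apply cond_pos|generalize (norm_ge_0 x); lra]. }
  destruct (HC _ Hp) as [A HA]; exists (A x); unfold filtermap.
  revert HA; apply filter_imp; intros B HB'; apply (@norm_compat1 C_AbsRing V0).
  apply Rle_lt_trans with (blin_norm (minus B A) * norm x).
  { apply blin_minus_bound. }
  assert (Nx := norm_ge_0 x).
  apply Rle_lt_trans with (eps / (1 + norm x) * norm x); [apply Rmult_le_compat_r; lra|].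
  apply Rlt_le_trans with (eps / (1 + norm x) * (1 + norm x)); [apply Rmult_lt_compat_l; lra|].
  right; field; lra. }
set (l := fun x : U => lim (filtermap (fun A : blin U V => (blin_fun A x : V0)) F) : V).
assert (Hl : forall x e, 0 < e -> F (fun A : blin U V => norm (minus (blin_fun A x) (l x)) < e)).
{ intros x e He.
  assert (K := complete_cauchy _ (filtermap_proper_filter _ _ _ F HF) (Hx x)).
  assert (Hloc : locally (l x) (fun y => norm (minus y (l x)) < e)).
  { apply locally_norm_iff; exists e; tauto. }
  destruct Hloc as [d Hd]; specialize (K d); unfold filtermap in K.
  revert K; apply filter_imp; intros A HA; exact (Hd _ HA). }
assert (Hplus : forall x y, l (plus x y) = plus (l x) (l y)).
{ intros x y.
  assert (E : minus (l (plus x y)) (plus (l x) (l y)) = zero).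
  2:{ replace (l (plus x y)) with (plus (plus (l x) (l y)) (minus (l (plus x y)) (plus (l x) (l y)))) by lmod V.
      rewrite E; lmod V. }
  apply norm_le_eps_zero; intros eps Heps.
  destruct (Hex _ (Hand _ _ (Hl (plus x y) (eps / 3) ltac:(lra))
     (Hand _ _ (Hl x (eps / 3) ltac:(lra)) (Hl y (eps / 3) ltac:(lra))))) as [A [H1 [H2 H3]]].
  rewrite blin_fun_plus in H1.
  norm_replace V (minus (plus (minus (A x) (l x)) (minus (A y) (l y))) (minus (plus (A x) (A y)) (l (plus x y)))).
  apply Rle_trans with (1 := norm_minus_le _ _).
  assert (K := norm_triangle (minus (A x) (l x)) (minus (A y) (l y))); lra. }
assert (Hscal : forall (k : C_AbsRing) x, l (scal k x) = scal k (l x)).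
{ intros k x.
  assert (E : minus (l (scal k x)) (scal k (l x)) = zero).
  2:{ replace (l (scal k x)) with (plus (scal k (l x)) (minus (l (scal k x)) (scal k (l x)))) by lmod V.
      rewrite E; lmod V. }
  apply norm_le_eps_zero; intros eps Heps.
  assert (Hk := Cmod_ge_0 k).
  assert (He : 0 < eps / (2 * (1 + Cmod k))) by (apply Rdiv_lt_0_compat; lra).
  destruct (Hex _ (Hand _ _ (Hl (scal k x) (eps / 2) ltac:(lra)) (Hl x _ He))) as [A [H1 H2]].
  rewrite blin_fun_scal in H1.
  norm_replace V (minus (scal k (minus (A x) (l x))) (minus (scal k (A x)) (l (scal k x)))).
  apply Rle_trans with (1 := norm_minus_le _ _); rewrite norm_scal_eq.
  assert (Cmod k * norm (minus (A x) (l x)) <= (1 + Cmod k) * (eps / (2 * (1 + Cmod k)))).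
  { apply Rmult_le_compat; try lra; apply norm_ge_0. }
  replace ((1 + Cmod k) * (eps / (2 * (1 + Cmod k)))) with (eps / 2) in * by (field; lra); lra. }
assert (Hlin : is_linear l).
{ split; [exact Hplus|exact Hscal|].
  destruct (HC 1 Rlt_0_1) as [A HA].
  exists (blin_norm A + 1); split.
  { assert (K := opnorm_ge_0 A (proj2_sig A)); change (0 <= blin_norm A) in K; lra. }
  intros x; apply le_epsilon; intros eps Heps.
  destruct (Hex _ (Hand _ _ HA (Hl x eps Heps))) as [B [H1' H2]].
  rewrite norm_minus_sym in H2; apply Rle_trans with (1 := norm_le_minus (l x) (B x)).
  apply Rplus_le_compat; [|lra].
  assert (K1 := norm_le_minus (B x) (A x)).
  assert (K2 := blin_fun_bound A x).
  assert (K3 := blin_minus_bound B A x).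
  assert (blin_norm (minus B A) * norm x <= 1 * norm x) by (apply Rmult_le_compat_r; [apply norm_ge_0|lra]).
  lra. }
exists (exist _ l Hlin : blin U V); intros eps.
assert (Hp : 0 < eps / 4) by (generalize (cond_pos eps); lra).
destruct (HC _ Hp) as [A HA].
generalize HA; apply filter_imp; intros B HB'.
change (blin_norm (minus B (exist _ l Hlin : blin U V)) < eps).
apply Rle_lt_trans with (eps / 2); [|lra].
apply blin_minus_norm_le; intros x Hx1; change (norm (minus (B x) (l x)) <= eps / 2).
apply le_epsilon; intros e He.
(* The auxiliary [B'] depends on [x], but both [B] and [B'] are within [eps / 4] of the fixed [A],
   so the resulting bound is uniform in [x]. *)
destruct (Hex _ (Hand _ _ HA (Hl x e He))) as [B' [H1' H2]].
assert (Hop : forall B1 : blin U V, blin_norm (minus B1 A) < eps / 4 -> norm (minus (B1 x) (A x)) <= eps / 4).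
{ intros B1 HB1; apply Rle_trans with (1 := blin_minus_bound B1 A x).
  rewrite <- (Rmult_1_r (eps / 4)); apply Rmult_le_compat; try lra; [|apply norm_ge_0].
  exact (opnorm_ge_0 _ (proj2_sig (minus B1 A : blin U V))). }
assert (K1 := Hop B HB'); assert (K2 := Hop B' H1').
assert (T1 := norm_minus_trans (A x) (B x) (l x)); assert (T2 := norm_minus_trans (B' x) (A x) (l x)).
rewrite (norm_minus_sym (A x) (B' x)) in T2; lra.
Qed.

(** The choice depends on [F] only as a predicate; mutually finer filters are equal by
    extensionality and so receive the same limit, as [blin_lim_close] requires. *)
Definition blin_lim (F : (blin U V -> Prop) -> Prop) : blin U V :=
  epsilon (inhabits blin_zero) (fun A => forall eps : posreal, F (ball A eps)).

Lemma blin_lim_cauchy F : ProperFilter F -> cauchy F ->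
  forall eps : posreal, F (ball (blin_lim F) eps).
Proof.
intros HF HC; apply (epsilon_spec (inhabits blin_zero) (fun A : blin U V => forall eps : posreal, F (ball A eps))).
now apply blin_cauchy_converges.
Qed.

Lemma blin_lim_close (F1 F2 : (blin U V -> Prop) -> Prop) :
  filter_le F1 F2 -> filter_le F2 F1 -> close (blin_lim F1) (blin_lim F2).
Proof.
intros H12 H21; assert (F1 = F2) as ->; [|apply close_refl].
apply functional_extensionality; intros P; apply propositional_extensionality.
split; [apply H21|apply H12].
Qed.

(** With this structure [frechet f] is itself a map into a Banach space, so the differentiability
    theorem below can be iterated. *)
Definition blin_CompleteNormedModule : CompleteNormedModule C_AbsRing :=
  CompleteNormedModule.Pack C_AbsRing (blin U V)
    (CompleteNormedModule.Class C_AbsRing (blin U V)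
       (NormedModule.class C_AbsRing (blin_NormedModule U V))
       (CompleteSpace.Mixin (blin_NormedModule U V) blin_lim blin_lim_cauchy blin_lim_close))
    (blin U V).

End BlinComplete.

Arguments blin_CompleteNormedModule : clear implicits.

(** * Differentiability of the Fréchet derivative *)

Section FrechetDifferentiable.

Context {U : NormedModule C_AbsRing} {V0 : CompleteNormedModule C_AbsRing}.
Local Notation V := (CompleteNormedModule.NormedModule C_AbsRing V0).

(** The difference quotients with step [v / k] miss [Df(y) v] by at most a constant over [k], by
    [taylor_quadratic], uniformly in [y] near [x]; Weierstrass' theorem then applies. *)
Lemma ex_filterdiff_frechet_apply (f : U -> V) (x v : U) (r M : R) : 0 < r ->
  diff_on f x (8 * r) -> (forall y : U, norm (minus y x) < 8 * r -> norm (f y) <= M) ->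
  ex_filterdiff (fun y => frechet f y v) (locally x).
Proof.
intros Hr Hf HM.
assert (Nv := norm_ge_0 v).
destruct (INR_unbounded (norm v / r)) as [N0 HN0].
(* The shift by [N0] makes every step shorter than [r], already for [n = 0]; the successor keeps
   [k n] nonzero. *)
set (k := fun n => INR (S (n + N0))).
assert (Hk : forall n, 0 < k n) by (intros n; apply lt_0_INR; lia).
assert (Hkv : forall n, norm (scal (RtoC (/ k n)) v) < r).
{ intros n; assert (K := Hk n); rewrite norm_scal_eq, Cmod_R, Rabs_pos_eq
    by (apply Rlt_le, Rinv_0_lt_compat, K).
  apply Rmult_lt_reg_l with (k n); [exact K|].
  rewrite <- Rmult_assoc, Rinv_r, Rmult_1_l by lra.
  assert (H : INR N0 <= k n) by (apply le_INR; lia).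
  apply Rmult_lt_compat_r with (r := r) in HN0; [|exact Hr].
  replace (norm v / r * r) with (norm v) in HN0 by (field; lra); nra. }
assert (HM0 : 0 <= M).
{ apply Rle_trans with (norm (f x)); [apply norm_ge_0|apply HM; rewrite norm_minus_diag; lra]. }
apply (ex_filterdiff_uniform_limit
  (fun n y => scal (RtoC (k n)) (minus (f (plus y (scal (RtoC (/ k n)) v))) (f y)))
  _ x r Hr).
- intros n y Hy; eexists.
  apply (filterdiff_scal_r_fct (RtoC (k n) : C_AbsRing)
    (fun y => minus (f (plus y (scal (RtoC (/ k n)) v))) (f y)));
    [exact Cmult_comm|].
  apply (filterdiff_minus_fct (fun y => f (plus y (scal (RtoC (/ k n)) v))) f).
  + apply ex_filterdiff_translate, frechet_correct, Hf.
    norm_replace U (plus (minus y x) (scal (RtoC (/ k n)) v)).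
    apply Rle_lt_trans with (1 := norm_triangle _ _); specialize (Hkv n); lra.
  + apply frechet_correct, Hf; lra.
- intros eps Heps.
  set (K := 2 * M / r ^ 2 * norm v ^ 2).
  assert (HK : 0 <= K).
  { apply Rmult_le_pos; [|simpl; nra]; apply Rmult_le_pos; [lra|].
    apply Rlt_le, Rinv_0_lt_compat; simpl; nra. }
  destruct (INR_unbounded (K / eps)) as [N HN]; exists N; intros n Hn y Hy.
  assert (Kn := Hk n).
  set (w := scal (RtoC (/ k n)) v).
  assert (Nw : norm w = / k n * norm v).
  { unfold w; rewrite norm_scal_eq, Cmod_R, Rabs_pos_eq; [reflexivity|].
    apply Rlt_le, Rinv_0_lt_compat, Kn. }
  assert (Hkk : (RtoC (k n) * RtoC (/ k n) = 1)%C) by (rewrite <- RtoC_mult, Rinv_r by lra; reflexivity).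
  replace (frechet f y v) with (scal (RtoC (k n)) (frechet f y w)).
  2:{ unfold w; rewrite blin_fun_scal, scal_assoc.
      change (mult (RtoC (k n) : C_AbsRing) (RtoC (/ k n))) with (RtoC (k n) * RtoC (/ k n))%C.
      rewrite Hkk; exact (scal_one (frechet f y v)). }
  norm_replace V (scal (RtoC (k n)) (minus (minus (f (plus y w)) (f y)) (frechet f y w))).
  rewrite norm_scal_eq, Cmod_R, Rabs_pos_eq by lra.
  assert (T : norm (minus (minus (f (plus y w)) (f y)) (frechet f y w)) <= 2 * M / r ^ 2 * norm w ^ 2).
  { apply taylor_quadratic; [exact Hr| | |exact (Hkv n)].
    - apply (diff_on_sub f x) with (8 * r); [lra|exact Hf].
    - intros z Hz; apply HM; assert (T := norm_minus_trans y z x); lra. }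
  apply Rmult_le_compat_l with (r := k n) in T; [|lra].
  apply Rle_trans with (1 := T).
  replace (k n * (2 * M / r ^ 2 * norm w ^ 2)) with (K / k n) by (rewrite Nw; unfold K; field; lra).
  apply Rmult_le_reg_r with (k n); [exact Kn|].
  replace (K / k n * k n) with K by (field; lra).
  assert (INR N <= k n) by (apply le_INR; lia).
  apply Rmult_lt_compat_l with (r := eps) in HN; [|exact Heps].
  replace (eps * (K / eps)) with K in HN by (field; lra); nra.
Qed.

(** The candidate sends [w] to the operator that maps [v] to the derivative of [y |-> Df(y) v] at
    [x] in direction [w]. Linearity in [v] follows from uniqueness of derivatives. The Taylor
    remainder of [y |-> Df(y) v] is at most a constant times [norm v] times [norm h ^ 2], hence
    uniform over [norm v <= 1]: differentiability in operator norm. *)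
Theorem ex_filterdiff_frechet (f : U -> V) (x : U) (R0 : R) : 0 < R0 -> diff_on f x R0 ->
  ex_filterdiff (frechet f : U -> blin_NormedModule U V) (locally x).
Proof.
intros HR Hf0.
destruct (locally_bounded f x (Hf0 x ltac:(rewrite norm_minus_diag; exact HR))) as [r1 [Hr1 HM0]].
set (M := norm (f x) + 1) in *.
(* Each [Df(.) v] must be differentiable within [4 * r] of [x], and at such a point this uses [f] on
   a ball of radius [8 * r]; all this stays within [12 * r]. *)
set (r := Rmin R0 r1 / 16).
assert (Hrr : 0 < r /\ 16 * r <= R0 /\ 16 * r <= r1).
{ assert (0 < Rmin R0 r1) by (apply Rmin_glb_lt; assumption).
  assert (K1 := Rmin_l R0 r1); assert (K2 := Rmin_r R0 r1); unfold r; lra. }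
destruct Hrr as [Hr [HrR Hr1']].
assert (Hf : forall y : U, norm (minus y x) < 4 * r -> diff_on f y (8 * r)).
{ intros y Hy; apply (diff_on_sub f x) with R0; [lra|exact Hf0]. }
assert (HM : forall y : U, norm (minus y x) < 4 * r ->
  forall z : U, norm (minus z y) < 8 * r -> norm (f z) <= M).
{ intros y Hy z Hz; apply HM0; assert (T := norm_minus_trans y z x); lra. }
assert (HMp : 0 <= M) by (unfold M; generalize (norm_ge_0 (f x)); lra).
set (g := fun v y => frechet f y v).
assert (Hg : forall v, diff_on (g v) x (4 * r)).
{ intros v y Hy; apply (ex_filterdiff_frechet_apply f y v r M Hr (Hf y Hy) (HM y Hy)). }
assert (Hxx : forall s, 0 < s -> norm (minus x x) < s) by (intros s Hs; rewrite norm_minus_diag; exact Hs).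
set (B := 2 * M / (8 * r)).
assert (HB : 0 <= B) by (apply Rmult_le_pos; [lra|apply Rlt_le, Rinv_0_lt_compat; lra]).
assert (Hgb : forall v y, norm (minus y x) < 4 * r -> norm (g v y) <= B * norm v).
{ intros v y Hy; apply frechet_bound; [lra|exact (Hf y Hy)|exact (HM y Hy)]. }
assert (HA : forall v w, norm (frechet (g v) x w) <= 2 * B / (4 * r) * norm v * norm w).
{ intros v w; replace (2 * B / (4 * r) * norm v * norm w) with (2 * (B * norm v) / (4 * r) * norm w)
    by (field; lra).
  apply frechet_bound; [lra|exact (Hg v)|exact (Hgb v)]. }
set (K := 2 * B / (4 * r)) in *.
assert (HK : 0 <= K) by (apply Rmult_le_pos; [lra|apply Rlt_le, Rinv_0_lt_compat; lra]).
assert (Hgd : forall v, filterdiff (g v) (locally x) (frechet (g v) x)).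
{ intros v; apply frechet_correct, Hg, Hxx; lra. }
assert (HlinA : forall w, is_linear (fun v => frechet (g v) x w)).
{ intros w; split.
  - intros v1 v2; apply (frechet_eq (g (plus v1 v2)) x (fun w => plus (frechet (g v1) x w) (frechet (g v2) x w))).
    apply filterdiff_ext with (fun y => plus (g v1 y) (g v2 y)).
    + intros y; unfold g; now rewrite blin_fun_plus.
    + apply (filterdiff_plus_fct (g v1) (g v2)); apply Hgd.
  - intros k v; apply (frechet_eq (g (scal k v)) x (fun w => scal k (frechet (g v) x w))).
    apply filterdiff_ext with (fun y => scal k (g v y)).
    + intros y; unfold g; now rewrite blin_fun_scal.
    + apply (filterdiff_scal_r_fct k (g v)); [exact Cmult_comm|apply Hgd].
  - exists (K * norm w + 1); assert (Nw := norm_ge_0 w); split; [nra|].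
    intros v; apply Rle_trans with (1 := HA v w); assert (Nv := norm_ge_0 v); nra. }
set (A := fun w : U => exist _ _ (HlinA w) : blin U V).
assert (Alin : @is_linear C_AbsRing U (blin_NormedModule U V) A).
{ split.
  - intros w1 w2; apply blin_ext; intros v; apply (blin_fun_plus (frechet (g v) x)).
  - intros k w; apply blin_ext; intros v; apply (blin_fun_scal (frechet (g v) x)).
  - exists (K + 1); split; [lra|]; intros w.
    change (opnorm (fun v => frechet (g v) x w) <= (K + 1) * norm w).
    apply opnorm_least; [apply HlinA|]; intros v Hv.
    apply Rle_trans with (1 := HA v w).
    assert (Nv := norm_ge_0 v); assert (Nw := norm_ge_0 w).
    apply Rmult_le_compat_r; [exact Nw|]; nra. }
exists A.
apply (@filterdiff_of_quadratic U (blin_NormedModule U V) (frechet f) A x (2 * B / r ^ 2) r Hr Alin).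
intros h Hh.
set (D := minus (minus (frechet f (plus x h)) (frechet f x)) (A h)).
change (opnorm (blin_fun D) <= 2 * B / r ^ 2 * norm h ^ 2).
apply opnorm_least; [exact (proj2_sig D)|]; intros v Hv.
change (norm (minus (minus (g v (plus x h)) (g v x)) (frechet (g v) x h)) <= 2 * B / r ^ 2 * norm h ^ 2).
apply Rle_trans with (2 * (B * norm v) / r ^ 2 * norm h ^ 2).
- apply taylor_quadratic; [exact Hr|exact (Hg v)|exact (Hgb v)|exact Hh].
- assert (Hi : 0 < / r ^ 2) by (apply Rinv_0_lt_compat; simpl; nra).
  apply Rmult_le_compat_r; [simpl; assert (Nh := norm_ge_0 h); nra|].
  apply Rmult_le_compat_r; [lra|].
  assert (Nv := norm_ge_0 v); nra.
Qed.

End FrechetDifferentiable.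

(** * The coefficient inequality *)

Section Caratheodory.

Lemma Cmod_le_of_Re (b : R) (t : C) : 0 < b -> - b <= Re t -> Cmod t <= Cmod (RtoC (2 * b) + t).
Proof.
intros Hb Ht; destruct t as [x y]; unfold Cmod; simpl in *.
apply sqrt_le_1_alt; nra.
Qed.

Lemma Re_le_Cmod (t : C) : Re t <= Cmod t.
Proof. apply Rle_trans with (1 := Rle_abs _), re_le_Cmod. Qed.

(** Only the even part [Q z = (P z + P (- z)) / 2 = 1 + z^2 e(z)] of [P z = 1 + z s(z)]
    matters; [(Q - 1) / (Q + 1 - 2 alpha)] is bounded by [1] and vanishes to second order. *)
Theorem caratheodory_second (s : C -> C_NormedModule) (alpha : R) (d : C) : alpha < 1 ->
  (forall z : C, Cmod z < 1 -> exists e, cderiv s z e) ->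
  (forall z : C, Cmod z < 1 -> alpha <= Re (1 + z * s z)%C) ->
  cderiv s 0%C d -> Cmod d <= 2 * (1 - alpha).
Proof.
intros Ha Hs HRe Hd; set (b := 1 - alpha).
assert (Hb : 0 < b) by (unfold b; lra).
(* The even part of [P] is [1 + z^2 e(z)] with this [e]; the value [d] at [0] is the limit of the
   quotient, so [e] is continuous there. *)
set (e := fun z : C => if excluded_middle_informative (z = 0%C) then d
                       else ((s z - s (- z)) * / (2 * z))%C).
assert (e0 : e 0%C = d) by (unfold e; destruct excluded_middle_informative as [_|H]; [reflexivity|now elim H]).
assert (ez : forall z : C, z <> 0%C -> e z = ((s z - s (- z)) * / (2 * z))%C).
{ intros z Hz; unfold e; destruct excluded_middle_informative; [contradiction|reflexivity]. }
assert (two : RtoC 2 <> 0%C) by (intros E; apply RtoC_inj in E; lra).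
assert (Hcont : forall eps, 0 < eps -> exists dl, 0 < dl /\ forall z : C, Cmod z < dl -> Cmod (e z - d) <= eps).
{ intros eps Heps.
  destruct (proj1 (cderiv_iff s 0%C d) Hd eps Heps) as [dl [Hdl K]].
  exists dl; split; [exact Hdl|]; intros z Hz.
  destruct (excluded_middle_informative (z = 0%C)) as [->|Hz0].
  { rewrite e0; replace (d - d)%C with (RtoC 0) by ring; rewrite Cmod_0; lra. }
  assert (Hp : 0 < Cmod z) by now apply Cmod_gt_0.
  assert (K1 := K z Hz); assert (K2 := K (- z)%C); rewrite Cmod_opp in K2; specialize (K2 Hz).
  rewrite Cplus_0_l in K1, K2.
  change (Cmod (s z - s 0%C - z * d) <= eps * Cmod z) in K1.
  change (Cmod (s (- z)%C - s 0%C - - z * d) <= eps * Cmod z) in K2.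
  rewrite ez by exact Hz0.
  replace ((s z - s (- z)%C) * / (2 * z) - d)%C with
    (((s z - s 0%C - z * d) - (s (- z)%C - s 0%C - - z * d)) * / (2 * z))%C by (field; auto).
  rewrite Cmod_mult, Cmod_inv, Cmod_mult, Cmod_R, (Rabs_pos_eq 2) by (try lra; now apply Cmult_neq_0).
  apply Rmult_le_reg_r with (2 * Cmod z); [lra|].
  rewrite Rmult_assoc, Rinv_l, Rmult_1_r by lra.
  assert (T := Cmod_triangle (s z - s 0%C - z * d) (- (s (- z)%C - s 0%C - - z * d))).
  rewrite Cmod_opp in T.
  eapply Rle_trans; [exact T|]; lra. }
assert (HRt : forall z : C, Cmod z < 1 -> - b <= Re (z * z * e z)%C).
{ intros z Hz; destruct (excluded_middle_informative (z = 0%C)) as [->|Hz0].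
  { replace (0 * 0 * e 0)%C with (RtoC 0) by ring; simpl; lra. }
  assert (K1 := HRe z Hz); assert (K2 := HRe (- z)%C); rewrite Cmod_opp in K2; specialize (K2 Hz).
  rewrite ez by exact Hz0.
  replace (z * z * ((s z - s (- z)%C) * / (2 * z)))%C with
    (RtoC (/ 2) * ((1 + z * s z) + (1 + - z * s (- z)%C)) - 1)%C
    by (rewrite RtoC_inv by lra; field; auto).
  set (p := (1 + z * s z)%C) in *; set (q := (1 + - z * s (- z)%C)%C) in *.
  replace (Re (RtoC (/ 2) * (p + q) - 1)) with ((Re p + Re q) / 2 - 1); [unfold b; lra|].
  destruct p, q; simpl; field. }
assert (Hden : forall z : C, Cmod z < 1 -> b <= Cmod (RtoC (2 * b) + z * z * e z)).
{ intros z Hz; apply Rle_trans with (2 := Re_le_Cmod _); specialize (HRt z Hz).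
  destruct (z * z * e z)%C as [x y]; simpl in *; lra. }
assert (Hden0 : forall z : C, Cmod z < 1 -> (RtoC (2 * b) + z * z * e z)%C <> 0%C).
{ intros z Hz E; specialize (Hden z Hz); rewrite E, Cmod_0 in Hden; lra. }
(* This is [(Q - 1) / (Q + 1 - 2 alpha)] divided by [z^2], so that [K 0 = d / (2 b)] and
   [Cmod (K z) <= / r ^ 2] on the circle of radius [r]. The half-plane condition enters as
   [|t| <= |2 b + t|] for [Re t >= - b]. *)
set (K := fun z : C => (e z * / (RtoC (2 * b) + z * z * e z))%C).
assert (HK0 : K 0%C = (d * / RtoC (2 * b))%C).
{ unfold K; rewrite e0; replace (RtoC (2 * b) + 0 * 0 * d)%C with (RtoC (2 * b)) by ring; reflexivity. }
assert (bn : RtoC (2 * b) <> 0%C) by (intros E; apply RtoC_inj in E; lra).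
assert (Hr : forall r, 0 < r < 1 -> Cmod (K 0%C) <= / r ^ 2).
{ intros r Hr.
  apply (center_norm_le C_CompleteNormedModule K r 1); try tauto.
  - intros eps Heps.
    set (B := Cmod d).
    assert (HB : 0 <= B) by apply Cmod_ge_0.
    set (e1 := Rmin 1 (eps * b / 2)).
    assert (He1' : 0 < eps * b) by (apply Rmult_lt_0_compat; assumption).
    assert (He1 : 0 < e1) by (apply Rmin_glb_lt; lra).
    destruct (Hcont e1 He1) as [dl [Hdl Hc]].
    set (e2 := eps * b ^ 2 / ((B + 1) ^ 2)).
    assert (He2 : 0 < e2) by (apply Rdiv_lt_0_compat; [apply Rmult_lt_0_compat; [lra|apply pow_lt; lra]|apply pow_lt; lra]).
    exists (Rmin dl (Rmin 1 e2)); split; [apply Rmin_glb_lt; [exact Hdl|apply Rmin_glb_lt; lra]|].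
    intros z Hz.
    assert (Hz1 := Rlt_le_trans _ _ _ Hz (Rmin_l _ _)).
    assert (Hz' := Rlt_le_trans _ _ _ Hz (Rmin_r _ _)).
    assert (Hz2 := Rlt_le_trans _ _ _ Hz' (Rmin_l _ _)).
    assert (Hz3 := Rlt_le_trans _ _ _ Hz' (Rmin_r _ _)).
    specialize (Hc z Hz1); change (Cmod (K z - K 0%C) <= eps); rewrite HK0; unfold K.
    replace (e z * / (RtoC (2 * b) + z * z * e z) - d * / RtoC (2 * b))%C with
      ((RtoC (2 * b) * (e z - d) - z * z * (e z * d)) * / (RtoC (2 * b) * (RtoC (2 * b) + z * z * e z)))%C.
    2:{ field; split; [exact bn|now apply Hden0]. }
    rewrite Cmod_mult, Cmod_inv by (apply Cmult_neq_0; [exact bn|now apply Hden0]).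
    rewrite Cmod_mult, Cmod_R, (Rabs_pos_eq (2 * b)) by lra.
    specialize (Hden z Hz2).
    set (m := Cmod (RtoC (2 * b) + z * z * e z)) in *.
    assert (Hez : Cmod (e z) <= B + 1).
    { replace (e z) with (d + (e z - d))%C by ring.
      apply Rle_trans with (1 := Cmod_triangle _ _).
      assert (e1 <= 1) by apply Rmin_l; unfold B; lra. }
    assert (Hnum : Cmod (RtoC (2 * b) * (e z - d) - z * z * (e z * d)) <= 2 * b * (eps * b)).
    { apply Rle_trans with (1 := Cmod_triangle _ _).
      rewrite Cmod_opp, !Cmod_mult, Cmod_R, Rabs_pos_eq by lra.
      fold B.
      assert (He1b : e1 <= eps * b / 2) by apply Rmin_r.
      assert (H1 : 2 * b * Cmod (e z - d) <= 2 * b * (eps * b / 2)) by (apply Rmult_le_compat_l; lra).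
      assert (Hz0 := Cmod_ge_0 z).
      assert (H2 : Cmod z * Cmod z * (Cmod (e z) * B) <= e2 * ((B + 1) * (B + 1))).
      { apply Rmult_le_compat; [nra|apply Rmult_le_pos; [apply Cmod_ge_0|lra]|nra|].
        apply Rmult_le_compat; try lra; apply Cmod_ge_0. }
      replace (e2 * ((B + 1) * (B + 1))) with (eps * b ^ 2) in H2 by (unfold e2; field; lra).
      simpl in H2; lra. }
    assert (Hmb : 0 < 2 * b * m) by (apply Rmult_lt_0_compat; lra).
    apply Rmult_le_reg_r with (2 * b * m); [exact Hmb|].
    rewrite Rmult_assoc, Rinv_l, Rmult_1_r by lra.
    apply Rle_trans with (1 := Hnum); nra.
  - intros z Hz1 Hz2.
    assert (Hz0 : z <> 0%C) by (intros ->; rewrite Cmod_0 in Hz1; lra).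
    destruct (Hs z Hz2) as [d1 Hd1].
    destruct (Hs (- z)%C) as [d2 Hd2]; [rewrite Cmod_opp; exact Hz2|].
    set (ee := fun y : C => ((s y - s (- y)) * / (2 * y))%C).
    assert (Hee : exists e', cderiv (V := C_NormedModule) ee z e').
    { eexists; unfold ee.
      apply (cderiv_mult (fun y => s y - s (- y))%C (fun y => / (2 * y))%C).
      - apply (cderiv_minus s (fun y => s (- y)%C)); [exact Hd1|].
        apply (cderiv_comp s (fun y => - y)%C); [exact Hd2|].
        apply (cderiv_comp_linear (V := C_NormedModule) (W := C_NormedModule) (fun y => y) z (RtoC 1) Copp).
        + exact (@is_linear_opp C_AbsRing C_NormedModule).
        + apply cderiv_id.
      - apply (cderiv_comp (V := C_NormedModule) (fun y => / y)%C (fun y => 2 * y)%C).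
        + apply cderiv_inv; now apply Cmult_neq_0.
        + apply (cderiv_mult (fun _ => RtoC 2) (fun y => y)); [apply cderiv_const|apply cderiv_id]. }
    destruct Hee as [e' He'].
    eexists; apply (cderiv_ext_loc (V := C_NormedModule)) with
      (F := fun y : C => (ee y * / (RtoC (2 * b) + y * y * ee y))%C) (r := Cmod z); [exact Hz1| |].
    + intros y Hy; unfold K; rewrite ez; [reflexivity|intros ->].
      replace (0 - z)%C with (- z)%C in Hy by ring; rewrite Cmod_opp in Hy; lra.
    + apply (cderiv_mult ee (fun y => / (RtoC (2 * b) + y * y * ee y))%C); [exact He'|].
      apply (cderiv_comp (V := C_NormedModule) (fun y => / y)%C (fun y => RtoC (2 * b) + y * y * ee y)%C).
      * apply cderiv_inv; unfold ee; rewrite <- ez by exact Hz0; now apply Hden0.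
      * apply (cderiv_plus (V := C_NormedModule) (fun _ => RtoC (2 * b)) (fun y => y * y * ee y)%C);
          [apply cderiv_const|].
        apply (cderiv_mult (fun y => y * y)%C ee); [|exact He'].
        apply (cderiv_mult (fun y => y) (fun y => y)); apply cderiv_id.
  - intros z Hz; change (Cmod (K z) <= / r ^ 2); unfold K.
    assert (Hz1 : Cmod z < 1) by lra.
    assert (T := Cmod_le_of_Re b (z * z * e z) Hb (HRt z Hz1)).
    rewrite !Cmod_mult, Hz in T.
    rewrite Cmod_mult, Cmod_inv by now apply Hden0.
    specialize (Hden z Hz1); set (m := Cmod (RtoC (2 * b) + z * z * e z)) in *.
    assert (Hr2 : 0 < r ^ 2) by (apply pow_lt; lra).
    apply Rmult_le_reg_r with (m * r ^ 2); [apply Rmult_lt_0_compat; lra|].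
    replace (Cmod (e z) * / m * (m * r ^ 2)) with (r * r * Cmod (e z)) by (field; lra).
    replace (/ r ^ 2 * (m * r ^ 2)) with m by (field; lra); exact T. }
assert (HKd : Cmod (K 0%C) = Cmod d / (2 * b)).
{ rewrite HK0, Cmod_mult, Cmod_inv by exact bn; rewrite Cmod_R, Rabs_pos_eq by lra; reflexivity. }
assert (Hk1 : Cmod (K 0%C) <= 1).
{ destruct (Rle_or_lt (Cmod (K 0%C)) 1) as [H|H]; [exact H|exfalso].
  set (k := Cmod (K 0%C)) in *.
  assert (Hk2 : / k < 1) by (rewrite <- Rinv_1; apply Rinv_lt_contravar; lra).
  assert (Hk3 : 0 < / k) by (apply Rinv_0_lt_compat; lra).
  (* The limit [r -> 1]: by the strict inequality between arithmetic and geometric means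
     [r ^ 2 > / k], against [k <= / r ^ 2]. *)
  set (r := (1 + / k) / 2).
  specialize (Hr r ltac:(unfold r; lra)).
  assert (Hr2 : 0 < r ^ 2) by (apply pow_lt; unfold r; lra).
  apply Rmult_le_compat_r with (r := r ^ 2) in Hr; [|lra].
  rewrite Rinv_l in Hr by lra.
  assert (k * / k = 1) by (apply Rinv_r; lra).
  assert (r ^ 2 > / k); [unfold r; simpl; nra|].
  nra. }
rewrite HKd in Hk1; apply Rmult_le_compat_r with (r := 2 * b) in Hk1; [|lra].
replace (Cmod d / (2 * b) * (2 * b)) with (Cmod d) in Hk1 by (field; lra); lra.
Qed.

End Caratheodory.

Lemma is_linear_eval {U V : NormedModule C_AbsRing} (u : U) :
  @is_linear C_AbsRing (blin_NormedModule U V) V (fun A => blin_fun A u).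
Proof.
split; [reflexivity|reflexivity|].
exists (1 + norm u); split; [generalize (norm_ge_0 u); lra|]; intros A.
apply Rle_trans with (1 := blin_fun_bound A u).
change (norm A) with (blin_norm A).
assert (K : 0 <= blin_norm A) by exact (opnorm_ge_0 _ (proj2_sig A)).
assert (Nu := norm_ge_0 u); nra.
Qed.

(** The value [q] at [z] is frozen, so that [n y = N y - A y q] vanishes at [z] and
    [G y (N y) - q = G y (n y)]. Only the continuity of [G] along a fixed vector remains to be
    shown, and the derivative is [G z n']. *)
Lemma cderiv_inverse_apply {U : NormedModule C_AbsRing} (A G : C -> blin U U) (N : C -> U)
  (z : C) (A' : blin U U) (N' : U) (r : R) : 0 < r ->
  (forall y : C, Cmod (y - z) < r -> is_inverse (A y) (G y)) ->
  cderiv (V := blin_NormedModule U U) A z A' -> cderiv N z N' ->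
  cderiv (fun y => G y (N y)) z (G z (minus N' (A' (G z (N z))))).
Proof.
intros Hr Hinv HA HN.
set (q := G z (N z)).
assert (HG : forall h : C, Cmod h < r -> is_inverse (A (z + h)%C) (G (z + h)%C)).
{ intros h Hh; apply Hinv; now replace (z + h - z)%C with h by ring. }
assert (Hz : is_inverse (A z) (G z)).
{ apply Hinv; replace (z - z)%C with (RtoC 0) by ring; now rewrite Cmod_0. }
set (n := fun y : C => minus (N y) (A y q)).
assert (Hn0 : n z = zero).
{ unfold n, q; rewrite (proj2 Hz); lmod U. }
set (n' := minus N' (A' q)).
assert (Hn : cderiv n z n').
{ apply cderiv_minus; [exact HN|].
  exact (cderiv_comp_linear (V := blin_NormedModule U U) A z A' _ (is_linear_eval q) HA). }
set (g := blin_norm (G z)).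
assert (Hg : 0 <= g) by exact (opnorm_ge_0 _ (proj2_sig (G z))).
assert (Nn := norm_ge_0 (G z n')).
apply cderiv_iff; intros eps Heps.
set (e1 := eps / (4 * (1 + g))); assert (He1 : 0 < e1) by (apply Rdiv_lt_0_compat; lra).
(* The first bound makes [A (z + h)] a perturbation of [A z] small against the norm [g] of the
   inverse; the second makes [G (z + h) n' - G z n'] smaller than [eps / 2]. *)
set (e2 := Rmin (/ (2 * (1 + g))) (eps / (4 * (1 + g) * (1 + norm (G z n'))))).
assert (He2 : 0 < e2).
{ apply Rmin_glb_lt; [apply Rinv_0_lt_compat; lra|apply Rdiv_lt_0_compat; [lra|]].
  apply Rmult_lt_0_compat; lra. }
destruct (proj1 (cderiv_iff n z n') Hn e1 He1) as [d1 [Hd1 H1]].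
destruct (cderiv_continuous (V := blin_NormedModule U U) A z A' HA e2 He2) as [d2 [Hd2 H2]].
exists (Rmin r (Rmin d1 d2)); split; [repeat apply Rmin_glb_lt; assumption|].
intros h Hh.
assert (Hh0 := Rlt_le_trans _ _ _ Hh (Rmin_l _ _)).
assert (Hh' := Rlt_le_trans _ _ _ Hh (Rmin_r _ _)).
assert (Hh1 := Rlt_le_trans _ _ _ Hh' (Rmin_l _ _)).
assert (Hh2 := Rlt_le_trans _ _ _ Hh' (Rmin_r _ _)).
specialize (H1 h Hh1); specialize (H2 h Hh2); specialize (HG h Hh0).
change (blin_norm (minus (A (z + h)%C) (A z)) < e2) in H2.
rewrite Hn0 in H1.
set (Gh := G (z + h)%C) in *; set (Ah := A (z + h)%C) in *.
assert (HGdiff : forall w, minus (Gh w) (G z w) = opp (Gh (minus (Ah (G z w)) (A z (G z w))))).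
{ intros w; rewrite blin_fun_minus, (proj2 Hz), (proj1 HG); lmod U. }
assert (He2a : e2 * g <= / 2).
{ apply Rle_trans with (/ (2 * (1 + g)) * (1 + g)); [|right; field; lra].
  apply Rmult_le_compat; try lra; apply Rmin_l. }
assert (HAdiff : forall w, norm (minus (Ah w) (A z w)) <= e2 * norm w).
{ intros w; apply Rle_trans with (1 := blin_minus_bound _ _ w).
  apply Rmult_le_compat_r; [apply norm_ge_0|lra]. }
(* A Neumann-type absorption: [Gh w] equals [G z w] minus a term of norm at most half of that of
   [Gh w]. *)
assert (HGh : forall w, norm (Gh w) <= 2 * g * norm w).
{ intros w.
  assert (E : Gh w = minus (G z w) (G z (minus (Ah (Gh w)) (A z (Gh w))))).
  { rewrite blin_fun_minus, (proj1 Hz), (proj2 HG); lmod U. }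
  assert (K1 : norm (Gh w) <= norm (G z w) + norm (G z (minus (Ah (Gh w)) (A z (Gh w))))).
  { rewrite E at 1; apply norm_minus_le. }
  assert (K2 := blin_fun_bound (G z) w); fold g in K2.
  assert (K3 := blin_fun_bound (G z) (minus (Ah (Gh w)) (A z (Gh w)))); fold g in K3.
  assert (K4 := HAdiff (Gh w)).
  assert (K5 : g * norm (minus (Ah (Gh w)) (A z (Gh w))) <= / 2 * norm (Gh w)).
  { apply Rle_trans with (g * (e2 * norm (Gh w))); [apply Rmult_le_compat_l; lra|].
    rewrite <- Rmult_assoc, (Rmult_comm g); apply Rmult_le_compat_r; [apply norm_ge_0|exact He2a]. }
  lra. }
assert (E : minus (minus (Gh (N (z + h)%C)) (G z (N z))) (scal h (G z n')) =
  plus (Gh (minus (minus (n (z + h)%C) zero) (scal h n'))) (scal h (minus (Gh n') (G z n')))).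
{ replace (minus (n (z + h)%C) zero) with (n (z + h)%C) by lmod U.
  unfold n at 1; rewrite !blin_fun_minus, blin_fun_scal; fold Ah q; rewrite (proj1 HG); lmod U. }
rewrite E; apply Rle_trans with (1 := norm_triangle _ _); rewrite norm_scal_eq.
assert (Nh := Cmod_ge_0 h).
assert (T1 : norm (Gh (minus (minus (n (z + h)%C) zero) (scal h n'))) <= eps / 2 * Cmod h).
{ apply Rle_trans with (1 := HGh _).
  apply Rle_trans with (2 * (1 + g) * (e1 * Cmod h)); [|right; unfold e1; field; lra].
  apply Rmult_le_compat; try lra; apply norm_ge_0. }
assert (T2 : norm (minus (Gh n') (G z n')) <= eps / 2).
{ rewrite HGdiff, norm_opp; apply Rle_trans with (1 := HGh _).
  apply Rle_trans with (2 * (1 + g) * (eps / (4 * (1 + g) * (1 + norm (G z n'))) * (1 + norm (G z n')))).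
  2:{ right; field; lra. }
  apply Rmult_le_compat; try lra; [apply norm_ge_0|].
  apply Rle_trans with (1 := HAdiff _).
  apply Rmult_le_compat; try lra; apply Rmin_r. }
apply Rmult_le_compat_l with (r := Cmod h) in T2; [|exact Nh]; lra.
Qed.

(** * Radial restrictions of quasi-convex maps and the coefficient bound *)

Section Main.

Variable X0 : CompleteNormedModule C_AbsRing.
Local Notation X := (CompleteNormedModule.NormedModule C_AbsRing X0).

Lemma diff_on_frechet {V0 : CompleteNormedModule C_AbsRing}
  (f : X -> CompleteNormedModule.NormedModule C_AbsRing V0) :
  diff_on f zero 1 -> @diff_on X (blin_NormedModule X (CompleteNormedModule.NormedModule C_AbsRing V0)) (frechet f) zero 1.
Proof.
intros Hf y Hy; apply (ex_filterdiff_frechet f y (1 - norm (minus y zero))); [lra|].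
apply (diff_on_sub f zero) with 1; [lra|exact Hf].
Qed.

Lemma holomorphic_diff_on (f : X -> X) : holomorphic f -> diff_on f zero 1.
Proof.
intros Hf y Hy; apply Hf; unfold unit_ball.
now replace (minus y zero) with y in Hy by lmod X.
Qed.

Lemma holomorphic_Dm_diff (f : X -> X) : holomorphic f -> forall y : X, norm y < 1 ->
  ex_filterdiff (Dm 1 f) (locally y) /\ ex_filterdiff (Dm 2 f) (locally y).
Proof.
intros Hf y Hy; assert (H1 := diff_on_frechet f (holomorphic_diff_on f Hf)).
assert (H2 := diff_on_frechet (V0 := blin_CompleteNormedModule X X0) (frechet f) H1).
assert (Hy' : norm (minus y zero) < 1) by now replace (minus y zero) with y by lmod X.
exact (conj (H1 y Hy') (H2 y Hy')).
Qed.

Lemma cderiv_smul {V : NormedModule C_AbsRing} (u : V) (z : C) :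
  cderiv (fun z : C => scal z u) z u.
Proof. apply cderiv_ext with (2 := cderiv_affine zero u z); intros y; lmod V. Qed.

(** The curve [z |-> Df(z u)^-1 (D^2 f(z u)(u, u))], whose derivative at [0] carries the
    third-order data of [f]. *)
Definition radial_quotient (f : X -> X) (u : X) (z : C) : X :=
  inverse (frechet f (scal z u)) (blin_fun (blin_fun (Dm 2 f (scal z u)) u) u).

Lemma norm_scal_lt_1 (u : X) (z : C) : norm u = 1 -> Cmod z < 1 -> norm (scal z u) < 1.
Proof. intros Hu Hz; now rewrite norm_scal_eq, Hu, Rmult_1_r. Qed.

(** The first argument of [Dm] is the newest direction of differentiation. Hence the derivative of
    [z |-> frechet f (scal z u)] is [Dm 2 f (scal z u)] applied to [u], and the argument order
    agrees with that of [third_functional]. *)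
Lemma cderiv_radial_quotient (f : X -> X) (u : X) (z : C) :
  locally_biholomorphic f -> norm u = 1 -> Cmod z < 1 ->
  cderiv (radial_quotient f u) z
    (inverse (frechet f (scal z u))
       (minus (blin_fun (blin_fun (blin_fun (Dm 3 f (scal z u)) u) u) u)
          (blin_fun (blin_fun (Dm 2 f (scal z u)) u) (radial_quotient f u z)))).
Proof.
intros [Hf Hinv] Hu Hz.
destruct (holomorphic_Dm_diff f Hf (scal z u) (norm_scal_lt_1 u z Hu Hz)) as [D1 D2].
apply frechet_correct in D1; apply frechet_correct in D2.
apply (cderiv_inverse_apply (fun z => frechet f (scal z u)) (fun z => inverse (frechet f (scal z u)))
  (fun z => blin_fun (blin_fun (Dm 2 f (scal z u)) u) u) z
  (blin_fun (Dm 2 f (scal z u)) u) (blin_fun (blin_fun (blin_fun (Dm 3 f (scal z u)) u) u) u) (1 - Cmod z)).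
- lra.
- intros y Hy; apply inverse_correct, Hinv; unfold unit_ball; apply norm_scal_lt_1; [exact Hu|].
  replace y with (z + (y - z))%C by ring; apply Rle_lt_trans with (1 := Cmod_triangle _ _); lra.
- exact (cderiv_comp_filterdiff (fun z : C => scal z u) z u _ _ D1 (cderiv_smul u z)).
- assert (H := cderiv_comp_filterdiff (fun z : C => scal z u) z u _ _ D2 (cderiv_smul u z)).
  apply (cderiv_comp_linear (V := multi X 1) (fun z => blin_fun (Dm 2 f (scal z u)) u) z
     (blin_fun (blin_fun (Dm 3 f (scal z u)) u) u) _ (is_linear_eval (U := X) (V := X) u)).
  exact (cderiv_comp_linear (V := multi X 2) (W := multi X 1) (fun z => Dm 2 f (scal z u)) z
     (blin_fun (Dm 3 f (scal z u)) u) _ (is_linear_eval (U := X) (V := multi X 1) u) H).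
Qed.

Lemma inverse_id (A : blin X X) : (forall y, A y = y) -> forall y, inverse A y = y.
Proof.
intros HA y.
assert (Hi : is_inverse A A) by (split; intros v; now rewrite !HA).
assert (H := inverse_correct A (ex_intro _ A Hi)).
rewrite <- (proj1 H y) at 2; now rewrite HA.
Qed.

Lemma radial_quotient_deriv_0 (f : X -> X) (u : X) :
  normalized f -> locally_biholomorphic f -> norm u = 1 ->
  cderiv (radial_quotient f u) 0%C
    (minus (blin_fun (blin_fun (blin_fun (Dm 3 f zero) u) u) u)
       (blin_fun (blin_fun (Dm 2 f zero) u) (blin_fun (blin_fun (Dm 2 f zero) u) u))).
Proof.
intros [_ Hn] Hf Hu; assert (H := cderiv_radial_quotient f u 0%C Hf Hu ltac:(rewrite Cmod_0; lra)).
unfold radial_quotient at 2 in H.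
replace (scal (RtoC 0) u) with (zero : X) in H by lmod X.
now rewrite !(inverse_id _ Hn) in H.
Qed.

(** The weight [2 / 3] gives both terms the same factor: [1 / 3! = 1 / 6] and
    [2 / 3 * 1 / 2 * 1 / 2 = 1 / 6]. What is left is [T] of the derivative of the radial quotient at
    [0]. *)
Lemma third_functional_radial (f : X -> X) (u : X) (r : R) (T : blin X C_NormedModule) :
  third_functional f (scal (RtoC r) u) T =
  (RtoC (r ^ 3 / 6) * T (minus (blin_fun (blin_fun (blin_fun (Dm 3 f zero) u) u) u)
       (blin_fun (blin_fun (Dm 2 f zero) u) (blin_fun (blin_fun (Dm 2 f zero) u) u))))%C.
Proof.
set (D2 := Dm 2 f zero : blin X (multi X 1)); set (D3 := Dm 3 f zero : blin X (multi X 2)).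
assert (E2 : forall w : X, blin_fun (blin_fun (Dm 2 f zero) (scal (RtoC r) u)) w
  = scal (RtoC r) (blin_fun (blin_fun D2 u) w)).
{ intros w; exact (f_equal (fun A : blin X X => A w) (blin_fun_scal D2 (RtoC r) u)). }
assert (F2 : diag 2 (Dm 2 f zero) (scal (RtoC r) u)
  = scal (RtoC r) (scal (RtoC r) (blin_fun (blin_fun D2 u) u))).
{ transitivity (blin_fun (blin_fun D2 (scal (RtoC r) u)) (scal (RtoC r) u)); [reflexivity|].
  transitivity (scal (RtoC r) (blin_fun (blin_fun D2 u) (scal (RtoC r) u))); [apply E2|].
  f_equal; apply (blin_fun_scal (U := X) (V := X)). }
assert (F3 : diag 3 (Dm 3 f zero) (scal (RtoC r) u) =
  scal (RtoC r) (scal (RtoC r) (scal (RtoC r) (blin_fun (blin_fun (blin_fun D3 u) u) u)))).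
{ transitivity (blin_fun (blin_fun (blin_fun D3 (scal (RtoC r) u)) (scal (RtoC r) u)) (scal (RtoC r) u));
    [reflexivity|].
  transitivity (scal (RtoC r) (blin_fun (blin_fun (blin_fun D3 u) (scal (RtoC r) u)) (scal (RtoC r) u))).
  { exact (f_equal (fun A : blin X (multi X 1) => blin_fun (blin_fun A (scal (RtoC r) u)) (scal (RtoC r) u))
      (blin_fun_scal D3 (RtoC r) u)). }
  f_equal.
  transitivity (scal (RtoC r) (blin_fun (blin_fun (blin_fun D3 u) u) (scal (RtoC r) u))).
  { exact (f_equal (fun A : blin X X => A (scal (RtoC r) u)) (blin_fun_scal (blin_fun D3 u) (RtoC r) u)). }
  f_equal; apply (blin_fun_scal (U := X) (V := X)). }
unfold third_functional.
rewrite F3, F2, E2, !(blin_fun_scal (U := X) (V := X)), !(blin_fun_scal (V := C_NormedModule)), blin_fun_minus.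
set (a := T (blin_fun (blin_fun (blin_fun D3 u) u) u)).
set (b := T (blin_fun (blin_fun D2 u) (blin_fun (blin_fun D2 u) u))).
change ((RtoC (/ INR (Factorial.fact 3)) * (r * (r * (r * a))) -
  RtoC (2 / 3) * (RtoC (/ INR (Factorial.fact 2)) * (r * (RtoC (/ INR (Factorial.fact 2)) * (r * (r * b))))))%C =
  (RtoC (r ^ 3 / 6) * (a - b))%C).
replace (INR (Factorial.fact 3)) with 6 by (simpl; ring).
replace (INR (Factorial.fact 2)) with 2 by (simpl; ring).
replace (RtoC (/ 6) * (r * (r * (r * a))) -
  RtoC (2 / 3) * (RtoC (/ 2) * (r * (RtoC (/ 2) * (r * (r * b))))))%C
  with ((RtoC (/ 6) * r * r * r) * a - (RtoC (2 / 3) * RtoC (/ 2) * RtoC (/ 2) * r * r * r) * b)%C by ring.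
rewrite <- !RtoC_mult.
replace (/ 6 * r * r * r) with (r ^ 3 / 6) by field.
replace (2 / 3 * / 2 * / 2 * r * r * r) with (r ^ 3 / 6) by field.
ring.
Qed.

Lemma support_functional_rotate (u : X) (T : blin X C_NormedModule) (z : C) :
  norm u = 1 -> norm T = 1 -> T u = RtoC 1 -> z <> 0%C ->
  support_functional (scal z u) (scal (Cconj z / Cmod z)%C T : blin X C_NormedModule).
Proof.
intros Hu HT HTu Hz.
assert (Hp : 0 < Cmod z) by now apply Cmod_gt_0.
assert (Hm : RtoC (Cmod z) <> 0%C) by (intros E; apply RtoC_inj in E; lra).
split.
- rewrite (norm_scal_eq (V := blin_NormedModule X C_NormedModule)), HT.
  rewrite Cmod_div by exact Hm; rewrite Cmod_conj, Cmod_R, Rabs_pos_eq by lra; field; lra.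
- rewrite norm_scal_eq, Hu, Rmult_1_r.
  change ((Cconj z / Cmod z * T (scal z u))%C = RtoC (Cmod z)).
  rewrite blin_fun_scal, HTu; change (scal z (RtoC 1 : C_NormedModule)) with (z * 1)%C.
  replace (Cconj z / Cmod z * (z * 1))%C with (z * Cconj z / Cmod z)%C by (field; exact Hm).
  rewrite <- Cmod2_conj, RtoC_pow; field; exact Hm.
Qed.

(** By homogeneity the vector in the definition of quasi-convexity at [z u] is [z (z q + u)]. The
    rotated functional turns the outer factor [z] into [Cmod z], which cancels against the norm of
    [z u]. *)
Lemma radial_quotient_Re (f : X -> X) (u : X) (T : blin X C_NormedModule) (alpha : R) (z : C) :
  quasi_convex_B alpha f -> alpha < 1 -> norm u = 1 -> norm T = 1 -> T u = RtoC 1 -> Cmod z < 1 ->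
  alpha <= Re (1 + z * T (radial_quotient f u z))%C.
Proof.
intros [Hn [Hb Hq]] Ha Hu HT HTu Hz1.
destruct (excluded_middle_informative (z = 0%C)) as [->|Hz].
{ replace (1 + 0 * T (radial_quotient f u 0%C))%C with (RtoC 1) by ring; simpl; lra. }
assert (Hp : 0 < Cmod z) by now apply Cmod_gt_0.
assert (Hm : RtoC (Cmod z) <> 0%C) by (intros E; apply RtoC_inj in E; lra).
assert (Ny : norm (scal z u) = Cmod z) by (rewrite norm_scal_eq, Hu; ring).
assert (Hy1 : unit_ball (scal z u)) by (unfold unit_ball; lra).
assert (Hy0 : scal z u <> zero).
{ intros E; rewrite E in Ny; rewrite (norm_zero (V := X)) in Ny; lra. }
specialize (Hq (scal z u) _ Hy1 Hy0 (support_functional_rotate u T z Hu HT HTu Hz)).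
set (A := frechet f (scal z u)) in *.
assert (HA := inverse_correct A (proj2 Hb (scal z u) Hy1)).
set (G := inverse A) in *.
set (D2 := Dm 2 f (scal z u) : blin X (multi X 1)) in *.
set (q := radial_quotient f u z).
assert (E : G (plus (diag 2 D2 (scal z u)) (A (scal z u))) = scal z (plus (scal z q) u)).
{ rewrite blin_fun_plus, (proj1 HA).
  replace (diag 2 D2 (scal z u)) with (scal z (scal z (blin_fun (blin_fun D2 u) u))).
  - rewrite !blin_fun_scal; change (G (blin_fun (blin_fun D2 u) u)) with q; lmod X.
  - simpl; rewrite (blin_fun_scal (U := X) (V := X)).
    rewrite (blin_fun_scal (U := X) (V := multi X 1)); reflexivity. }
assert (E' : G (Hierarchy.plus (diag 2 D2 (scal z u)) (A (scal z u))) = scal z (plus (scal z q) u)) by exact E.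
rewrite E' in Hq.
change (blin_fun (scal (Cconj z / Cmod z)%C T : blin X C_NormedModule) (scal z (plus (scal z q) u)))
  with (Cconj z / Cmod z * T (scal z (plus (scal z q) u)))%C in Hq.
rewrite blin_fun_scal, blin_fun_plus, blin_fun_scal, HTu in Hq.
change (scal z (plus (scal z (T q)) (RtoC 1 : C_NormedModule))) with (z * (z * T q + 1))%C in Hq.
replace (Cconj z / Cmod z * (z * (z * T q + 1)))%C with (RtoC (Cmod z) * (1 + z * T q))%C in Hq.
2:{ replace (Cconj z / Cmod z * (z * (z * T q + 1)))%C with (z * Cconj z / Cmod z * (1 + z * T q))%C
      by (field; exact Hm).
    f_equal; rewrite <- Cmod2_conj, RtoC_pow; field; exact Hm. }
rewrite Ny in Hq.
replace (Re (RtoC (Cmod z) * (1 + z * T q))) with (Cmod z * Re (1 + z * T q)) in Hq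
  by (destruct (1 + z * T q)%C; simpl; ring).
apply Rmult_le_reg_l with (Cmod z); [exact Hp|]; lra.
Qed.

Theorem third_functional_bound (f : X -> X) (alpha : R) (x : X) (T : blin X C_NormedModule) :
  alpha < 1 -> quasi_convex_B alpha f -> unit_ball x -> x <> zero -> support_functional x T ->
  Cmod (third_functional f x T) <= (1 - alpha) / 3 * norm x ^ 3.
Proof.
intros Ha Hf Hx Hx0 [HT HTx].
assert (Np : 0 < norm x).
{ destruct (norm_ge_0 x) as [H|H]; [exact H|]; elim Hx0; apply norm_eq_zero; now symmetry. }
set (r := norm x) in *.
assert (Hrr : (RtoC (/ r) * RtoC r = 1)%C) by (rewrite <- RtoC_mult, Rinv_l by lra; reflexivity).
set (u := scal (RtoC (/ r)) x).
assert (Hu : norm u = 1).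
{ unfold u; rewrite norm_scal_eq, Cmod_R, Rabs_pos_eq by (apply Rlt_le, Rinv_0_lt_compat, Np).
  fold r; field; lra. }
assert (HTu : T u = RtoC 1).
{ unfold u; rewrite blin_fun_scal, HTx; exact Hrr. }
assert (Ex : x = scal (RtoC r) u).
{ unfold u; rewrite scal_assoc; change (mult (RtoC r : C_AbsRing) (RtoC (/ r))) with (RtoC r * RtoC (/ r))%C.
  rewrite Cmult_comm, Hrr; symmetry; exact (scal_one x). }
rewrite Ex, third_functional_radial.
set (d := minus _ _).
assert (Hd : Cmod (T d) <= 2 * (1 - alpha)).
{ apply (caratheodory_second (fun z => T (radial_quotient f u z)) alpha); [exact Ha| | |].
  - intros z Hz; eexists; apply cderiv_comp_linear; [exact (proj2_sig T)|].
    apply cderiv_radial_quotient; [exact (proj1 (proj2 Hf))|exact Hu|exact Hz].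
  - intros z Hz; now apply radial_quotient_Re.
  - apply (cderiv_comp_linear (radial_quotient f u) 0%C d); [exact (proj2_sig T)|].
    apply radial_quotient_deriv_0; [exact (proj1 Hf)|exact (proj1 (proj2 Hf))|exact Hu]. }
rewrite Cmod_mult, Cmod_R, Rabs_pos_eq by (apply Rmult_le_pos; [apply pow_le|]; lra).
assert (Hr3 : 0 <= r ^ 3 / 6) by (apply Rmult_le_pos; [apply pow_le|]; lra).
apply Rmult_le_compat_l with (r := r ^ 3 / 6) in Hd; [|exact Hr3]; lra.
Qed.

End Main.

(** * Norming functionals *)

Lemma zorn (S : Type) (le : S -> S -> Prop) :
  (forall a, le a a) -> (forall a b c, le a b -> le b c -> le a c) ->
  (forall a b, le a b -> le b a -> a = b) ->
  (forall A : S -> Prop, (forall a b, A a -> A b -> le a b \/ le b a) ->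
     exists m, forall a, A a -> le a m) ->
  exists m, forall a, le m a -> a = m.
Proof.
intros Hr Ht Ha Hc.
set (leb := fun a b => if excluded_middle_informative (le a b) then true else false).
assert (E : forall a b, leb a b = true <-> le a b).
{ intros a b; unfold leb; destruct excluded_middle_informative as [H|H]; (split; [|intros K]); [intros _; exact H|reflexivity|discriminate|contradiction]. }
destruct (@classical_sets.Zorn S leb) as [m Hm].
- intros a; now apply E.
- intros a b c H1 H2; apply E; apply Ht with b; now apply E.
- intros a b H1 H2; apply Ha; now apply E.
- intros A HA; destruct (Hc A) as [m Hm].
  + intros a b H1 H2; destruct (HA a b H1 H2) as [H|H]; [left|right]; now apply E.
  + exists m; intros a H; apply E, Hm, H.
- exists m; intros a H; apply Hm; now apply E.
Qed.

Lemma inf_exists (E : R -> Prop) (m : R) : (exists x, E x) -> (forall x, E x -> m <= x) ->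
  exists i, (forall x, E x -> i <= x) /\ forall c, (forall x, E x -> c <= x) -> c <= i.
Proof.
intros [x0 Hx0] Hm.
destruct (completeness (fun y => E (- y))) as [s [Hs1 Hs2]].
- exists (- m); intros y Hy; specialize (Hm _ Hy); lra.
- exists (- x0); now rewrite Ropp_involutive.
- exists (- s); split.
  + intros x Hx; assert (- x <= s) by (apply Hs1; now rewrite Ropp_involutive); lra.
  + intros c Hc; assert (s <= - c); [|lra].
    apply Hs2; intros y Hy; specialize (Hc _ Hy); lra.
Qed.

Section HahnBanach.

Context {X : NormedModule C_AbsRing}.

(** Only real scalars occur: the functional is first found over the reals and made complex
    afterwards. *)
Definition sublinear (p : X -> R) : Prop :=
  (forall x y, p (plus x y) <= p x + p y) /\
  (forall t x, 0 < t -> p (scal (RtoC t) x) <= t * p x).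

Lemma sublinear_zero p : sublinear p -> p zero = 0.
Proof.
intros [_ H].
assert (E : forall t : R, scal (RtoC t) zero = zero :> X) by (intros t; lmod X).
assert (H1 := H 2 zero ltac:(lra)); assert (H2 := H (/ 2) zero ltac:(lra)).
rewrite E in H1, H2; lra.
Qed.

Lemma sublinear_opp p x : sublinear p -> 0 <= p x + p (opp x).
Proof.
intros H; rewrite <- (sublinear_zero p H).
replace zero with (plus x (opp x)) by lmod X; apply H.
Qed.

Lemma sublinear_norm : sublinear norm.
Proof.
split; [apply norm_triangle|]; intros t x Ht.
rewrite norm_scal_eq, Cmod_R, Rabs_pos_eq; lra.
Qed.

(** Here [q x] is the infimum over [t >= 0] of [p (x + t y) - t p y]. A minimal sublinear [p] must
    equal [q], so [p (- y) <= - p y] for every [y], which forces [p] to be odd and then additive. *)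
Lemma sublinear_descend (p : X -> R) (y : X) : sublinear p ->
  exists q, sublinear q /\ (forall x, q x <= p x) /\ q (opp y) <= - p y.
Proof.
intros Hp; destruct (Hp) as [Hadd Hhom].
assert (p0 := sublinear_zero p Hp).
assert (Hhom0 : forall t x, 0 <= t -> p (scal (RtoC t) x) <= t * p x).
{ intros t x [Ht|<-]; [now apply Hhom|].
  replace (scal (RtoC 0) x) with (zero : X) by lmod X; lra. }
assert (Hhom1 : forall t x, 0 <= t -> t * p x <= p (scal (RtoC t) x)).
{ intros t x [Ht|<-]; [|replace (scal (RtoC 0) x) with (zero : X) by lmod X; lra].
  assert (H := Hhom (/ t) (scal (RtoC t) x) (Rinv_0_lt_compat _ Ht)).
  assert (Htt : (RtoC (/ t) * RtoC t = 1)%C) by (rewrite <- RtoC_mult, Rinv_l by lra; reflexivity).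
  replace (scal (RtoC (/ t)) (scal (RtoC t) x)) with x in H.
  - apply Rmult_le_compat_l with (r := t) in H; [|lra].
    rewrite <- Rmult_assoc, Rinv_r, Rmult_1_l in H by lra; exact H.
  - rewrite scal_assoc; change (mult (RtoC (/ t) : C_AbsRing) (RtoC t)) with (RtoC (/ t) * RtoC t)%C.
    rewrite Htt; symmetry; exact (scal_one x). }
set (E := fun x v => exists t, 0 <= t /\ v = p (plus x (scal (RtoC t) y)) - t * p y).
assert (HE : forall x, exists i, (forall v, E x v -> i <= v) /\ forall c, (forall v, E x v -> c <= v) -> c <= i).
{ intros x; apply (inf_exists (E x) (- p (opp x))).
  - exists (p (plus x (scal (RtoC 0) y)) - 0 * p y); exists 0; split; [lra|reflexivity].
  - intros v [t [Ht ->]].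
    assert (H := Hadd (plus x (scal (RtoC t) y)) (opp x)).
    replace (plus (plus x (scal (RtoC t) y)) (opp x)) with (scal (RtoC t) y) in H by lmod X.
    specialize (Hhom1 t y Ht); lra. }
set (q := fun x => proj1_sig (constructive_indefinite_description _ (HE x))).
assert (Hq1 : forall x t, 0 <= t -> q x <= p (plus x (scal (RtoC t) y)) - t * p y).
{ intros x t Ht; unfold q; destruct constructive_indefinite_description as [i [H1 H2]]; simpl.
  apply H1; exists t; tauto. }
assert (Hq2 : forall x c, (forall t, 0 <= t -> c <= p (plus x (scal (RtoC t) y)) - t * p y) -> c <= q x).
{ intros x c Hc; unfold q; destruct constructive_indefinite_description as [i [H1 H2]]; simpl.
  apply H2; intros v [t [Ht ->]]; now apply Hc. }
exists q; split; [split|split].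
- intros x1 x2.
  assert (H : q (plus x1 x2) - q x2 <= q x1); [|lra].
  apply Hq2; intros t1 Ht1.
  assert (H : q (plus x1 x2) - (p (plus x1 (scal (RtoC t1) y)) - t1 * p y) <= q x2); [|lra].
  apply Hq2; intros t2 Ht2.
  assert (H1 := Hq1 (plus x1 x2) (t1 + t2) ltac:(lra)).
  assert (H2 := Hadd (plus x1 (scal (RtoC t1) y)) (plus x2 (scal (RtoC t2) y))).
  replace (plus (plus x1 (scal (RtoC t1) y)) (plus x2 (scal (RtoC t2) y)))
    with (plus (plus x1 x2) (scal (RtoC (t1 + t2)) y)) in H2 by (rewrite RtoC_plus; lmod X).
  lra.
- intros s x Hs.
  assert (H : q (scal (RtoC s) x) / s <= q x).
  { apply Hq2; intros t Ht.
    assert (H1 := Hq1 (scal (RtoC s) x) (s * t) ltac:(nra)).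
    assert (H2 := Hhom s (plus x (scal (RtoC t) y)) Hs).
    replace (scal (RtoC s) (plus x (scal (RtoC t) y)))
      with (plus (scal (RtoC s) x) (scal (RtoC (s * t)) y)) in H2 by (rewrite RtoC_mult; lmod X).
    apply Rmult_le_reg_r with s; [exact Hs|].
    replace (q (scal (RtoC s) x) / s * s) with (q (scal (RtoC s) x)) by (field; lra); lra. }
  apply Rmult_le_compat_r with (r := s) in H; [|lra].
  replace (q (scal (RtoC s) x) / s * s) with (q (scal (RtoC s) x)) in H by (field; lra); lra.
- intros x; assert (H := Hq1 x 0 (Rle_refl 0)).
  replace (plus x (scal (RtoC 0) y)) with x in H by lmod X; lra.
- assert (H := Hq1 (opp y) 1 Rle_0_1).
  replace (plus (opp y) (scal (RtoC 1) y)) with (zero : X) in H by lmod X; lra.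
Qed.

(** Zorn's lemma for the reversed pointwise order: a chain is bounded by its pointwise infimum,
    which is finite because [a x >= - a (- x) >= - p0 (- x)]. *)
Lemma minimal_sublinear (p0 : X -> R) : sublinear p0 ->
  exists p, sublinear p /\ (forall x, p x <= p0 x) /\
    forall q, sublinear q -> (forall x, q x <= p x) -> q = p.
Proof.
intros Hp0.
set (S := {p : X -> R | sublinear p /\ forall x, p x <= p0 x}).
destruct (zorn S (fun a b => forall x, proj1_sig b x <= proj1_sig a x)) as [m Hm].
- intros a x; apply Rle_refl.
- intros a b c H1 H2 x; apply Rle_trans with (proj1_sig b x); auto.
- intros [a Ha] [b Hb] H1 H2; simpl in *.
  assert (a = b) as <- by (apply functional_extensionality; intros x; apply Rle_antisym; auto).
  f_equal; apply ProofIrrelevance.proof_irrelevance.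
- intros A HA.
  destruct (classic (exists a, A a)) as [[a0 Ha0]|Hno].
  (* The empty chain has no infimum and is bounded by [p0] instead. *)
  2:{ exists (exist _ p0 (conj Hp0 (fun x => Rle_refl _))); intros a Ha; elim Hno; now exists a. }
  assert (HI : forall x, exists i, (forall v, (exists a, A a /\ v = proj1_sig a x) -> i <= v) /\
     forall c, (forall v, (exists a, A a /\ v = proj1_sig a x) -> c <= v) -> c <= i).
  { intros x; apply inf_exists with (- p0 (opp x)).
    - exists (proj1_sig a0 x), a0; tauto.
    - intros v [[a [Ha Ha']] [_ ->]]; simpl.
      assert (H := sublinear_opp a x Ha); specialize (Ha' (opp x)); lra. }
  set (q := fun x => proj1_sig (constructive_indefinite_description _ (HI x))).
  assert (Hq1 : forall x a, A a -> q x <= proj1_sig a x).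
  { intros x a Ha; unfold q; destruct constructive_indefinite_description as [i [H1 H2]]; simpl.
    apply H1; exists a; tauto. }
  assert (Hq2 : forall x c, (forall a, A a -> c <= proj1_sig a x) -> c <= q x).
  { intros x c Hc; unfold q; destruct constructive_indefinite_description as [i [H1 H2]]; simpl.
    apply H2; intros v [a [Ha ->]]; now apply Hc. }
  assert (Hq : sublinear q).
  { split.
    - intros x y; assert (H : q (plus x y) - q y <= q x); [|lra].
      apply Hq2; intros a Ha; assert (H : q (plus x y) - proj1_sig a x <= q y); [|lra].
      apply Hq2; intros b Hb.
      (* An infimum of sublinear functionals need not be subadditive; in a chain the smaller of [a]
         and [b] serves both points at once. *)
      assert (H : exists c, A c /\ proj1_sig c x <= proj1_sig a x /\ proj1_sig c y <= proj1_sig b y).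
      { destruct (HA a b Ha Hb) as [H|H]; [exists b|exists a]; repeat split; auto; apply Rle_refl. }
      destruct H as [c [Hc [H1 H2]]]; assert (H3 := Hq1 (plus x y) c Hc).
      assert (H4 := proj1 (proj1 (proj2_sig c)) x y); lra.
    - intros t x Ht; assert (H : q (scal (RtoC t) x) / t <= q x).
      { apply Hq2; intros a Ha; assert (H1 := Hq1 (scal (RtoC t) x) a Ha).
        assert (H2 := proj2 (proj1 (proj2_sig a)) t x Ht).
        apply Rmult_le_reg_r with t; [exact Ht|].
        replace (q (scal (RtoC t) x) / t * t) with (q (scal (RtoC t) x)) by (field; lra); lra. }
      apply Rmult_le_compat_r with (r := t) in H; [|lra].
      replace (q (scal (RtoC t) x) / t * t) with (q (scal (RtoC t) x)) in H by (field; lra); lra. }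
  assert (Hq0 : forall x, q x <= p0 x).
  { intros x; apply Rle_trans with (1 := Hq1 x a0 Ha0); apply (proj2_sig a0). }
  exists (exist _ q (conj Hq Hq0)); intros a Ha x; now apply Hq1.
- destruct m as [p [Hp Hpp]]; exists p; split; [exact Hp|]; split; [exact Hpp|].
  intros q Hq Hqp.
  assert (Hq0 : forall x, q x <= p0 x) by (intros x; apply Rle_trans with (p x); auto).
  exact (f_equal (@proj1_sig _ _) (Hm (exist _ q (conj Hq Hq0)) Hqp)).
Qed.

(** Starting [minimal_sublinear] below [x |-> inf_t (|x + t u| - t |u|)] makes the minimal
    functional, which is real-linear, attain the norm at [u]. *)
Theorem norming_functional (u : X) : norm u = 1 ->
  exists T : blin X C_NormedModule, norm T = 1 /\ T u = RtoC 1.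
Proof.
intros Hu.
destruct (sublinear_descend norm u sublinear_norm) as [p0 [Hp0 [Hp0n Hp0u]]].
destruct (minimal_sublinear p0 Hp0) as [g [Hg [Hgp Hmin]]].
assert (Hgn : forall x, g x <= norm x) by (intros x; apply Rle_trans with (p0 x); auto).
assert (Hopp : forall y, g (opp y) = - g y).
{ intros y; destruct (sublinear_descend g y Hg) as [q [Hq [Hqg Hqy]]].
  rewrite (Hmin q Hq Hqg) in Hqy; assert (H := sublinear_opp g y Hg); lra. }
assert (Hadd : forall x y, g (plus x y) = g x + g y).
{ intros x y; assert (H1 := proj1 Hg x y); assert (H2 := proj1 Hg (plus x y) (opp y)).
  replace (plus (plus x y) (opp y)) with x in H2 by lmod X; rewrite Hopp in H2; lra. }
assert (Hpos : forall t x, 0 < t -> g (scal (RtoC t) x) = t * g x).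
{ intros t x Ht; assert (H1 := proj2 Hg t x Ht); assert (H2 := proj2 Hg t (opp x) Ht).
  replace (scal (RtoC t) (opp x)) with (opp (scal (RtoC t) x)) in H2 by lmod X.
  rewrite !Hopp in H2; lra. }
assert (Hhom : forall t x, g (scal (RtoC t) x) = t * g x).
{ intros t x; destruct (Rtotal_order t 0) as [Ht|[->|Ht]]; [|..|now apply Hpos].
  - replace (scal (RtoC t) x) with (opp (scal (RtoC (- t)) x)) by (rewrite RtoC_opp; lmod X).
    rewrite Hopp, Hpos by lra; ring.
  - replace (scal (RtoC 0) x) with (zero : X) by lmod X; rewrite (sublinear_zero g Hg); ring. }
(* The standard complexification [g z - i g (i z)] of a real-linear functional. *)
set (T := fun z : X => (g z, - g (scal Ci z)) : C).
assert (Ek : forall (k : C) z, g (scal k z) = Re k * g z + Im k * g (scal Ci z)).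
{ intros k z; rewrite <- !Hhom, <- Hadd; f_equal.
  replace k with (RtoC (Re k) + RtoC (Im k) * Ci)%C at 1; [lmod X|].
  destruct k; unfold RtoC, Ci, Cplus, Cmult; simpl; f_equal; ring. }
assert (Tplus : forall x y, T (plus x y) = (T x + T y)%C).
{ intros x y; unfold T.
  replace (scal Ci (plus x y)) with (plus (scal Ci x) (scal Ci y)) by lmod X.
  rewrite !Hadd; apply injective_projections; simpl; ring. }
assert (Tscal : forall (k : C) x, T (scal k x) = (k * T x)%C).
{ intros k x; unfold T.
  replace (scal Ci (scal k x)) with (scal (Ci * k)%C x) by lmod X.
  rewrite (Ek k x), (Ek (Ci * k)%C x); destruct k; unfold Ci, Cmult; apply injective_projections; simpl; ring. }
assert (Tnorm : forall x, Cmod (T x) <= norm x).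
{ intros x; destruct (Req_dec (Cmod (T x)) 0) as [E|E]; [rewrite E; apply norm_ge_0|].
  assert (Hm : RtoC (Cmod (T x)) <> 0%C) by (intros H; apply RtoC_inj in H; contradiction).
  (* Rotating [x] by [k] makes the value of [T] equal to [Cmod (T x)]; being real, it equals
     [g (k x)], so the norm bound on [g] carries over. *)
  set (k := (Cconj (T x) / Cmod (T x))%C).
  assert (Hk : Cmod k = 1).
  { unfold k; rewrite Cmod_div by exact Hm; rewrite Cmod_conj, Cmod_R, Rabs_pos_eq by apply Cmod_ge_0.
    field; exact E. }
  assert (HkT : T (scal k x) = RtoC (Cmod (T x))).
  { rewrite Tscal; unfold k.
    replace (Cconj (T x) / Cmod (T x) * T x)%C with (T x * Cconj (T x) / Cmod (T x))%C by (field; exact Hm).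
    rewrite <- Cmod2_conj, RtoC_pow; field; exact Hm. }
  assert (H := f_equal Re HkT); simpl in H.
  rewrite <- H; apply Rle_trans with (1 := Hgn _); rewrite norm_scal_eq, Hk; lra. }
assert (Hlin : @is_linear C_AbsRing X C_NormedModule T).
{ split; [exact Tplus|exact Tscal|].
  exists 1; split; [lra|]; intros x; rewrite Rmult_1_l; exact (Tnorm x). }
assert (HTu : T u = RtoC 1).
{ assert (H1 := Hgp (opp u)); rewrite Hopp in H1; assert (H2 := Hgn u).
  assert (Eg : g u = 1) by lra.
  assert (H3 := Tnorm u); rewrite Hu in H3.
  (* The real part of [T u] is already [1], so modulus at most [1] forces the imaginary part to
     vanish. *)
  assert (H4 : Cmod (T u) ^ 2 <= 1) by (assert (H5 := Cmod_ge_0 (T u)); simpl; nra).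
  rewrite Cmod2_alt in H4; unfold T in *; simpl in *; rewrite Eg in *.
  apply injective_projections; simpl; [reflexivity|nra]. }
exists (exist _ T Hlin : blin X C_NormedModule); split; [|exact HTu].
apply Rle_antisym.
- apply (opnorm_least T 1 Hlin); intros x Hx; apply Rle_trans with (1 := Tnorm x); exact Hx.
- apply Rle_trans with (norm (T u)); [rewrite HTu; right; symmetry; exact Cmod_1|].
  apply (opnorm_ub T u Hlin); lra.
Qed.

End HahnBanach.

(** * The extremal maps *)

Fixpoint psum (a : nat -> R) (m : nat) (w : C) : C :=
  match m with
  | O => RtoC (a O)
  | S m' => (psum a m' w + RtoC (a (S m')) * w ^ S m')%C
  end.

Definition pderiv (a : nat -> R) (n : nat) : R := INR (S n) * a (S n).

Lemma cderiv_pow (n : nat) (w : C) :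
  cderiv (V := C_NormedModule) (fun w => w ^ S n)%C w (RtoC (INR (S n)) * w ^ n)%C.
Proof.
induction n as [|n IH].
- apply (cderiv_ext (V := C_NormedModule) (fun w => w)).
  + intros y; simpl; symmetry; exact (Cmult_1_r y).
  + apply (cderiv_eq_C (fun w : C => w) w (RtoC 1)); [simpl; ring|apply cderiv_id].
- apply (cderiv_eq_C (fun w : C => (w * w ^ S n)%C) w
    ((1 * w ^ S n + w * (RtoC (INR (S n)) * w ^ n))%C)).
  + rewrite (S_INR (S n)), RtoC_plus; simpl Cpow; ring.
  + exact (cderiv_mult (fun w => w) (fun w => w ^ S n)%C w _ _ (cderiv_id w) IH).
Qed.

Lemma cderiv_psum (a : nat -> R) (m : nat) (w : C) :
  cderiv (V := C_NormedModule) (psum a (S m)) w (psum (pderiv a) m w).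
Proof.
assert (Hterm : forall n, cderiv (V := C_NormedModule) (fun w => RtoC (a (S n)) * w ^ S n)%C w
                           (RtoC (pderiv a n) * w ^ n)%C).
{ intros n.
  apply (cderiv_eq_C (fun w : C => (RtoC (a (S n)) * w ^ S n)%C) w
    ((0 * w ^ S n + RtoC (a (S n)) * (RtoC (INR (S n)) * w ^ n))%C)).
  - unfold pderiv; rewrite RtoC_mult; ring.
  - exact (cderiv_mult (fun _ => RtoC (a (S n))) (fun w => w ^ S n)%C w _ _ (cderiv_const _ w) (cderiv_pow n w)). }
induction m as [|m IH].
- apply (cderiv_eq_C (psum a 1) w ((0 + RtoC (pderiv a 0) * w ^ 0)%C));
    [simpl; ring|].
  exact (cderiv_plus (V := C_NormedModule) (fun _ => RtoC (a O)) _ w _ _ (cderiv_const _ w) (Hterm O)).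
- exact (cderiv_plus (V := C_NormedModule) (psum a (S m)) _ w _ _ IH (Hterm (S m))).
Qed.

Lemma psum_0 (a : nat -> R) (m : nat) : psum a m 0%C = RtoC (a O).
Proof. induction m as [|m IH]; [reflexivity|]; simpl; rewrite IH; ring. Qed.

Lemma psum_log_deriv (a : nat -> R) (m : nat) (w : C) :
  (w * psum (pderiv a) m w)%C = psum (fun n => INR n * a n)%R (S m) w.
Proof.
induction m as [|m IH].
- unfold pderiv; simpl psum; rewrite !Rmult_0_l, !Rmult_1_l; simpl; ring.
- change (psum (pderiv a) (S m) w) with (psum (pderiv a) m w + RtoC (pderiv a (S m)) * w ^ S m)%C.
  rewrite Cmult_plus_distr_l, IH; unfold pderiv.
  change (psum (fun n => INR n * a n)%R (S (S m)) w) with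
    (psum (fun n => INR n * a n)%R (S m) w + RtoC (INR (S (S m)) * a (S (S m))) * w ^ S (S m))%C.
  simpl Cpow; ring.
Qed.

Lemma psum_plus (a b : nat -> R) (m : nat) (w : C) :
  psum (fun n => a n + b n) m w = (psum a m w + psum b m w)%C.
Proof. induction m as [|m IH]; simpl; rewrite ?IH, !RtoC_plus; ring. Qed.

Lemma psum_scal (k : R) (a : nat -> R) (m : nat) (w : C) :
  psum (fun n => k * a n) m w = (RtoC k * psum a m w)%C.
Proof. induction m as [|m IH]; simpl; rewrite ?IH, !RtoC_mult; ring. Qed.

Lemma psum_ext (a b : nat -> R) (m : nat) (w : C) : (forall n, a n = b n) -> psum a m w = psum b m w.
Proof. intros H; induction m as [|m IH]; simpl; rewrite ?IH, ?H; reflexivity. Qed.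

(** Eneström-Kakeya: multiplying by [1 - w] telescopes the coefficients. *)
Lemma enestrom_kakeya (a : nat -> R) (m : nat) (w : C) :
  (forall n, 0 <= a (S n) <= a n) -> Cmod w <= 1 ->
  a O * (1 - Cmod w) <= Cmod ((1 - w) * psum a m w).
Proof.
intros Ha Hw; assert (W := Cmod_ge_0 w).
assert (H : 0 <= a m <= a O /\
  Cmod ((1 - w) * psum a m w - RtoC (a O) + RtoC (a m) * w ^ S m) <= (a O - a m) * Cmod w).
{ induction m as [|m [IH0 IH]].
  - split; [assert (H := Ha O); lra|].
    replace ((1 - w) * psum a 0 w - RtoC (a O) + RtoC (a O) * w ^ 1)%C with (RtoC 0) by (simpl; ring).
    rewrite Cmod_0; lra.
  - split; [assert (H := Ha m); lra|].
    replace ((1 - w) * psum a (S m) w - RtoC (a O) + RtoC (a (S m)) * w ^ S (S m))%C with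
      (((1 - w) * psum a m w - RtoC (a O) + RtoC (a m) * w ^ S m) - RtoC (a m - a (S m)) * w ^ S m)%C
      by (rewrite RtoC_minus; simpl; ring).
    apply Rle_trans with (1 := Cmod_triangle _ _).
    rewrite Cmod_opp, Cmod_mult, Cmod_R, Rabs_pos_eq by (assert (H := Ha m); lra).
    assert (K : Cmod (w ^ S m) <= Cmod w).
    { rewrite Cmod_pow; simpl; rewrite <- (Rmult_1_r (Cmod w)) at 3.
      apply Rmult_le_compat_l; [exact W|]; rewrite <- (pow1 m); apply pow_incr; lra. }
    assert (H := Ha m).
    assert ((a m - a (S m)) * Cmod (w ^ S m) <= (a m - a (S m)) * Cmod w) by (apply Rmult_le_compat_l; lra).
    lra. }
destruct H as [H0 H].
set (p := ((1 - w) * psum a m w)%C) in *.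
assert (K : Cmod (w ^ S m) <= Cmod w).
{ rewrite Cmod_pow; simpl; rewrite <- (Rmult_1_r (Cmod w)) at 3.
  apply Rmult_le_compat_l; [exact W|]; rewrite <- (pow1 m); apply pow_incr; lra. }
assert (T1 := Cmod_triangle p (- (p - RtoC (a O) + RtoC (a m) * w ^ S m))).
assert (T2 := Cmod_triangle (p + - (p - RtoC (a O) + RtoC (a m) * w ^ S m)) (RtoC (a m) * w ^ S m)).
replace (p + - (p - RtoC (a O) + RtoC (a m) * w ^ S m) + RtoC (a m) * w ^ S m)%C with (RtoC (a O)) in T2 by ring.
rewrite Cmod_opp in T1; rewrite Cmod_R, Cmod_mult, Cmod_R, !Rabs_pos_eq in T2 by lra.
assert (a m * Cmod (w ^ S m) <= a m * Cmod w) by (apply Rmult_le_compat_l; lra).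
lra.
Qed.

(** The bound is attained at [w = - q]. After clearing denominators and using [Re w >= - m] with
    [m = Cmod w], it becomes [(q - m) (1 + m) >= 0]. *)
Lemma Re_quotient_lower (w : C) (q : R) : Cmod w <= q -> q < 1 ->
  - q / (1 + q) <= Re (w / (1 - w)).
Proof.
intros Hw Hq; assert (W := Cmod_ge_0 w).
destruct w as [x y].
assert (M : Cmod (x, y) ^ 2 = x ^ 2 + y ^ 2) by (rewrite Cmod2_alt; reflexivity).
set (m := Cmod (x, y)) in *.
assert (Hx : - m <= x <= m).
{ assert (K := re_le_Cmod (x, y)); apply Rabs_le_between in K; exact K. }
assert (D : 0 < (1 - x) ^ 2 + y ^ 2) by (simpl; nra).
replace (Re ((x, y) / (1 - (x, y)))) with ((x - (x ^ 2 + y ^ 2)) / ((1 - x) ^ 2 + y ^ 2))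
  by (simpl; field; simpl in *; nra).
rewrite <- M.
apply Rmult_le_reg_r with ((1 + q) * ((1 - x) ^ 2 + y ^ 2)); [apply Rmult_lt_0_compat; lra|].
replace (- q / (1 + q) * ((1 + q) * ((1 - x) ^ 2 + y ^ 2))) with (- q * ((1 - x) ^ 2 + y ^ 2)) by (field; lra).
replace ((x - m ^ 2) / ((1 - x) ^ 2 + y ^ 2) * ((1 + q) * ((1 - x) ^ 2 + y ^ 2))) with ((x - m ^ 2) * (1 + q)) by (field; lra).
replace ((1 - x) ^ 2 + y ^ 2) with (1 - 2 * x + m ^ 2) by (rewrite M; ring).
assert ((q - m) * (1 + m) >= 0) by nra; nra.
Qed.

(** One of the two factors [p ^ n] in [(p ^ 2) ^ n] absorbs the linear factor, by Bernoulli's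
    inequality for [(/ p) ^ n]; the other one tends to [0]. *)
Lemma arith_geometric_small (p eps : R) : 0 < p < 1 -> 0 < eps ->
  exists m : nat, (INR m + 2) * (p ^ 2) ^ (m + 2) <= eps.
Proof.
intros Hp Heps; set (t := / p - 1).
assert (Ht : 0 < t).
{ unfold t; assert (1 < / p); [rewrite <- Rinv_1; apply Rinv_lt_contravar; lra|lra]. }
destruct (pow_lt_1_zero p) with (y := eps * t) as [N HN].
{ rewrite Rabs_pos_eq; lra. }
{ apply Rmult_lt_0_compat; assumption. }
exists N; specialize (HN (N + 2)%nat ltac:(lia)).
rewrite Rabs_pos_eq in HN by (apply pow_le; lra).
assert (K := poly (N + 2) t Ht).
replace (1 + t) with (/ p) in K by (unfold t; ring).
rewrite pow_inv, plus_INR in K; simpl (INR 2) in K.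
assert (Hpn : 0 < p ^ (N + 2)) by (apply pow_lt; lra).
replace ((p ^ 2) ^ (N + 2)) with (p ^ (N + 2) * p ^ (N + 2)) by (rewrite <- Rpow_mult_distr; f_equal; ring).
set (P := p ^ (N + 2)) in *; set (n := INR N) in *.
assert (Hn : 0 <= n) by apply pos_INR.
assert (K' : (n + 2) * t * P <= 1).
{ apply Rmult_le_compat_r with (r := P) in K; [|lra]; rewrite Rinv_l in K by lra; nra. }
apply Rmult_le_reg_r with t; [exact Ht|].
apply Rle_trans with ((n + 2) * t * P * P); [right; ring|].
apply Rle_trans with (1 * P); [apply Rmult_le_compat_r; lra|lra].
Qed.

(** Taylor coefficients of [(1 - w)^(- s)]. *)
Fixpoint binom_coef (s : R) (n : nat) : R :=
  match n with
  | O => 1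
  | S n' => binom_coef s n' * ((INR n' + s) / (INR n' + 1))
  end.

Section BinomialCoefficients.

Variable s : R.
Hypothesis Hs : 0 < s <= 1.

Lemma binom_coef_pos n : 0 < binom_coef s n.
Proof.
induction n as [|n IH]; simpl; [lra|]; assert (H := pos_INR n).
apply Rmult_lt_0_compat; [exact IH|apply Rdiv_lt_0_compat; lra].
Qed.

Lemma binom_coef_decr n : 0 <= binom_coef s (S n) <= binom_coef s n.
Proof.
split; [apply Rlt_le, binom_coef_pos|].
simpl; rewrite <- (Rmult_1_r (binom_coef s n)) at 2; assert (H := pos_INR n).
apply Rmult_le_compat_l; [apply Rlt_le, binom_coef_pos|].
apply Rmult_le_reg_r with (INR n + 1); [lra|].
replace ((INR n + s) / (INR n + 1) * (INR n + 1)) with (INR n + s) by (field; lra); lra.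
Qed.

Lemma binom_coef_le_1 n : binom_coef s n <= 1.
Proof.
induction n as [|n IH]; [simpl; lra|]; assert (H := binom_coef_decr n); lra.
Qed.

Lemma pderiv_binom_coef n : pderiv (binom_coef s) n = (INR n + s) * binom_coef s n.
Proof. unfold pderiv; rewrite S_INR; simpl; field; generalize (pos_INR n); lra. Qed.

(** The function [(1 - w)^(- s)] solves [(1 - w) y' = s y]; a truncated series satisfies this up to
    a single term of top degree. *)
Lemma binom_coef_ode m (w : C) :
  ((1 - w) * psum (pderiv (binom_coef s)) m w =
   RtoC s * psum (binom_coef s) (S m) w - RtoC (pderiv (binom_coef s) (S m)) * w ^ S m)%C.
Proof.
induction m as [|m IH].
- simpl psum; rewrite !pderiv_binom_coef; simpl binom_coef; simpl INR.
  replace ((0 + s) * 1) with s by ring; replace (1 * ((0 + s) / (0 + 1))) with s by field.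
  rewrite RtoC_mult, RtoC_plus; simpl; ring.
- change (psum (pderiv (binom_coef s)) (S m) w)
    with (psum (pderiv (binom_coef s)) m w + RtoC (pderiv (binom_coef s) (S m)) * w ^ S m)%C.
  rewrite Cmult_plus_distr_l, IH.
  change (psum (binom_coef s) (S (S m)) w)
    with (psum (binom_coef s) (S m) w + RtoC (binom_coef s (S (S m))) * w ^ S (S m))%C.
  assert (E : RtoC (pderiv (binom_coef s) (S (S m))) =
    (RtoC (pderiv (binom_coef s) (S m)) + RtoC s * RtoC (binom_coef s (S (S m))))%C).
  { rewrite <- RtoC_mult, <- RtoC_plus; f_equal; rewrite pderiv_binom_coef; unfold pderiv; ring. }
  rewrite E; simpl Cpow; ring.
Qed.

End BinomialCoefficients.

(** * Maps of the form [phi(tau x) x] *)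

Section RadialMap.

Variable X0 : CompleteNormedModule C_AbsRing.
Local Notation X := (CompleteNormedModule.NormedModule C_AbsRing X0).

Variable tau : blin X C_NormedModule.
Hypothesis Htau : norm tau = 1.
Variables phi phi' g g' : C -> C.
Hypothesis Hphi : forall z, cderiv (V := C_NormedModule) phi z (phi' z).
Hypothesis Hg : forall z, cderiv (V := C_NormedModule) g z (g' z).
Hypothesis Hgphi : forall z, (phi z + z * phi' z)%C = g z.
Hypothesis phi_0 : phi 0%C = RtoC 1.
Hypothesis phi_neq_0 : forall z : C, Cmod z < 1 -> phi z <> 0%C.
Hypothesis g_neq_0 : forall z : C, Cmod z < 1 -> g z <> 0%C.

Let f (x : X) : X := scal (phi (tau x)) x.

(** The product rule for [scal] takes its scalar factor in the ring's own module structure. Both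
    structures have the modulus as norm, and the remainder condition sees nothing else of the
    target. *)
Lemma filterdiff_C_AbsRing {U : NormedModule C_AbsRing} (h l : U -> C) (x : U) :
  @filterdiff C_AbsRing U C_NormedModule h (locally x) l ->
  @filterdiff C_AbsRing U (AbsRing_NormedModule C_AbsRing) h (locally x) l.
Proof. intros [[H1 H2 H3] H]; split; [split; assumption|exact H]. Qed.

Lemma radial_map_filterdiff (x : X) :
  filterdiff f (locally x)
    (fun v => plus (scal (phi' (tau x) * tau v)%C x) (scal (phi (tau x)) v)).
Proof.
assert (D : @filterdiff C_AbsRing X C_NormedModule (fun x => phi (tau x)) (locally x)
  (fun v => (tau v * phi' (tau x))%C)).
{ apply (filterdiff_comp' (V := C_NormedModule) tau phi x tau (fun h => (h * phi' (tau x))%C)).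
  - apply filterdiff_linear; exact (proj2_sig tau).
  - exact (Hphi (tau x)). }
apply filterdiff_C_AbsRing in D.
eapply filterdiff_ext_lin.
- apply (filterdiff_scal_fct x (fun x => phi (tau x)) (fun x => x) _ _ Cmult_comm D (filterdiff_id _)).
- intros v; simpl; f_equal; f_equal; apply Cmult_comm.
Qed.

Lemma radial_map_frechet (x v : X) :
  frechet f x v = plus (scal (phi' (tau x) * tau v)%C x) (scal (phi (tau x)) v).
Proof. exact (frechet_eq f x _ (radial_map_filterdiff x) v). Qed.

(** On the complex line through [x] everything reduces to one variable: the factor is [h'] for
    [h = z phi], evaluated at [z * tau x]. *)
Lemma radial_map_frechet_radial (x : X) (z : C) :
  frechet f (scal z x) x = scal (g (z * tau x)%C) x.
Proof.
rewrite radial_map_frechet, blin_fun_scal.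
change (scal z (tau x)) with (z * tau x)%C.
rewrite <- Hgphi; lmod X.
Qed.

Lemma tau_lt_1 (x : X) : norm x < 1 -> Cmod (tau x) < 1.
Proof.
intros Hx; apply Rle_lt_trans with (norm x); [|exact Hx].
rewrite <- (Rmult_1_l (norm x)), <- Htau; exact (blin_fun_bound tau x).
Qed.

Lemma radial_map_holomorphic : holomorphic f.
Proof. intros x _; eexists; apply radial_map_filterdiff. Qed.

Lemma radial_map_inverse (x : X) : unit_ball x -> exists G : blin X X, is_inverse (frechet f x) G.
Proof.
intros Hx; assert (Hz := tau_lt_1 x Hx).
assert (Hp := phi_neq_0 (tau x) Hz); assert (Hgz := g_neq_0 (tau x) Hz).
assert (Lid : @is_linear C_AbsRing X X (fun y => y)).
{ split; [reflexivity|reflexivity|]; exists 1; split; [lra|]; intros y; lra. }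
assert (Lr : @is_linear C_AbsRing X X (fun y => scal (tau y : C) x)).
{ exact (is_linear_comp tau (fun h : C_NormedModule => scal h x) (proj2_sig tau) (is_linear_scal_C x)). }
(* The derivative is [phi] times the identity plus an operator of rank one; this is the
   Sherman-Morrison inverse, whose denominator [phi + tau x * phi'] is [g]. *)
set (G := scal (/ phi (tau x))%C (minus (exist _ _ Lid : blin X X)
   (scal (phi' (tau x) / g (tau x))%C (exist _ _ Lr : blin X X))) : blin X X).
assert (EG : forall y, G y = scal (/ phi (tau x))%C (minus y (scal (phi' (tau x) / g (tau x))%C (scal (tau y : C) x)))).
{ reflexivity. }
exists G; split; intros y.
- rewrite EG, radial_map_frechet, blin_fun_plus, !blin_fun_scal.
  change (plus (scal (phi' (tau x) * tau y)%C (tau x)) (scal (phi (tau x)) (tau y)))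
    with (phi' (tau x) * tau y * tau x + phi (tau x) * tau y)%C.
  replace (phi' (tau x) * tau y * tau x + phi (tau x) * tau y)%C with (g (tau x) * tau y)%C
    by (rewrite <- Hgphi; ring).
  lmod X.
- rewrite radial_map_frechet, EG, blin_fun_scal, blin_fun_minus, !blin_fun_scal.
  set (p := phi (tau x)) in *; set (p' := phi' (tau x)) in *; set (t := tau y : C).
  change (scal (/ p)%C (minus t (scal (p' / g (tau x))%C (scal t (tau x)))))
    with (/ p * (t - p' / g (tau x) * (t * tau x)))%C.
  assert (E : g (tau x) = (p + tau x * p')%C) by (unfold p, p'; now rewrite Hgphi).
  rewrite E in *; set (z := tau x : C) in *.
  lmod X.
Qed.

(** The second derivative is never computed in general directions: [z |-> Df(z x) x] is
    differentiated in two ways, and derivatives are unique. *)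
Lemma radial_map_second (x : X) (z : C) : norm (scal z x) < 1 ->
  blin_fun (blin_fun (Dm 2 f (scal z x)) x) x = scal (tau x * g' (z * tau x))%C x.
Proof.
intros Hz.
destruct (holomorphic_Dm_diff X0 f radial_map_holomorphic (scal z x) Hz) as [D _].
apply frechet_correct in D.
assert (H := cderiv_comp_filterdiff (fun z : C => scal z x) z x _ _ D (cderiv_smul x z)).
apply (cderiv_comp_linear (V := multi X 1) _ z _ _ (is_linear_eval (U := X) (V := X) x)) in H.
apply (cderiv_unique (V := X) (fun z : C => scal (g (z * tau x)%C) x) z).
- apply (cderiv_ext (V := X)) with (2 := H); intros y; apply radial_map_frechet_radial.
- assert (K : cderiv (V := C_NormedModule) (fun z : C => g (z * tau x)%C) z (tau x * g' (z * tau x))%C).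
  { apply (cderiv_comp (V := C_NormedModule) g (fun z => z * tau x)%C z (tau x)); [apply Hg|].
    apply (cderiv_eq_C _ _ (1 * tau x + z * 0)%C); [ring|].
    apply (cderiv_mult (fun z => z) (fun _ => tau x)); [apply cderiv_id|apply cderiv_const_C]. }
  exact (cderiv_comp_linear (V := C_NormedModule) _ z _ (fun h : C => scal h x) (is_linear_scal_C x) K).
Qed.

Lemma radial_map_inverse_radial (x : X) (z k : C) : norm (scal z x) < 1 ->
  inverse (frechet f (scal z x)) (scal k x) = scal (k / g (z * tau x))%C x.
Proof.
intros Hz; assert (H := inverse_correct _ (radial_map_inverse (scal z x) Hz)).
assert (Hgz : g (z * tau x)%C <> 0%C).
{ apply g_neq_0; assert (K := tau_lt_1 _ Hz); rewrite blin_fun_scal in K; exact K. }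
replace (scal k x) with (scal (k / g (z * tau x))%C (frechet f (scal z x) x)).
- rewrite blin_fun_scal; f_equal; apply (proj1 H).
- rewrite radial_map_frechet_radial; lmod X.
Qed.

(** The vector in question is [x] multiplied by [1 + z g'(z) / g(z)] at [z = tau x], so every
    support functional at [x] yields the same condition. *)
Lemma radial_map_quasi_convex (alpha : R) :
  (forall z : C, Cmod z < 1 -> alpha <= Re (1 + z * g' z / g z)%C) ->
  quasi_convex_B alpha f.
Proof.
intros HRe.
assert (t0 : tau zero = RtoC 0).
{ exact (linear_zero _ (proj2_sig tau)). }
split; [split|split; [split|]].
- unfold f; lmod X.
- intros y; rewrite radial_map_frechet, t0, phi_0; lmod X.
- exact radial_map_holomorphic.
- exact radial_map_inverse.
- intros x T Hx Hx0 [HT HTx].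
  assert (E1 : scal (RtoC 1) x = x) by exact (scal_one x).
  assert (Hx1 : norm (scal (RtoC 1) x) < 1) by (rewrite E1; exact Hx).
  assert (HA := radial_map_frechet_radial x (RtoC 1)).
  assert (HD := radial_map_second x (RtoC 1) Hx1).
  assert (HI := fun k => radial_map_inverse_radial x (RtoC 1) k Hx1).
  rewrite E1, Cmult_1_l in HA, HD.
  assert (Hgz := g_neq_0 _ (tau_lt_1 x Hx)).
  assert (E : inverse (frechet f x) (Hierarchy.plus (diag 2 (Dm 2 f x) x) (frechet f x x)) =
    scal (1 + tau x * g' (tau x) / g (tau x))%C x).
  { transitivity (inverse (frechet f x) (scal (tau x * g' (tau x) + g (tau x))%C x)).
    - f_equal; transitivity (plus (scal (tau x * g' (tau x))%C x) (scal (g (tau x)) x)); [|lmod X].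
      exact (f_equal2 plus HD HA).
    - specialize (HI (tau x * g' (tau x) + g (tau x))%C); rewrite E1, Cmult_1_l in HI.
      rewrite HI; f_equal; field; exact Hgz. }
  rewrite E, blin_fun_scal, HTx.
  specialize (HRe _ (tau_lt_1 x Hx)).
  change (scal (1 + tau x * g' (tau x) / g (tau x))%C (RtoC (norm x) : C_NormedModule))
    with ((1 + tau x * g' (tau x) / g (tau x)) * RtoC (norm x))%C.
  replace (Re ((1 + tau x * g' (tau x) / g (tau x)) * RtoC (norm x)))
    with (Re (1 + tau x * g' (tau x) / g (tau x)) * norm x)
    by (destruct (1 + tau x * g' (tau x) / g (tau x))%C; simpl; ring).
  apply Rmult_le_compat_r; [apply norm_ge_0|exact HRe].
Qed.

Lemma radial_map_third (u : X) (r : R) (d : C) : norm u = 1 -> tau u = RtoC 1 ->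
  cderiv (V := C_NormedModule) (fun z => g' z / g z)%C 0%C d ->
  third_functional f (scal (RtoC r) u) tau = (RtoC (r ^ 3 / 6) * d)%C.
Proof.
intros Hu Htu Hd; rewrite third_functional_radial; f_equal.
assert (Hn : normalized f).
{ assert (t0 : tau zero = RtoC 0) by exact (linear_zero _ (proj2_sig tau)).
  split; [unfold f; lmod X|]; intros y; rewrite radial_map_frechet, t0, phi_0; lmod X. }
assert (H := radial_quotient_deriv_0 X0 f u Hn (conj radial_map_holomorphic radial_map_inverse) Hu).
apply (cderiv_comp_linear (radial_quotient X0 f u) _ _ tau (proj2_sig tau)) in H.
apply (cderiv_unique (V := C_NormedModule) _ _ _ _ H).
apply (cderiv_ext_loc (V := C_NormedModule)) with (r := 1) (3 := Hd); [lra|].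
intros y Hy; replace (y - 0)%C with y in Hy by ring.
assert (Hyu : norm (scal y u) < 1) by now apply norm_scal_lt_1.
unfold radial_quotient; rewrite radial_map_second, radial_map_inverse_radial by exact Hyu.
rewrite blin_fun_scal, Htu, (Cmult_1_r y).
change ((g' y / g y)%C = (1 * g' y / g y * 1)%C); unfold Cdiv; ring.
Qed.

End RadialMap.

(** * Sharpness of the constant *)

Theorem third_functional_constant_sharp (X0 : CompleteNormedModule C_AbsRing) (alpha c : R) :
  (exists x : X0, x <> Hierarchy.zero) -> 0 <= alpha < 1 ->
  (forall f : X0 -> X0, quasi_convex_B alpha f ->
     forall (x : X0) (T : blin X0 C_NormedModule),
       unit_ball x -> x <> Hierarchy.zero -> support_functional x T ->
       Cmod (third_functional f x T) <= c * norm x ^ 3) ->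
  (1 - alpha) / 3 <= c.
Proof.
intros [x0 Hx0] Ha Hc.
set (X := CompleteNormedModule.NormedModule C_AbsRing X0) in *.
set (s := 1 - alpha); assert (Hs : 0 < s <= 1) by (unfold s; lra).
assert (Hn0 : 0 < @norm C_AbsRing X x0).
{ destruct (norm_ge_0 (x0 : X)) as [H|H]; [exact H|]; elim Hx0; apply (norm_eq_zero (V := X)); now symmetry. }
set (u := scal (RtoC (/ norm (x0 : X))) (x0 : X) : X).
assert (Hu : norm u = 1).
{ unfold u; rewrite norm_scal_eq, Cmod_R, Rabs_pos_eq by (apply Rlt_le, Rinv_0_lt_compat, Hn0).
  field; lra. }
destruct (norming_functional u Hu) as [tau [Htau Htu]].
assert (Hkey : forall p, 0 < p < 1 -> p ^ 2 * s / 3 <= c).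
(* Writing [q] as a square fits [arith_geometric_small]; in the variable [z] it is the dilation by
   [p]. *)
{ intros p Hp; set (q := p ^ 2).
  assert (Hq : 0 < q < 1) by (unfold q; simpl; nra).
  (* The margin gained by dilation is [s (1 - q) / (1 + q)]. The error term enters with a factor
     [2], and the second [1 - q] pays for the denominator, which is at least [1 - q] by
     Eneström-Kakeya. *)
  destruct (arith_geometric_small p (s * (1 - q) * (1 - q) / (2 * (1 + q))) Hp) as [m Hm].
  { apply Rdiv_lt_0_compat; [repeat apply Rmult_lt_0_compat|]; lra. }
  fold q in Hm.
  set (a := binom_coef s).
  (* Termwise integration of [g], a polynomial in [z^2]: dividing by [2 n + 1] makes the derivative
     of [z * phi z] equal to [g]. *)
  set (d := fun n => a n / (2 * INR n + 1)).
  set (W := fun z : C => (RtoC q * (z * z))%C).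
  set (phi := fun z => psum d (S m) (W z)).
  set (phi' := fun z => (RtoC (2 * q) * z * psum (pderiv d) m (W z))%C).
  set (g := fun z => psum a (S m) (W z)).
  set (g' := fun z => (RtoC (2 * q) * z * psum (pderiv a) m (W z))%C).
  assert (HW : forall z, cderiv (V := C_NormedModule) W z (RtoC (2 * q) * z)%C).
  { intros z; apply (cderiv_eq_C _ _ (0 * (z * z) + RtoC q * (1 * z + z * 1))%C).
    - rewrite RtoC_mult; ring.
    - apply (cderiv_mult (fun _ => RtoC q) (fun z => z * z)%C); [apply cderiv_const_C|].
      apply (cderiv_mult (fun z => z) (fun z => z)); apply cderiv_id. }
  assert (HWm : forall z : C, Cmod z < 1 -> Cmod (W z) <= q).
  { intros z Hz; unfold W; rewrite !Cmod_mult, Cmod_R, Rabs_pos_eq by lra.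
    assert (Z := Cmod_ge_0 z); assert (Cmod z * Cmod z <= 1) by nra; apply Rle_trans with (q * 1); [apply Rmult_le_compat_l|]; lra. }
  assert (Hphi : forall z, cderiv (V := C_NormedModule) phi z (phi' z)).
  { intros z; exact (cderiv_comp (V := C_NormedModule) (psum d (S m)) W z _ _ (cderiv_psum d m (W z)) (HW z)). }
  assert (Hg : forall z, cderiv (V := C_NormedModule) g z (g' z)).
  { intros z; exact (cderiv_comp (V := C_NormedModule) (psum a (S m)) W z _ _ (cderiv_psum a m (W z)) (HW z)). }
  assert (Hgphi : forall z, (phi z + z * phi' z)%C = g z).
  { intros z; unfold phi, phi', g.
    replace (z * (RtoC (2 * q) * z * psum (pderiv d) m (W z)))%C with
      (RtoC 2 * (W z * psum (pderiv d) m (W z)))%C by (unfold W; rewrite RtoC_mult; ring).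
    rewrite psum_log_deriv, <- psum_scal, <- psum_plus; apply psum_ext.
    intros n; unfold d; field; generalize (pos_INR n); lra. }
  assert (Hdd : forall n, 0 <= d (S n) <= d n).
  { intros n; assert (K := binom_coef_decr s Hs n); fold a in K; assert (N := pos_INR n); unfold d; split.
    - apply Rmult_le_pos; [lra|]; apply Rlt_le, Rinv_0_lt_compat; rewrite S_INR; lra.
    - apply Rmult_le_compat; try lra; [apply Rlt_le, Rinv_0_lt_compat; rewrite S_INR; lra|].
      apply Rinv_le_contravar; rewrite ?S_INR; lra. }
  assert (Hnz : forall b, b O = 1 -> (forall n, 0 <= b (S n) <= b n) ->
    forall w, Cmod w < 1 -> psum b (S m) w <> 0%C).
  { intros b Hb0 Hb w Hw E; assert (K := enestrom_kakeya b (S m) w Hb ltac:(lra)).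
    rewrite E, Cmult_0_r, Cmod_0, Hb0 in K; lra. }
  assert (phi_0 : phi 0%C = RtoC 1).
  { unfold phi; replace (W 0%C) with (RtoC 0) by (unfold W; ring); rewrite psum_0; unfold d, a; simpl.
    f_equal; field. }
  assert (g_0 : g 0%C = RtoC 1).
  { unfold g; replace (W 0%C) with (RtoC 0) by (unfold W; ring); now rewrite psum_0. }
  assert (phi_neq_0 : forall z : C, Cmod z < 1 -> phi z <> 0%C).
  { intros z Hz; apply Hnz; [unfold d, a; simpl; field|exact Hdd|specialize (HWm z Hz); lra]. }
  assert (g_neq_0 : forall z : C, Cmod z < 1 -> g z <> 0%C).
  { intros z Hz; apply Hnz; [reflexivity|exact (binom_coef_decr s Hs)|specialize (HWm z Hz); lra]. }
  assert (HRe : forall z : C, Cmod z < 1 -> alpha <= Re (1 + z * g' z / g z)%C).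
  { intros z Hz; specialize (HWm z Hz); set (w := W z) in *.
    assert (Hgz := g_neq_0 z Hz); unfold g in Hgz; fold w in Hgz.
    assert (W0 := Cmod_ge_0 w).
    assert (H1w : (1 - w)%C <> 0%C).
    { intros E; assert (w = RtoC 1) as E1 by (replace w with (1 - (1 - w))%C by ring; rewrite E; ring).
      rewrite E1, Cmod_1 in HWm; lra. }
    set (rem := (RtoC (pderiv a (S m)) * w ^ S m)%C).
    assert (Hode := binom_coef_ode s m w); fold a in Hode; fold rem in Hode.
    (* The truncated differential equation splits the logarithmic derivative into that of the exact
       power and an error controlled by [rem]. *)
    assert (E : (z * g' z / g z)%C =
      (RtoC (2 * s) * (w / (1 - w)) - RtoC 2 * (w * rem / ((1 - w) * psum a (S m) w)))%C).
    { unfold g', g; fold w.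
      replace (z * (RtoC (2 * q) * z * psum (pderiv a) m w))%C with
        (RtoC 2 * w * psum (pderiv a) m w)%C by (unfold w, W; rewrite RtoC_mult; ring).
      replace (psum (pderiv a) m w) with ((RtoC s * psum a (S m) w - rem) / (1 - w))%C
        by (rewrite <- Hode; field; exact H1w).
      rewrite RtoC_mult; field; split; assumption. }
    assert (HEK := enestrom_kakeya a (S m) w (binom_coef_decr s Hs) ltac:(lra)).
    change (a O) with 1 in HEK; rewrite Rmult_1_l in HEK.
    set (D := ((1 - w) * psum a (S m) w)%C) in *.
    assert (HD : D <> 0%C) by now apply Cmult_neq_0.
    assert (Hrem : Cmod (w * rem / D) <= s * (1 - q) / (2 * (1 + q))).
    { rewrite Cmod_div by exact HD; unfold rem; rewrite !Cmod_mult, Cmod_R, Cmod_pow.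
      unfold a; rewrite pderiv_binom_coef by exact Hs; fold a.
      assert (Pa := binom_coef_pos s Hs (S m)); assert (La := binom_coef_le_1 s Hs (S m)); fold a in Pa, La.
      assert (Pm := pos_INR (S m)); rewrite Rabs_pos_eq by (apply Rmult_le_pos; lra).
      apply Rmult_le_reg_r with (Cmod D); [lra|].
      unfold Rdiv at 1; rewrite Rmult_assoc, Rinv_l, Rmult_1_r by lra.
      apply Rle_trans with ((INR m + 2) * q ^ (m + 2)).
      - replace (Cmod w * ((INR (S m) + s) * a (S m) * Cmod w ^ S m))
          with ((INR (S m) + s) * a (S m) * Cmod w ^ (m + 2))
          by (replace (m + 2)%nat with (S (S m)) by lia; simpl; ring).
        apply Rmult_le_compat; [apply Rmult_le_pos; lra|apply pow_le, W0| |apply pow_incr; lra].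
        rewrite S_INR in *; nra.
      - apply Rle_trans with (1 := Hm).
        apply Rle_trans with (s * (1 - q) / (2 * (1 + q)) * (1 - q)); [right; field; lra|].
        apply Rmult_le_compat_l; [|lra].
        apply Rmult_le_pos; [nra|apply Rlt_le, Rinv_0_lt_compat; lra]. }
    rewrite E.
    assert (Hlow := Re_quotient_lower w q HWm (proj2 Hq)).
    set (A := (w / (1 - w))%C) in *; set (B := (w * rem / D)%C) in *.
    replace (Re (1 + (RtoC (2 * s) * A - RtoC 2 * B))) with (1 + 2 * s * Re A - 2 * Re B)
      by (destruct A, B; simpl; ring).
    assert (HB := Re_le_Cmod B).
    assert (s * Re A >= s * (- q / (1 + q))) by (apply Rle_ge, Rmult_le_compat_l; lra).
    (* The budget balances exactly: the worst case of the main term and the largest admissible error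
       leave [1 - s], which is [alpha]. *)
    assert (Eq : 1 - 2 * s * (q / (1 + q)) - 2 * (s * (1 - q) / (2 * (1 + q))) = 1 - s * ((1 + q) / (1 + q)))
      by (field; lra).
    replace ((1 + q) / (1 + q)) with 1 in Eq by (field; lra).
    unfold Rdiv in *; unfold s in *; lra. }
  assert (Hder : cderiv (V := C_NormedModule) (fun z => g' z / g z)%C 0%C (RtoC (2 * q * s))).
  (* Since [g' / g = z k(z)], the derivative at [0] is just [k 0 = 2 q s], whatever the derivative
     of [k] is. *)
  { set (k := fun z => (RtoC (2 * q) * (psum (pderiv a) m (W z) / g z))%C).
    assert (Hm1 : exists e, cderiv (V := C_NormedModule) (fun z => psum (pderiv a) m (W z)) 0%C e).
    { destruct m as [|m'].
      - eexists; exact (cderiv_const_C _ _).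
      - eexists; exact (cderiv_comp (V := C_NormedModule) (psum (pderiv a) (S m')) W 0%C _ _
          (cderiv_psum (pderiv a) m' (W 0%C)) (HW 0%C)). }
    destruct Hm1 as [e He].
    assert (Hk : exists e, cderiv (V := C_NormedModule) k 0%C e).
    { eexists; apply (cderiv_mult (fun _ => RtoC (2 * q))); [apply cderiv_const_C|].
      apply (cderiv_mult (fun z => psum (pderiv a) m (W z)) (fun z => / g z)%C); [exact He|].
      apply (cderiv_comp (V := C_NormedModule) (fun z => / z)%C g); [|apply Hg].
      apply cderiv_inv; rewrite g_0; intros E; apply RtoC_inj in E; lra. }
    destruct Hk as [e' He'].
    apply (cderiv_ext (V := C_NormedModule) (fun z => z * k z)%C).
    { intros z; unfold k, g', Cdiv; match goal with |- ?x = ?y => change (x = y :> C) end; ring. }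
    apply (cderiv_eq_C _ _ (1 * k 0%C + 0 * e')%C).
    - unfold k; rewrite g_0; replace (W 0%C) with (RtoC 0) by (unfold W; ring).
      rewrite psum_0; unfold a; rewrite pderiv_binom_coef by exact Hs; simpl.
      replace ((0 + s) * 1) with s by ring; rewrite !RtoC_mult; field.
    - apply (cderiv_mult (fun z => z) k); [apply cderiv_id|exact He']. }
  set (f := fun x : X => scal (phi (tau x)) x).
  assert (Hf := radial_map_quasi_convex X0 tau Htau phi phi' g g' Hphi Hg Hgphi phi_0 phi_neq_0 g_neq_0 alpha HRe).
  assert (H3 := radial_map_third X0 tau Htau phi phi' g g' Hphi Hg Hgphi phi_0 phi_neq_0 g_neq_0
    u (/ 2) (RtoC (2 * q * s)) Hu Htu Hder).
  (* At radius [1 / 2] the functional has modulus [(1 / 48) * 2 q s], to be compared with [c / 8];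
     this is [q s / 3 <= c]. *)
  set (x := scal (RtoC (/ 2)) u : X) in *.
  assert (Nx : norm x = / 2) by (unfold x; rewrite norm_scal_eq, Hu, Cmod_R, Rabs_pos_eq; lra).
  assert (Hx1 : unit_ball x) by (unfold unit_ball; lra).
  assert (Hx2 : x <> zero) by (intros E; rewrite E, (norm_zero (V := X)) in Nx; lra).
  assert (Hx3 : support_functional x tau).
  { split; [exact Htau|]; rewrite Nx; unfold x; rewrite blin_fun_scal, Htu; exact (Cmult_1_r _). }
  assert (Hb : Cmod (RtoC ((/ 2) ^ 3 / 6) * RtoC (2 * q * s)) <= c * norm x ^ 3).
  { rewrite <- H3; exact (Hc f Hf x tau Hx1 Hx2 Hx3). }
  rewrite Cmod_mult, !Cmod_R, !Rabs_pos_eq in Hb; [| |lra].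
  2:{ apply Rmult_le_pos; [apply Rmult_le_pos|]; lra. }
  rewrite Nx in Hb; simpl in Hb; fold q; lra. }
destruct (Rle_or_lt (s / 3) c) as [H|H]; [exact H|exfalso].
assert (Hc0 : 0 < c).
{ specialize (Hkey (/ 2) ltac:(lra)); simpl in Hkey; lra. }
(* If [c < s / 3] then [k < 1], and [p = (1 + k) / 2] has [p ^ 2 > k], contradicting
   [p ^ 2 * s / 3 <= c = k * s / 3]. *)
set (k := 3 * c / s).
assert (Hk : 0 < k < 1).
{ unfold k; split; [apply Rdiv_lt_0_compat; lra|].
  apply Rmult_lt_reg_r with s; [lra|]; replace (3 * c / s * s) with (3 * c) by (field; lra); lra. }
specialize (Hkey ((1 + k) / 2) ltac:(lra)).
assert (Ek : c = k * s / 3) by (unfold k; field; lra).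
assert (((1 + k) / 2) ^ 2 > k) by (simpl; nra).
nra.
Qed.

End Development.

Theorem theorem2p1 (X : CompleteNormedModule C_AbsRing) (alpha : R) :
  (exists x : X, x <> zero) ->
  0 <= alpha < 1 ->
  (forall f : X -> X, quasi_convex_B alpha f ->
     forall (x : X) (T : blin X C_NormedModule),
       unit_ball x -> x <> zero -> support_functional x T ->
       Cmod (third_functional f x T) <= (1 - alpha) / 3 * norm x ^ 3)
  /\
  (forall c : R,
     (forall f : X -> X, quasi_convex_B alpha f ->
        forall (x : X) (T : blin X C_NormedModule),
          unit_ball x -> x <> zero -> support_functional x T ->
          Cmod (third_functional f x T) <= c * norm x ^ 3) ->
     (1 - alpha) / 3 <= c).
Proof.
intros Hne Ha; split.
- intros f Hf x T; apply (third_functional_bound X f alpha x T (proj2 Ha) Hf).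
- intros c; exact (third_functional_constant_sharp X alpha c Hne Ha).
Qed.
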